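(* Let $(\Omega,\mu)$ be a $\sigma$-finite measure space, let $1\leq p<\infty$ and let $(e_k)_{k\geq1}$ be an $R$-basis of $L^p(\Omega,\mu)$. Then there exists a density $g$ on $\Omega$ such that $\phi_{p,g}(e_k)\in L^2(g\,d\mu)$ for any $k\geq1$, and the sequence $(\phi_{p,g}(e_k))_{k\geq1}$ is a basis of $L^2(g\,d\mu)$.
   Context: All spaces are complex. A density on $(\Omega,\mu)$ is a measurable function $g\colon\Omega\to(0,\infty)$ with $\Vert g\Vert_{L^1(\mu)}=1$. For such $g$ and $1\leq p<\infty$, $\phi_{p,g}\colon L^p(\Omega,\mu)\to L^p(\Omega,g\,d\mu)$ is the isometric isomorphism $\phi_{p,g}(h)=g^{-1/p}h$. $L^2(g\,d\mu)$ means $L^2(\Omega,g\,d\mu)$. A sequence $(e_k)_{k\geq1}$ in a Banach space $X$ is a basis if for every $x\in X$ there is a unique scalar sequence $(a_k)_{k\geq1}$ such that $\sum_k a_ke_k$ converges to $x$. The associated projections are $P_N\colon X\to X$, $P_N(\sum_k a_ke_k)=\sum_{k=1}^N a_ke_k$. The basis is an $R$-basis if the set $\{P_N: N\geq1\}\subset B(X)$ is $R$-bounded. $R$-boundedness: let $(\epsilon_k)_{k\geq1}$ be independent Rademacher variables on a probability space $\Omega_0$ and put $\Vert\sum_k\epsilon_k\otimes x_k\Vert_{\mathrm{Rad}(X)}=\bigl(\int_{\Omega_0}\Vert\sum_k\epsilon_k(\lambda)x_k\Vert_X^2\,d\lambda\bigr)^{1/2}$. A set $\tau\subset B(X)$ is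 $R$-bounded if there is $C\geq0$ such that $\Vert\sum_k\epsilon_k\otimes T_kx_k\Vert_{\mathrm{Rad}(X)}\leq C\Vert\sum_k\epsilon_k\otimes x_k\Vert_{\mathrm{Rad}(X)}$ for all finite families $T_1,\dots,T_n\in\tau$ (repetitions allowed) and $x_1,\dots,x_n\in X$. *)

(* Defs.v *)
From HB Require Import structures.
From mathcomp Require Import all_boot all_order all_algebra finmap.
From mathcomp Require Import all_classical all_reals all_analysis.
From mathcomp Require Import measurable_realfun complex.

Set Implicit Arguments.
Unset Strict Implicit.
Unset Printing Implicit Defensive.
Import Order.TTheory GRing.Theory Num.Theory.
Import numFieldNormedType.Exports.
Import ComplexField.Normc.

Local Open Scope classical_set_scope.
Local Open Scope complex_scope.
Local Open Scope ring_scope.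

Section complex_Lfun.
Context d (T : measurableType d) (R : realType).
Variables (mu : {measure set T -> \bar R}) (p : R).
Implicit Types (f g : T -> R[i]).

(* Borel measurability on R[i], identified with the plane. *)
Definition cmeasurable f :=
  measurable_fun setT (fun x => complex.Re (f x)) /\
  measurable_fun setT (fun x => complex.Im (f x)).

Definition cLnorm f : \bar R := 'N[mu]_p%:E[EFin \o (@normc R \o f)]%E.

Definition memLp f := cmeasurable f /\ (cLnorm f < +oo)%E.

Lemma normc_ge0 (z : R[i]) : 0 <= normc z.
Proof. by case: z => a b; exact: sqrtr_ge0. Qed.

Lemma normcE (z : R[i]) : (normc z)%:C = `|z|.
Proof. by []. Qed.

Lemma normcD (z w : R[i]) : normc (z + w) <= normc z + normc w.
Proof. by rewrite -lecR rmorphD/= !normcE ler_normD. Qed.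

Lemma measurable_normc f : cmeasurable f ->
  measurable_fun setT (fun x => normc (f x)).
Proof.
move=> [mr mi].
rewrite (_ : (fun _ => _) = fun x => (complex.Re (f x) ^+ 2 + complex.Im (f x) ^+ 2) `^ 2^-1).
  apply: (measurableT_comp (measurable_powR _)).
  by apply: measurable_funD; exact: measurable_funX.
apply/funext => x; case: (f x) => a b /=.
by rewrite powR12_sqrt// addr_ge0 ?sqr_ge0.
Qed.

Lemma cmeasurableD f g : cmeasurable f -> cmeasurable g ->
  cmeasurable (fun x => f x + g x).
Proof.
move=> [fr fi] [gr gi]; split.
  rewrite (_ : (fun _ => _) = fun x => complex.Re (f x) + complex.Re (g x)).
    exact: measurable_funD.
  by apply/funext => x; case: (f x) (g x) => a b [].
rewrite (_ : (fun _ => _) = fun x => complex.Im (f x) + complex.Im (g x)).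
  exact: measurable_funD.
by apply/funext => x; case: (f x) (g x) => a b [].
Qed.

Lemma cmeasurableM f g : cmeasurable f -> cmeasurable g ->
  cmeasurable (fun x => f x * g x).
Proof.
move=> [fr fi] [gr gi]; split.
  rewrite (_ : (fun _ => _) =
      fun x => complex.Re (f x) * complex.Re (g x) - complex.Im (f x) * complex.Im (g x)).
    by apply: measurable_funB; exact: measurable_funM.
  by apply/funext => x; case: (f x) (g x) => a b [].
rewrite (_ : (fun _ => _) =
    fun x => complex.Re (f x) * complex.Im (g x) + complex.Im (f x) * complex.Re (g x)).
  by apply: measurable_funD; exact: measurable_funM.
by apply/funext => x; case: (f x) (g x) => a b [].
Qed.

Lemma cmeasurable_cst (c : R[i]) : cmeasurable (fun=> c).
Proof. by split; exact: measurable_cst. Qed.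

Hypothesis p1 : 1 <= p.

Let p0 : 0 < p. Proof. exact: lt_le_trans ltr01 p1. Qed.

Let abs_p_ge0 f x : (0 <= `|(normc (f x))%:E| `^ p)%E.
Proof. exact: poweR_ge0. Qed.

Lemma cLnorm_ge0 f : (0 <= cLnorm f)%E.
Proof. exact: Lnorm_ge0. Qed.

Lemma cLnorm0 : cLnorm (fun=> 0) = 0%E.
Proof.
rewrite /cLnorm (_ : EFin \o _ = cst 0%E); last first.
  by apply/funext => x; congr EFin; exact: normc0.
by rewrite Lnorm0// eqe gt_eqF.
Qed.

Lemma cLnormD f g : cmeasurable f -> cmeasurable g ->
  (cLnorm (fun x => f x + g x)%R <= cLnorm f + cLnorm g)%E.
Proof.
move=> mf mg; have mF := measurable_normc mf; have mG := measurable_normc mg.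
apply: (@le_trans _ _
    ('N[mu]_p%:E[EFin \o ((fun x => normc (f x)) \+ (fun x => normc (g x)))%R])%E);
  last exact: eminkowski.
rewrite /cLnorm unlock.
have ip0 : 0 <= p^-1 by rewrite invr_ge0 ltW.
apply: (gt0_ler_poweR ip0).
- by rewrite in_itv/= leey andbT integral_ge0// => x _; exact: poweR_ge0.
- by rewrite in_itv/= leey andbT integral_ge0// => x _; exact: poweR_ge0.
have mm (h : T -> R) : measurable_fun setT h ->
    measurable_fun setT (fun x => `|(h x)%:E| `^ p)%E.
  move=> mh; apply: (measurableT_comp (measurable_poweR _)).
  by apply: measurableT_comp => //; exact/measurable_EFinP.
apply: ge0_le_integral => //.
- by move=> x _; exact: abs_p_ge0.
- exact: (mm _ (measurable_normc (cmeasurableD mf mg))).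
- by apply: mm; exact: measurable_funD.
- move=> x _; apply: (gt0_ler_poweR (ltW p0)); rewrite ?in_itv/= ?leey ?andbT//.
  rewrite lee_fin !ger0_norm ?addr_ge0 ?normc_ge0//; exact: normcD.
Qed.

Lemma cLnormZ (l : R[i]) f : cmeasurable f ->
  (cLnorm (fun x => l * f x)%R = (normc l)%:E * cLnorm f)%E.
Proof.
move=> mf; rewrite /cLnorm unlock.
under eq_integral => x _.
  rewrite (_ : (EFin \o _) x = (normc l)%:E * (normc (f x))%:E)%E; last first.
    by rewrite -EFinM -normcM.
  rewrite abseM poweRM//; over.
have mF : measurable_fun setT (fun x => `|(normc (f x))%:E| `^ p)%E.
  apply: (measurableT_comp (measurable_poweR _)).
  by apply: measurableT_comp => //; apply/measurable_EFinP; exact: measurable_normc.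
rewrite ge0_integralZl ?poweR_ge0//.
rewrite poweRM ?poweR_ge0 ?integral_ge0//.
rewrite -poweRrM divff ?gt_eqF// poweRe1// gee0_abs ?lee_fin ?normc_ge0//.
Qed.

Lemma memLp0 : memLp (fun=> 0).
Proof. by split; [exact: cmeasurable_cst|rewrite cLnorm0]. Qed.

Lemma memLpD f g : memLp f -> memLp g -> memLp (fun x => f x + g x).
Proof.
move=> [mf lf] [mg lg]; split; first exact: cmeasurableD.
by apply: le_lt_trans (cLnormD mf mg) _; rewrite lte_add_pinfty.
Qed.

Lemma memLpZ (l : R[i]) f : memLp f -> memLp (fun x => l * f x).
Proof.
move=> [mf lf]; split.
  by apply: cmeasurableM => //; exact: cmeasurable_cst.
by rewrite cLnormZ// lte_mul_pinfty// lee_fin normc_ge0.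
Qed.

Lemma memLpN f : memLp f -> memLp (fun x => - f x).
Proof.
move=> /(memLpZ (-1)); congr memLp; apply/funext => x; exact: mulN1r.
Qed.

Lemma cmeasurable_ae_cLnorm f g : cmeasurable f -> cmeasurable g ->
  f = g %[ae mu] -> cLnorm f = cLnorm g.
Proof.
move=> mf mg fg; rewrite /cLnorm unlock; congr (_ `^ _)%E.
have mm h : cmeasurable h ->
    measurable_fun setT (fun x => `|(normc (h x))%:E| `^ p)%E.
  move=> mh; apply: (measurableT_comp (measurable_poweR _)).
  by apply: measurableT_comp => //; apply/measurable_EFinP; exact: measurable_normc.
apply: ge0_ae_eq_integral => //.
- exact: mm.
- exact: mm.
- by move=> x _; exact: poweR_ge0.
- by move=> x _; exact: poweR_ge0.
- by apply: filterS fg => x /= fgx _; rewrite fgx.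
Qed.

Lemma cLnorm_eq0 f : cmeasurable f -> cLnorm f = 0%E -> f = (fun=> 0) %[ae mu].
Proof.
move=> mf /Lnorm_eq0_eq0 => /(_ _ _) h.
have : (fun x => (normc (f x))%:E) = (fun=> 0%E) %[ae mu].
  by apply: h; [apply/measurable_EFinP; exact: measurable_normc|rewrite lte_fin].
by apply: filterS => x /= /[apply] -[] /eq0_normc.
Qed.

End complex_Lfun.

Section complex_Lp_def.
Context d (T : measurableType d) (R : realType).
Variables (mu : {measure set T -> \bar R}) (p : R) (p1 : 1 <= p).

Record cLfun_type := CLfun { cLfun_fun :> T -> R[i]; _ : memLp mu p cLfun_fun }.

HB.instance Definition _ := gen_eqMixin cLfun_type.
HB.instance Definition _ := gen_choiceMixin cLfun_type.

Definition cLfun_eq (f g : cLfun_type) := `[< f = g %[ae mu] >].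

Let cLfun_eq_refl : reflexive cLfun_eq.
Proof. by move=> f; apply/asboolP; exact: ae_eq_refl. Qed.

Let cLfun_eq_sym : symmetric cLfun_eq.
Proof. by move=> f g; apply/idP/idP => /asboolP h; apply/asboolP/ae_eq_sym. Qed.

Let cLfun_eq_trans : transitive cLfun_eq.
Proof.
by move=> f g h /asboolP gf /asboolP fh; apply/asboolP/(ae_eq_trans gf fh).
Qed.

Canonical cLfun_eq_canonical :=
  EquivRel cLfun_eq cLfun_eq_refl cLfun_eq_sym cLfun_eq_trans.

Local Open Scope quotient_scope.

(* [p1] is a phantom parameter: the vector space structure below needs it. *)
Definition cLp of 1 <= p : Type := {eq_quot cLfun_eq}.
HB.instance Definition _ (h : 1 <= p) := Choice.on (cLp h).
HB.instance Definition _ (h : 1 <= p) := EqQuotient.on (cLp h).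
Local Notation L := (cLp p1).

Definition cLp_fun (x : L) : T -> R[i] := repr x.
Local Coercion cLp_fun : cLp >-> Funclass.

Lemma memLp_cLp (x : L) : memLp mu p x.
Proof. by rewrite /cLp_fun; case: (repr x). Qed.

Lemma cLpP (x y : L) : x = y %[ae mu] -> x = y.
Proof. by move=> xy; rewrite -[x]reprK -[y]reprK; apply/eqmodP/asboolP. Qed.

(* The class of [f], with the junk value 0 when [f] is not in L^p. *)
Definition toLp (f : T -> R[i]) : L :=
  match pselect (memLp mu p f) with
  | left h => \pi_L (CLfun h)
  | right _ => \pi_L (CLfun (memLp0 mu p1))
  end.

Lemma toLpK (f : T -> R[i]) : memLp mu p f -> toLp f = f %[ae mu].
Proof.
rewrite /toLp; case: pselect => // h _; rewrite /cLp_fun.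
have /eqmodP/asboolP : repr (\pi_L (CLfun h)) = CLfun h %[mod L] by rewrite reprK.
by [].
Qed.

Lemma cLp_funK (x : L) : toLp x = x.
Proof. by apply/cLpP/toLpK/memLp_cLp. Qed.

Let zero : L := toLp (fun=> 0).
Let opp (x : L) : L := toLp (fun t => - x t).
Let add (x y : L) : L := toLp (fun t => x t + y t).
Let scale (l : R[i]) (x : L) : L := toLp (fun t => l * x t).

Let zeroK : zero = (fun=> 0) %[ae mu].
Proof. exact: toLpK (memLp0 _ p1). Qed.

Let oppK x : opp x = (fun t => - x t) %[ae mu].
Proof. exact: toLpK (memLpN p1 (memLp_cLp x)). Qed.

Let addK x y : add x y = (fun t => x t + y t) %[ae mu].
Proof. exact: toLpK (memLpD p1 (memLp_cLp x) (memLp_cLp y)). Qed.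

Let scaleK l x : scale l x = (fun t => l * x t) %[ae mu].
Proof. exact: toLpK (memLpZ p1 l (memLp_cLp x)). Qed.

Let filterS4 (P1 P2 P3 P4 P : set T) :
  (forall t, P1 t -> P2 t -> P3 t -> P4 t -> P t) ->
  (\forall t \ae mu, P1 t) -> (\forall t \ae mu, P2 t) ->
  (\forall t \ae mu, P3 t) -> (\forall t \ae mu, P4 t) ->
  \forall t \ae mu, P t.
Proof.
move=> PP h1 h2 h3 h4; apply: filterS3 h2 h3 (filterI h1 h4).
by move=> t ? ? []; auto.
Qed.

Let addA : associative add.
Proof.
move=> x y z; apply: cLpP.
move: (addK x (add y z)) (addK y z) (addK (add x y) z) (addK x y).
apply: filterS4 => t + + + + _ => /(_ I) -> /(_ I) -> /(_ I) -> /(_ I) ->.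
exact: addrA.
Qed.

Let addC : commutative add.
Proof.
move=> x y; apply: cLpP; move: (addK x y) (addK y x).
by apply: filterS2 => t + + _ => /(_ I) -> /(_ I) ->; exact: addrC.
Qed.

Let add0 : left_id zero add.
Proof.
move=> x; apply: cLpP; move: (addK zero x) zeroK.
by apply: filterS2 => t + + _ => /(_ I) -> /(_ I) ->; exact: add0r.
Qed.

Let addN : left_inverse zero opp add.
Proof.
move=> x; apply: cLpP; move: (addK (opp x) x) (oppK x) zeroK.
apply: filterS3 => t + + + _ => /(_ I) -> /(_ I) -> /(_ I) ->.
exact: addNr.
Qed.

HB.instance Definition _ := GRing.isZmodule.Build L addA addC add0 addN.

Let scaleA (a b : R[i]) (x : L) : scale a (scale b x) = scale (a * b) x.
Proof.
apply: cLpP; move: (scaleK a (scale b x)) (scaleK b x) (scaleK (a * b) x).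
apply: filterS3 => t + + + _ => /(_ I) -> /(_ I) -> /(_ I) ->.
exact: mulrA.
Qed.

Let scale1 : left_id 1 scale.
Proof.
move=> x; apply: cLpP; move: (scaleK 1 x).
by apply: filterS => t + _ => /(_ I) ->; exact: mul1r.
Qed.

Let scaleDr : right_distributive scale +%R.
Proof.
move=> l x y; apply: cLpP.
have h : scale l (x + y) = (fun t => l * (x t + y t)) %[ae mu].
  move: (scaleK l (x + y)) (addK x y).
  by apply: filterS2 => t + + _ => /(_ I) -> /(_ I) ->.
move: h (addK (scale l x) (scale l y)) (scaleK l x) (scaleK l y).
apply: filterS4 => t + + + + _ => /(_ I) -> /(_ I) -> /(_ I) -> /(_ I) ->.
exact: mulrDr.
Qed.

Let scaleDl (x : L) : {morph scale^~ x : a b / a + b}.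
Proof.
move=> a b; apply: cLpP.
move: (scaleK (a + b) x) (addK (scale a x) (scale b x)) (scaleK a x)
  (scaleK b x).
apply: filterS4 => t + + + + _ => /(_ I) -> /(_ I) -> /(_ I) -> /(_ I) ->.
exact: mulrDl.
Qed.

HB.instance Definition _ :=
  GRing.Zmodule_isLmodule.Build R[i] L scaleA scale1 scaleDr scaleDl.

Lemma cLp0E : (0 : L) = (fun=> 0) %[ae mu].
Proof. exact: zeroK. Qed.

Lemma cLpNE (x : L) : (- x : L) = (fun t => - x t) %[ae mu].
Proof. exact: oppK. Qed.

Lemma cLpDE (x y : L) : (x + y : L) = (fun t => x t + y t) %[ae mu].
Proof. exact: addK. Qed.

Lemma cLpZE (l : R[i]) (x : L) : (l *: x : L) = (fun t => l * x t) %[ae mu].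
Proof. exact: scaleK. Qed.

Let cLp_norm (x : L) : R[i] := (fine (cLnorm mu p x))%:C.

Let normK (x : L) : (fine (cLnorm mu p x))%:E = cLnorm mu p x.
Proof.
have [_ fx] := memLp_cLp x.
by rewrite fineK// ge0_fin_numE// cLnorm_ge0.
Qed.

Let cLnorm_ext (x : L) f : memLp mu p f -> x = f %[ae mu] ->
  cLnorm mu p x = cLnorm mu p f.
Proof.
move=> [mf _]; have [mx _] := memLp_cLp x; exact: cmeasurable_ae_cLnorm.
Qed.

Let ler_cLp_normD (x y : L) : cLp_norm (x + y : L) <= cLp_norm x + cLp_norm y.
Proof.
rewrite -rmorphD/= lecR -lee_fin EFinD !normK.
rewrite (cLnorm_ext (memLpD p1 (memLp_cLp x) (memLp_cLp y)) (cLpDE x y)).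
have [mx _] := memLp_cLp x; have [my _] := memLp_cLp y.
exact: cLnormD.
Qed.

Let cLp_normZ (l : R[i]) (x : L) : cLp_norm (l *: x : L) = `|l| * cLp_norm x.
Proof.
rewrite -normcE -rmorphM/=; congr (_%:C).
apply: EFin_inj; rewrite EFinM !normK.
rewrite (cLnorm_ext (memLpZ p1 l (memLp_cLp x)) (cLpZE l x)).
by have [mx _] := memLp_cLp x; rewrite cLnormZ.
Qed.

Let cLp_normr0_eq0 (x : L) : cLp_norm x = 0 -> x = 0.
Proof.
move=> [x0]; apply: cLpP; have [mx _] := memLp_cLp x.
have : cLnorm mu p x = 0%E by rewrite -normK x0.
move=> /(cLnorm_eq0 p1 mx) + ; move: cLp0E.
by apply: filterS2 => t + + _ => /(_ I) -> /(_ I) ->.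
Qed.

HB.instance Definition _ :=
  Lmodule_isNormed.Build R[i] L ler_cLp_normD cLp_normZ cLp_normr0_eq0.

Lemma cLp_normE (x : L) : `|x| = (fine (cLnorm mu p x))%:C.
Proof. by []. Qed.

End complex_Lp_def.
Coercion cLp_fun : cLp >-> Funclass.

Record density d (T : measurableType d) (R : realType)
    (mu : {measure set T -> \bar R}) := Density {
  density_fun :> T -> R;
  density_measurable : measurable_fun setT density_fun;
  density_gt0 : forall x, 0 < density_fun x;
  density_norm1 : ('N[mu]_1[EFin \o density_fun] = 1)%E }.

Section density_measure.
Local Open Scope ereal_scope.
Context d (T : measurableType d) (R : realType).
Variables (mu : {measure set T -> \bar R}) (g : density mu).

(* The measure g dmu. *)
Definition dmeasure (A : set T) : \bar R := \int[mu]_(x in A) (g x)%:E.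

Let g0 x : 0 <= (g x)%:E. Proof. by rewrite lee_fin ltW// density_gt0. Qed.

Let mg : measurable_fun setT (fun x => (g x)%:E).
Proof. by apply/measurable_EFinP; exact: density_measurable. Qed.

Let dmeasure0 : dmeasure set0 = 0. Proof. exact: integral_set0. Qed.

Let dmeasure_ge0 A : 0 <= dmeasure A. Proof. exact: integral_ge0. Qed.

Let dmeasure_sigma_additive : semi_sigma_additive dmeasure.
Proof. exact: semi_sigma_additive_nng_induced. Qed.

HB.instance Definition _ := isMeasure.Build _ _ _ dmeasure
  dmeasure0 dmeasure_ge0 dmeasure_sigma_additive.

Let dmeasure_setT : dmeasure setT = 1.
Proof.
rewrite -(density_norm1 g) Lnorm1; apply: eq_integral => x _.
by rewrite /= ger0_norm// ltW// density_gt0.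
Qed.

HB.instance Definition _ := Measure_isProbability.Build _ _ _
  dmeasure dmeasure_setT.

Import HBNNSimple.

Let nnsfun_dmeasure (h : {nnsfun T >-> R}) :
  \int[dmeasure]_x (h x)%:E = \int[mu]_x ((h x)%:E * (g x)%:E).
Proof.
under [LHS]eq_integral do rewrite fimfunE -fsumEFin//.
rewrite [LHS]ge0_integral_fsum//; last 2 first.
- by move=> r; exact/measurable_EFinP/measurableT_comp.
- by move=> n x _; rewrite EFinM nnfun_muleindic_ge0.
under [RHS]eq_integral.
  move=> x xD; rewrite fimfunE -fsumEFin// muleC ge0_mule_fsumr; last first.
    by move=> r; rewrite EFinM nnfun_muleindic_ge0.
  over.
rewrite [RHS]ge0_integral_fsum//; last 2 first.
- move=> r; apply: emeasurable_funM => //.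
  exact/measurable_EFinP/measurableT_comp.
- by move=> n x _; rewrite EFinM mule_ge0// nnfun_muleindic_ge0.
apply: eq_fsbigr => r /[!inE] -[y _ yr].
have r0 : (0 <= r)%R by rewrite -yr.
have mr : measurable (h @^-1` [set r]) by [].
rewrite integralZl_indic_nnsfun// integral_indic// setIT.
under [RHS]eq_integral do rewrite EFinM muleCA.
rewrite ge0_integralZl//.
- congr (_ * _); rewrite [LHS]integral_mkcond; apply: eq_integral => x _.
  by rewrite patchE indicE; case: ifPn => _; rewrite ?mule1 ?mule0.
- by apply: emeasurable_funM => //; exact/measurable_EFinP.
- by move=> x _; rewrite mule_ge0// lee_fin.
Qed.

Lemma ge0_integral_dmeasure (f : T -> \bar R) :
  measurable_fun setT f -> (forall x, 0 <= f x) ->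
  \int[dmeasure]_x f x = \int[mu]_x (f x * (g x)%:E).
Proof.
move=> mf f0; pose f_ := nnsfun_approx measurableT mf.
have cf x : (f_ n x)%:E @[n --> \oo] --> f x by exact: cvg_nnsfun_approx.
transitivity (limn (fun n => \int[dmeasure]_x (f_ n x)%:E)).
  rewrite -monotone_convergence//=.
  - by apply: eq_integral => x _; apply/esym/cvg_lim.
  - by move=> n; exact/measurable_EFinP.
  - by move=> n x _; rewrite lee_fin.
  - by move=> x _ a b ab; rewrite lee_fin//; exact/lefP/nd_nnsfun_approx.
under eq_fun do rewrite nnsfun_dmeasure.
rewrite -monotone_convergence//=.
- apply: eq_integral => x _; apply/cvg_lim => //.
  by apply: cvgeZr => //; exact: cf.
- by move=> n; apply: emeasurable_funM => //; exact/measurable_EFinP.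
- by move=> n x _; rewrite mule_ge0// lee_fin.
- move=> x _ a b ab; rewrite lee_wpmul2r// lee_fin.
  exact/lefP/nd_nnsfun_approx.
Qed.

End density_measure.

Section phi.
Context d (T : measurableType d) (R : realType).
Variables (mu : {measure set T -> \bar R}) (g : density mu).
Variables (p : R) (p1 : 1 <= p).

Let p0 : 0 < p. Proof. exact: lt_le_trans ltr01 p1. Qed.

Definition phi_fun (h : T -> R[i]) (x : T) : R[i] :=
  (g x `^ (- p^-1))%:C * h x.

(* [phi_fun h] does lie in L^p (g dmu), see [memLp_phi]; the isometry property
   is [norm_phi]. *)
Definition phi (h : cLp mu p1) : cLp (dmeasure g) p1 := toLp _ p1 (phi_fun h).

Let mphi h : cmeasurable h -> cmeasurable (phi_fun h).
Proof.
move=> mh; apply: cmeasurableM => //; split => /=; last exact: measurable_cst.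
apply: (measurableT_comp (measurable_powR _)); exact: density_measurable.
Qed.

Let cLnorm_phi h : cmeasurable h ->
  cLnorm (dmeasure g) p (phi_fun h) = cLnorm mu p h.
Proof.
move=> mh; rewrite /cLnorm unlock; congr (_ `^ _)%E.
rewrite ge0_integral_dmeasure; last 2 first.
- apply: (measurableT_comp (measurable_poweR _)).
  apply: measurableT_comp => //; apply/measurable_EFinP.
  exact/measurable_normc/mphi.
- by move=> x; exact: poweR_ge0.
apply: eq_integral => x _; have gx := density_gt0 g x.
rewrite /= /phi_fun normcM normrM powRM// -EFinM; congr EFin.
rewrite /= expr0n/= addr0 sqrtr_sqr normr_id (ger0_norm (powR_ge0 _ _)).
rewrite -powRrM mulNr mulVf ?gt_eqF// powR_inv1 ?(ltW gx)// mulrAC.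
by rewrite mulVf ?gt_eqF// mul1r.
Qed.

Lemma memLp_phi (h : cLp mu p1) : memLp (dmeasure g) p (phi_fun h).
Proof.
have [mh lh] := memLp_cLp h; split; first exact: mphi.
by rewrite cLnorm_phi.
Qed.

Lemma phiE (h : cLp mu p1) : phi h = phi_fun h %[ae dmeasure g].
Proof. exact/toLpK/memLp_phi. Qed.

Lemma norm_phi (h : cLp mu p1) : `|phi h| = `|h|.
Proof.
rewrite !cLp_normE; congr (fine _)%:C; have [mh _] := memLp_cLp h.
rewrite -(cLnorm_phi mh); apply: (cmeasurable_ae_cLnorm _ _ _ (phiE h)).
  by have [] := memLp_cLp (phi h).
exact: mphi.
Qed.

End phi.

Section schauder_basis.
Context (K : numFieldType) (X : normedModType K).
Implicit Types (e : nat -> X) (x : X).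

(* Sequences are indexed from 0: [e k] stands for e_(k+1). *)
Definition schauder_basis e := forall x,
  exists! a : nat -> K, series (fun k => a k *: e k) @ \oo --> x.

(* The coefficients of [x], when [e] is a basis. *)
Definition basis_coef e x : nat -> K :=
  xget (fun=> 0) [set a | series (fun k => a k *: e k) @ \oo --> x].

Definition basis_proj e (N : nat) x : X :=
  \sum_(k < N) basis_coef e x k *: e k.

Definition bounded_operators : set (X -> X) :=
  [set S | linear S /\ continuous S].

End schauder_basis.

Section rademacher.
Context d (Omega : measurableType d) (R : realType) (P : probability Omega R).
Implicit Type (Z eps : nat -> {RV P >-> R}).

Definition independent_RVs Z :=
  forall (J : {fset nat}) (B : nat -> set R), (forall k, measurable (B k)) ->
    P (\bigcap_(k in [set` J]) (Z k @^-1` B k)) =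
    (\prod_(k <- J) P (Z k @^-1` B k))%E.

Definition rademacher eps :=
  [/\ forall k w, eps k w = 1 \/ eps k w = -1,
      forall k, P (eps k @^-1` [set 1]) = (2^-1)%:E
    & independent_RVs eps].

Context (X : normedModType R[i]).

(* The norm of [X] takes its values in R[i], hence the real part. *)
Definition rad_norm eps n (x : 'I_n -> X) : \bar R :=
  'N[P]_2%:E[EFin \o
    (fun w => complex.Re `|\sum_(k < n) (eps k w)%:C *: x k|)%R]%E.

(* [bounded_operators] is B(X). *)
Definition R_bounded eps (tau : set (X -> X)) :=
  tau `<=` @bounded_operators _ X /\
  exists2 C : R, 0 <= C &
    forall n (S : 'I_n -> X -> X) (x : 'I_n -> X), (forall k, tau (S k)) ->
      (rad_norm eps (fun k => S k (x k)) <= C%:E * rad_norm eps x)%E.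

Definition R_basis eps (e : nat -> X) :=
  schauder_basis e /\
  R_bounded eps [set basis_proj e N | N in [set N | (0 < N)%N]].

End rademacher.

Lemma ler12 (R : realType) : 1 <= 2 :> R.
Proof. by rewrite ler1n. Qed.

(* Main.v *)
(** Let q = p/2.  By Khintchine's inequality, the R-boundedness of the projections
    P_N means that the square functions satisfy
      \int (\sum |P_(N_k) x_k|^2)^q dmu <= K \int (\sum |x_k|^2)^q dmu.
    A change of density g turns this into the weighted estimate
      \int |P_N x|^2 g^(1-2/p) dmu <= l \int |x|^2 g^(1-2/p) dmu,
    that is, into the uniform boundedness of the P_N on L^2(g dmu).  Starting from
    a density g0 for which every phi_{p,g0}(e_k) is bounded, one maximises the
    concave functional \int pot(A - l B) g0 dmu over all square functions
    A = \sum |P_(N_k) x_k|^2 and B = \sum |x_k|^2 (normalised by a power of g0),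
    where pot(t) = inf_(r >= 1) (t r^(q-1) + r^q).  The square function estimate
    bounds this functional from above.  The minimisers r along a maximising
    sequence converge by strict concavity, and g is a multiple of r^q g0.
    No duality is used, so all p >= 1 are treated alike.

    It remains to see that the span of the e_k is dense in L^2(g dmu).  If u is a
    nearly shortest vector of x + span(e_k), then passing to u - th P_N u would
    shorten it by a fixed factor: u - P_N u is bounded in L^2(g dmu) and tends to 0
    almost everywhere along a subsequence, so it is asymptotically orthogonal
    to u. *)

Require Import Defs.
From mathcomp Require Import all_boot all_order all_algebra finmap.
From mathcomp Require Import all_classical all_reals all_analysis.
From mathcomp Require Import measurable_realfun complex.
From mathcomp Require Import ring lra.
Import Order.TTheory GRing.Theory Num.Theory.
Import numFieldNormedType.Exports.
Import ComplexField.Normc.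

Set Implicit Arguments.
Unset Strict Implicit.
Unset Printing Implicit Defensive.

Local Open Scope classical_set_scope.
Local Open Scope complex_scope.
Local Open Scope ring_scope.

(** * Power inequalities and a concave potential *)

Section powR_inequalities.
Context {R : realType}.
Implicit Types (q x y t u th : R).

(** The estimate [\int (A - l B) w <= 0] for all pairs is a separation statement, and [pot] is built
    so that a maximiser supplies [w]. As an infimum of affine functions of [t], its supergradient at
    [t] is [r^(q-1)], where [r] is the minimiser. At a maximum over the convex cone of the
    differences [A - l B] the derivative along every generator is nonpositive, which is the estimate
    with [w = r^(q-1)]. Testing with [r = 1 + A + B] bounds the functional, and the constraint
    [r >= 1] keeps [g] above a multiple of [g0]. The supremum need not be attained. Hence strict
    concavity is needed in quantitative form: near-maximisers have minimisers whose powers [r^(q/2)]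
    are close in L^2, and optimality is tested with steps that are large compared with the defect.
    For p < 2 the convergence of [P_N x] to [x] in L^p does not give convergence in L^2(g dmu), so
    the density of the span is not inherited from L^p. The argument with nearly shortest vectors
    replaces it. *)

Lemma powR_le_tangent1 th u : 0 <= th <= 1 -> 0 <= u ->
  u `^ th <= 1 + th * (u - 1).
Proof.
move=> /andP[]; rewrite le_eqVlt => /predU1P[<- _ _|th0].
  by rewrite powRr0 mul0r addr0.
rewrite le_eqVlt => /predU1P[-> u0|th1 u0].
  by rewrite powRr1// mul1r addrC subrK.
have := @conjugate_powR R (u `^ th) 1 th^-1 (1 - th)^-1 (powR_ge0 _ _) ler01.
rewrite !invr_gt0 subr_gt0 !invrK subrKC => /(_ th0 th1 erefl).
by rewrite mulr1 powR1 -powRrM divff ?gt_eqF// powRr1//; lra.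
Qed.

Lemma powR_ge_tangent1 q u : 1 <= q -> 0 <= u ->
  1 + q * (u - 1) <= u `^ q.
Proof.
move=> q1 u0; have q0 : 0 < q by lra.
have := @powR_le_tangent1 q^-1 (u `^ q).
rewrite invr_ge0 ltW//= invf_le1// powR_ge0 -powRrM divff ?gt_eqF// powRr1//.
move=> /(_ q1 isT) h; have := ler_wpM2l (ltW q0) h.
by rewrite mulrDr mulrA divff ?gt_eqF//; lra.
Qed.

Lemma powR_divM q x y : 0 < x -> 0 <= y -> (y / x) `^ q * x `^ q = y `^ q.
Proof. by move=> x0 y0; rewrite -powRM ?divr_ge0// ?(ltW x0)// divfK// gt_eqF. Qed.

Lemma gt0_powRD x q1 q2 : 0 < x -> x `^ (q1 + q2) = x `^ q1 * x `^ q2.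
Proof. by move=> x0; rewrite powRD// lt0r_neq0// implybT. Qed.

Lemma gt0_powRB x q1 q2 : 0 < x -> x `^ (q1 - q2) = x `^ q1 / x `^ q2.
Proof. by move=> x0; rewrite powRB// lt0r_neq0// implybT. Qed.

Lemma powRB1 q x : 0 < x -> x `^ q = x * x `^ (q - 1).
Proof.
move=> x0; rewrite -{2}(powRr1 (ltW x0)) -gt0_powRD//; congr (_ `^ _); ring.
Qed.

Lemma eqW x y : x = y -> x <= y. Proof. by move=> ->. Qed.

Lemma powR_le_tangent q x y : 0 <= q <= 1 -> 0 < x -> 0 <= y ->
  y `^ q <= x `^ q + q * x `^ (q - 1) * (y - x).
Proof.
move=> q01 x0 y0; rewrite -(powR_divM q x0 y0).
have /(ler_wpM2r (powR_ge0 x q)) :=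
  powR_le_tangent1 q01 (divr_ge0 y0 (ltW x0)).
rewrite (powRB1 q x0) => /le_trans; apply; apply/eqW.
by field; rewrite gt_eqF.
Qed.

Lemma powR_ge_tangent q x y : 1 <= q -> 0 < x -> 0 <= y ->
  x `^ q + q * x `^ (q - 1) * (y - x) <= y `^ q.
Proof.
move=> q1 x0 y0; rewrite -(powR_divM q x0 y0).
have /(ler_wpM2r (powR_ge0 x q)) :=
  powR_ge_tangent1 q1 (divr_ge0 y0 (ltW x0)).
rewrite (powRB1 q x0); apply: le_trans; apply/eqW.
by field; rewrite gt_eqF.
Qed.

Lemma sqr_powR_half q x : 0 <= x -> (x `^ (q / 2)) ^+ 2 = x `^ q.
Proof. by move=> x0; rewrite -powR_mulrn ?powR_ge0// -powRrM divfK. Qed.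

(** Bernoulli's inequality with its defect measured by a square. With [z = u^(q/2)], division by [z]
    leaves [(2-q) z <= q (u/z) + 2 (1-q)], which is Bernoulli again for [z = (u/z)^(q/(2-q))]. *)
Lemma powR_gap_lt1 q u : 0 < q < 1 -> 0 < u ->
  u `^ q + (1 - q) * (1 - u `^ (q / 2)) ^+ 2 <= 1 - q + q * u.
Proof.
move=> /andP[q0 q1] u0; rewrite -(sqr_powR_half q (ltW u0)).
set z := u `^ (q / 2); have z0 : 0 < z by exact: powR_gt0.
have uz : u = z `^ (2 / q).
  rewrite /z -powRrM mulrA divfK// divff ?gt_eqF// powRr1//; exact: ltW.
have th : 0 <= q / (2 - q) <= 1.
  by rewrite divr_ge0 ?ler_pdivrMr//=; lra.
have := powR_le_tangent1 th (ltW (divr_gt0 u0 z0)).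
have uzE : u / z = z `^ ((2 - q) / q).
  rewrite [in LHS]uz (_ : (2 - q) / q = 2 / q - 1); last first.
    by field; rewrite gt_eqF.
  by rewrite gt0_powRB// powRr1// ltW.
rewrite {1}uzE.
rewrite -powRrM (_ : (2 - q) / q * (q / (2 - q)) = 1); last first.
  by field; rewrite !gt_eqF//; lra.
rewrite powRr1 ?(ltW z0)//.
move=> /(ler_wpM2r (ltW z0)) h1.
have q2 : 0 <= 2 - q by lra.
have := ler_wpM2r q2 h1.
rewrite (_ : (_ + _) * z * (2 - q) = q * u + 2 * (1 - q) * z); last first.
  by field; rewrite !gt_eqF//; lra.
by lra.
Qed.

(** For q >= 2 the tangent inequality for the exponent [q/2] gives the gap with constant 1. For q <
    2 and [z = u^(q/2)] the claim is [q u <= 2 (q-1) z + (2-q) z^2], which is Bernoulli for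
    [z^((2-q)/q) = u/z]. *)
Lemma powR_gap_ge1 q u : 1 < q -> 0 < u ->
  q * u + Num.min 1 (q - 1) * (1 - u `^ (q / 2)) ^+ 2 <= q - 1 + u `^ q.
Proof.
move=> q1 u0; rewrite -(sqr_powR_half q (ltW u0)).
have [q2|q2] := leP 2 q.
  have := @powR_ge_tangent1 (q / 2) u _ (ltW u0).
  rewrite ler_pdivlMr// mul1r => /(_ q2).
  have -> : Num.min 1 (q - 1) = 1 by apply/min_idPl; lra.
  by lra.
have -> : Num.min 1 (q - 1) = q - 1 by apply/min_idPr; lra.
set z := u `^ (q / 2); have z0 : 0 < z by exact: powR_gt0.
have th : 0 <= (2 - q) / q <= 1.
  by rewrite divr_ge0 ?ler_pdivrMr//=; lra.
have /(ler_wpM2l (ltW z0)) := powR_le_tangent1 th (ltW z0).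
have -> : z * z `^ ((2 - q) / q) = u.
  rewrite -{1}(powRr1 (ltW z0)) -gt0_powRD//.
  rewrite -powRrM (_ : q / 2 * _ = 1) ?powRr1 ?(ltW u0)//.
  by field; rewrite gt_eqF//; lra.
have q0 : 0 < q by lra.
move=> /(ler_wpM2r (ltW q0)).
rewrite (_ : z * _ * q = (2 * q - 2) * z + (2 - q) * z ^+ 2); last first.
  by field; rewrite gt_eqF.
by lra.
Qed.

Lemma powR_gap_lt q x y : 0 < q < 1 -> 0 < x -> 0 < y ->
  y `^ q + (1 - q) * (x `^ (q / 2) - y `^ (q / 2)) ^+ 2 <=
  (1 - q) * x `^ q + q * y * x `^ (q - 1).
Proof.
move=> q01 x0 y0.
have := ler_wpM2r (powR_ge0 x q) (powR_gap_lt1 q01 (divr_gt0 y0 x0)).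
rewrite -!(powR_divM _ x0 (ltW y0)) -(sqr_powR_half q (ltW x0)).
have := powRB1 q x0; rewrite -(sqr_powR_half q (ltW x0)).
set A := _ `^ q; set P := (y / x) `^ _; set X := x `^ (q / 2); set Q := x `^ _ => h.
rewrite [X in _ <= X](_ : _ = (1 - q) * X ^+ 2 + q * y * Q).
  by apply: le_trans; apply: eqW; ring.
by rewrite mulrDl h; field; rewrite gt_eqF.
Qed.

Lemma powR_gap_gt q x y : 1 < q -> 0 < x -> 0 < y ->
  q * y * x `^ (q - 1) +
    Num.min 1 (q - 1) * (x `^ (q / 2) - y `^ (q / 2)) ^+ 2 <=
  (q - 1) * x `^ q + y `^ q.
Proof.
move=> q1 x0 y0.
have := ler_wpM2r (powR_ge0 x q) (powR_gap_ge1 q1 (divr_gt0 y0 x0)).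
rewrite -!(powR_divM _ x0 (ltW y0)) -(sqr_powR_half q (ltW x0)).
have := powRB1 q x0; rewrite -(sqr_powR_half q (ltW x0)).
set A := _ `^ q; set P := (y / x) `^ _; set X := x `^ (q / 2); set Q := x `^ _ => h.
rewrite [X in X <= _](_ : _ =
    q * y * Q + Num.min 1 (q - 1) * (X - P * X) ^+ 2).
  by move=> /le_trans; apply; apply: eqW; ring.
by rewrite mulrDl {1}h; field; rewrite gt_eqF.
Qed.

End powR_inequalities.

Section concave_potential.
Context {R : realType}.
Implicit Types (q s t x y : R).

(* [pot q s] is the infimum over [x >= 1] of [s * x ^ (q - 1) + x ^ q], attained at
   [x = thr q s]; as an infimum of affine functions of [s] it is concave.  The constant
   [gapc q] measures, in [pot_le], how far the other [x] are from attaining it. *)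
Definition thr q s := Num.max 1 ((q^-1 - 1) * s).
Definition pot q s := s * thr q s `^ (q - 1) + thr q s `^ q.
Definition gapc q := if q <= 1 then 1 else Num.min 1 (q - 1)^-1.

Lemma thr_ge1 q s : 1 <= thr q s. Proof. by rewrite le_max lexx. Qed.

Lemma thr_gt0 q s : 0 < thr q s. Proof. exact: lt_le_trans (thr_ge1 _ _). Qed.

Lemma gapc_gt0 q : 0 < gapc q.
Proof.
by rewrite /gapc; case: ifPn => //; rewrite -ltNge => q1; rewrite lt_min ltr01 invr_gt0 subr_gt0.
Qed.

Lemma powR_ge1 x q : 1 <= x -> 0 <= q -> 1 <= x `^ q.
Proof. by move=> x1 q0; rewrite -(powRr0 x) ler_powR. Qed.

Lemma powR_le1 x q : 1 <= x -> q <= 0 -> x `^ q <= 1.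
Proof. by move=> x1 q0; rewrite -(powRr0 x) ler_powR. Qed.

Lemma pot_le q t x : 0 < q -> 1 <= x ->
  pot q t + gapc q * (x `^ (q / 2) - thr q t `^ (q / 2)) ^+ 2 <=
  t * x `^ (q - 1) + x `^ q.
Proof.
move=> q0 x1; have x0 : 0 < x by lra.
rewrite /pot; have := thr_ge1 q t; set y := thr q t => y1.
have y0 : 0 < y by lra.
(* First-order condition at the minimiser [y]: an equality where the constraint [x >= 1] is
   inactive; otherwise [y = 1], and the sign of [1 - x^(q-1)] decides. *)
have cmp : q != 1 ->
    t * (y `^ (q - 1) - x `^ (q - 1)) <=
    y * (q / (1 - q)) * (y `^ (q - 1) - x `^ (q - 1)).
  move=> q1; have q10 : 1 - q != 0 by rewrite subr_eq0 eq_sym.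
  have tE : t = (q^-1 - 1) * t * (q / (1 - q)) by field; rewrite q10 gt_eqF.
  rewrite {1}tE /y /thr; case: (leP 1 (_ * t)) => // h; rewrite powR1.
  have [{}q1|{}q1|/eqP] := ltgtP q 1; last by rewrite (negbTE q1).
  - apply: ler_wpM2r; first by rewrite subr_ge0 powR_le1// subr_le0 ltW.
    by apply: ler_wpM2r (ltW h); rewrite divr_ge0 ?subr_ge0// ltW.
  - apply: ler_wnM2r; first by rewrite subr_le0 powR_ge1// subr_ge0 ltW.
    by apply: ler_wnM2r (ltW h); rewrite pmulr_rle0// invr_le0 subr_le0 ltW.
have := powRB1 q y0; set Y := y `^ q; set Y' := y `^ (q - 1) => YE.
set X' := x `^ (q - 1) in cmp *; set X := x `^ q.
have [q1|q1|q1] := ltgtP q 1.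
- rewrite /gapc (ltW q1) mul1r.
  have := @powR_gap_lt _ q x y; rewrite q0 q1 => /(_ isT x0 y0) g.
  have {}cmp := cmp (negbT (lt_eqF q1)).
  have q1' : 0 < 1 - q by lra.
  have {}cmp : 0 <= q * y * (Y' - X') - (1 - q) * t * (Y' - X').
    move: cmp; rewrite -subr_ge0 -(pmulr_rge0 _ q1') => /le_trans; apply.
    by apply: eqW; rewrite -/Y'; field; rewrite gt_eqF.
  rewrite -subr_ge0 -(pmulr_rge0 _ q1').
  move: g cmp; rewrite -/Y -/Y' -/X -/X' YE; lra.
- rewrite /gapc (leNgt q 1) q1/=.
  have g := powR_gap_gt q1 x0 y0.
  have {}cmp := cmp (negbT (gt_eqF q1)).
  have q1' : 0 < q - 1 by lra.
  have mE : (q - 1) * Num.min 1 (q - 1)^-1 = Num.min 1 (q - 1).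
    by rewrite minC minr_pMr ?(ltW q1')// divff ?gt_eqF// mulr1.
  have {}cmp : 0 <= - q * y * (Y' - X') - (q - 1) * t * (Y' - X').
    move: cmp; rewrite -subr_ge0 -(pmulr_rge0 _ q1') => /le_trans; apply.
    by apply: eqW; rewrite -/Y'; field; rewrite -opprB oppr_eq0 gt_eqF.
  rewrite -subr_ge0 -(pmulr_rge0 _ q1').
  move: g cmp; rewrite -/Y -/Y' -/X -/X' YE -mE; lra.
- rewrite /Y' /X' /Y /X /y /thr /gapc q1 lexx invr1 subrr mul0r !powRr0.
  rewrite (max_idPl ler01) powR1 powRr1 ?(ltW x0)// mul1r.
  have := sqr_powR_half 1 (ltW x0); have : 1 <= x `^ (1 / 2) by exact: powR_ge1.
  by rewrite powRr1 ?(ltW x0)//; nra.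
Qed.

Lemma powRD_le q x y : 0 < q -> 0 <= x -> 0 <= y ->
  (x + y) `^ q <= 2 `^ q * (x `^ q + y `^ q).
Proof.
move=> q0; wlog xy : x y / x <= y => [h x0 y0|x0 y0].
  by have [/h|/ltW/h] := leP x y; [exact|rewrite addrC (addrC (_ `^ _)); exact].
apply: (@le_trans _ _ ((2 * y) `^ q)).
  by apply: ge0_ler_powR; rewrite ?nnegrE; lra.
by rewrite powRM//; apply: ler_wpM2l; rewrite ?powR_ge0// lerDr powR_ge0.
Qed.

(** One majorant for both ranges of q: for q <= 1 the term [y] suffices, for q > 1 the power
    does. *)
Lemma mul_powRB1_le q x y : 0 < q -> 0 <= y -> 1 <= x ->
  y * x `^ (q - 1) <= y + (y + x) `^ q.
Proof.
move=> q0 y0 x1; have [q1|q1] := leP q 1.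
  rewrite -[leLHS]addr0 lerD ?powR_ge0// ler_piMr// powR_le1//; lra.
have yx : 0 < y + x by lra.
rewrite (powRB1 q yx) -[leLHS]add0r lerD// ler_pM ?powR_ge0//; first lra.
by apply: ge0_ler_powR; rewrite ?nnegrE; lra.
Qed.

(** Either [1 + a <= M b], and then [1 + a + b] is comparable with [b], or [b < (1 + a) / M]. A
    large [M] makes the coefficient of the remainder small. *)
Lemma powR_le_trade q a b M : 0 < q -> 0 <= a -> 0 <= b -> 0 < M ->
  b `^ q <= (M + 1) * (b * (1 + a + b) `^ (q - 1))
            + (2 / M) `^ q * (1 + a `^ q).
Proof.
move=> q0 a0 b0 M0; have [h|h] := leP (1 + a) (M * b).
  have {}b0 : 0 < b by nra.
  rewrite -[leLHS]addr0; apply: lerD; last first.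
    by rewrite mulr_ge0 ?powR_ge0// addr_ge0 ?powR_ge0.
  rewrite (powRB1 q b0) mulrCA; apply: ler_wpM2l; first exact: ltW.
  have [q1|q1] := leP 1 q.
    rewrite -[leLHS]mul1r ler_pM ?powR_ge0//; first lra.
    by apply: ge0_ler_powR; rewrite ?nnegrE; lra.
  have M1 : 0 < M + 1 by lra.
  apply: (@le_trans _ _ ((M + 1) * ((M + 1) * b) `^ (q - 1))).
    rewrite powRM ?(ltW M1) ?(ltW b0)// mulrA -powRB1//.
    by rewrite ler_peMl ?powR_ge0// powR_ge1 ?(ltW q0)//; lra.
  apply: ler_wpM2l; first exact: ltW.
  rewrite -[q - 1]opprB !powRN lef_pV2 ?posrE ?powR_gt0 ?mulr_gt0//; last lra.
  by apply: ge0_ler_powR; rewrite ?nnegrE; nra.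
rewrite -[leLHS]add0r; apply: lerD.
  by rewrite !mulr_ge0 ?powR_ge0//; lra.
apply: (@le_trans _ _ (((1 + a) / M) `^ q)).
  by apply: ge0_ler_powR; rewrite ?nnegrE ?divr_ge0 ?ler_pdivlMr//; lra.
rewrite powRM ?invr_ge0 ?addr_ge0 ?(ltW M0)//.
rewrite powRM ?invr_ge0 ?(ltW M0)// mulrAC; apply: ler_wpM2r.
  exact: powR_ge0.
by have := powRD_le q0 ler01 a0; rewrite powR1.
Qed.

(** Insert [x = 1 + a + b] into [pot_le]: [a x^(q-1) + x^q] is at most a constant times
    [1 + a^q + b^q], and for large [l] the term [- l b x^(q-1)] outweighs this [b^q] and the
    required [K b^q] as well. After integration, the right-hand side is what the square function
    estimate controls. *)
Lemma pot_le_trade q K : 0 < q -> 0 <= K ->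
  exists l D, [/\ 0 <= l, 0 <= D & forall a b, 0 <= a -> 0 <= b ->
    pot q (a - l * b) <= D * (1 + a `^ q - K * b `^ q)].
Proof.
(* This [M] gives [(2/M)^q = 1/(2(K+1))], so that [L] times the remainder's coefficient is exactly
   [C]. *)
move=> q0 K0; pose M := 2 * (2 * (K + 1)) `^ q^-1.
pose C := 2 * (2 `^ q * 2 `^ q).
have C0 : 0 <= C by rewrite /C !mulr_ge0 ?powR_ge0.
have M0 : 0 < M by rewrite mulr_gt0 ?powR_gt0//; lra.
pose L := 2 * C * (K + 1).
exists (L * (M + 1)), (C + L / (2 * (K + 1))).
have L0 : 0 <= L by rewrite /L !mulr_ge0//; lra.
have K1 : 0 < 2 * (K + 1) by lra.
split.
- by rewrite mulr_ge0//; lra.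
- by rewrite addr_ge0// divr_ge0// ltW.
move=> a b a0 b0; pose x := 1 + a + b.
have x1 : 1 <= x by rewrite /x; lra.
have x0 : 0 < x by lra.
have := @pot_le q (a - L * (M + 1) * b) x q0 x1.
have : 0 <= gapc q * (x `^ (q / 2) - thr q (a - L * (M + 1) * b) `^ (q / 2)) ^+ 2.
  by rewrite mulr_ge0 ?sqr_ge0// ltW// gapc_gt0.
have := powR_le_trade q0 a0 b0 M0.
have -> : (2 / M) `^ q = (2 * (K + 1))^-1.
  rewrite /M invfM mulrA divff ?gt_eqF// mul1r -powRN -powRrM.
  by rewrite mulNr mulVf ?gt_eqF// powR_inv1// ltW.
rewrite -/x; have : a * x `^ (q - 1) <= x `^ q.
  rewrite (powRB1 q x0); apply: ler_wpM2r; [exact: powR_ge0|rewrite /x; lra].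
have : x `^ q <= 2 `^ q * 2 `^ q * (1 + a `^ q + b `^ q).
  rewrite /x -addrA -mulrA.
  apply: le_trans (powRD_le q0 _ _) _; rewrite ?addr_ge0//.
  apply: ler_wpM2l; first exact: powR_ge0.
  rewrite powR1 -addrA mulrDr mulr1; apply: lerD; last exact: powRD_le.
  by apply: powR_ge1; [lra|exact: ltW].
have := powR_ge0 a q; have := powR_ge0 b q.
move: (pot _ _) (a `^ q) (b `^ q) (x `^ q) (x `^ (q - 1)) (gapc _ * _)
  => p A B X Y G B0 A0 XC aY; set U := _ ^-1 => tr G0 pe.
have LU : L * U = C by rewrite /L /U; field; rewrite gt_eqF//; lra.
rewrite LU; have := ler_wpM2l L0 tr.
rewrite mulrDr (mulrA L U) LU => {}tr.
have {}tr : L * B - C * (1 + A) <= L * (M + 1) * b * Y by lra.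
have {}XC : 2 * X <= C * (1 + A + B).
  by rewrite /C -mulrA; apply: ler_wpM2l.
have {}pe : p + G <= a * Y - L * (M + 1) * b * Y + X by rewrite -mulrBl.
have : p <= C * (1 + A + B) - (L * B - C * (1 + A)) by lra.
rewrite /L => /le_trans; apply; rewrite -subr_ge0.
rewrite (_ : _ - _ = C * B) ?mulr_ge0//; ring.
Qed.

Lemma abs_pot_le q s : 0 < q ->
  `|pot q s| <= `|s| + 2 * (`|s| + thr q s) `^ q.
Proof.
move=> q0; apply: le_trans (ler_normD _ _) _; rewrite normrM.
rewrite !(ger0_norm (powR_ge0 _ _)).
have := mul_powRB1_le q0 (normr_ge0 s) (thr_ge1 q s).
have : thr q s `^ q <= (`|s| + thr q s) `^ q.
  have t0 := thr_gt0 q s; have s0 := normr_ge0 s.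
  by apply: ge0_ler_powR; rewrite ?nnegrE; lra.
lra.
Qed.

Lemma thr_le q s : thr q s <= 1 + `|q^-1 - 1| * `|s|.
Proof.
rewrite ge_max lerDl mulr_ge0//= -normrM.
by rewrite (le_trans (ler_norm _))// lerDr.
Qed.

Lemma thr_lip q s t : thr q s <= thr q t + `|q^-1 - 1| * `|s - t|.
Proof.
rewrite -normrM mulrBr [leLHS]/thr ge_max; apply/andP; split.
  by rewrite -[leLHS]addr0 lerD// thr_ge1.
rewrite -[leLHS](subrK ((q^-1 - 1) * t)) addrC lerD ?ler_norm//.
by rewrite le_max lexx orbT.
Qed.

End concave_potential.

(** * Sequences of integrable functions *)

Section sequences_and_integrals.
Context {R : realType}.

Lemma cvg_powR (q : R) (u : nat -> R) (l : R) : 0 < l -> u @ \oo --> l ->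
  (u n `^ q) @[n --> \oo] --> l `^ q.
Proof.
move=> l0 ul; apply: (@continuous_cvg _ _ _ _ _ u (fun x => x `^ q)) => //.
apply/differentiable_continuous/derivable1_diffP.
by apply: derivable_powR; rewrite in_itv/= l0.
Qed.

Lemma geometric_increments_le (k : nat -> R) (s : R) : 0 <= s ->
  (forall n, `|k n - k n.+1| <= s * 2^-1 ^+ n) ->
  forall n, `|k 0%N - k n| <= 2 * s.
Proof.
move=> s0 ks n; have : `|k 0%N - k n| <= 2 * s * (1 - 2^-1 ^+ n).
  elim: n => [|n ih]; first by rewrite expr0 !subrr normr0 mulr0.
  have := ler_normD (k 0%N - k n) (k n - k n.+1); rewrite subrKA exprS.
  by have := ks n; move: ih; lra.
have : 0 <= 2^-1 ^+ n :> R by rewrite exprn_ge0// invr_ge0.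
by nra.
Qed.

Lemma geometric_increments_cvg (k : nat -> R) (s : R) : 0 <= s ->
  (forall n, `|k n - k n.+1| <= s * 2^-1 ^+ n) -> cvgn k.
Proof.
(* The correction drops by [s 2^-n] at each step, the largest possible increase of [k]; hence [v] is
   nonincreasing. *)
move=> s0 ks; pose v n := k n + 2 * s * 2^-1 ^+ n.
have v0 : (fun n => 2 * s * 2^-1 ^+ n : R) @ \oo --> 0.
  rewrite -[X in _ --> X](mulr0 (2 * s)); apply: cvgMl_tmp; apply: cvg_expr.
  by rewrite ger0_norm ?invr_ge0// invf_lt1 ?ltr1n.
have cv : cvgn v.
  apply: nonincreasing_is_cvgn.
    apply/nonincreasing_seqP => n; have := ks n.
    rewrite /v ler_norml exprS => /andP[h _].
    by lra.
  exists (k 0%N - 2 * s) => _ [n _ <-]; rewrite /v.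
  have := geometric_increments_le s0 ks n; rewrite ler_norml => /andP[_].
  have : 0 <= 2 * s * 2^-1 ^+ n by rewrite !mulr_ge0 ?exprn_ge0 ?invr_ge0.
  by lra.
have -> : k = v \- (fun n => 2 * s * 2^-1 ^+ n).
  by apply/funext => n; rewrite /v/= addrK.
by apply: is_cvgB => //; apply/cvg_ex; exists 0.
Qed.

Context d (T : measurableType d) (mu : {measure set T -> \bar R}).
Implicit Types f g : T -> R.

Definition L1 f := mu.-integrable setT (EFin \o f).

Lemma L1_measurable f : L1 f -> measurable_fun setT f.
Proof. by move=> /measurable_int/measurable_EFinP. Qed.

Lemma L1_le f g : measurable_fun setT f -> (forall t, `|f t| <= g t) ->
  L1 g -> L1 f.
Proof.
move=> mf fg; apply: le_integrable => //; first exact/measurable_EFinP.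
by move=> t _; rewrite /= lee_fin (le_trans (fg t))// ler_norm.
Qed.

Lemma L1D f g : L1 f -> L1 g -> L1 (fun t => f t + g t).
Proof. by move=> hf hg; apply: (integrableD _ hf hg). Qed.

Lemma L1B f g : L1 f -> L1 g -> L1 (fun t => f t - g t).
Proof. by move=> hf hg; apply: (integrableB _ hf hg). Qed.

Lemma L1Z (c : R) f : L1 f -> L1 (fun t => c * f t).
Proof. by move=> hf; apply: (integrableZl _ c hf). Qed.

Lemma L1_norm f : L1 f -> L1 (fun t => `|f t|).
Proof. exact: integrable_norm. Qed.

Lemma L1_sum (I : Type) (s : seq I) (f : I -> T -> R) :
  (forall i, L1 (f i)) -> L1 (fun t => \sum_(i <- s) f i t).
Proof.
move=> hf; rewrite /L1.
have -> : (EFin \o (fun t => \sum_(i <- s) f i t)) =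
   (fun t => (\sum_(i <- s) (EFin \o f i) t)%E).
  by apply/funext => t /=; rewrite sumEFin.
apply: (@integrable_sum _ _ _ mu _ measurableT I s xpredT (fun i => EFin \o f i)) => i _; exact: hf.
Qed.

Lemma EFin_Rintegral f : L1 f ->
  (\int[mu]_t f t)%:E = (\int[mu]_t (f t)%:E)%E.
Proof. by move=> hf; rewrite /Rintegral fineK//; exact: integrable_fin_num. Qed.

Lemma L1_ge0P f : measurable_fun setT f -> (forall t, 0 <= f t) ->
  (\int[mu]_t (f t)%:E < +oo)%E -> L1 f.
Proof.
move=> mf f0 fi; apply/integrableP; split; first exact/measurable_EFinP.
by under eq_integral do rewrite /= ger0_norm//.
Qed.

Lemma ae_Rint_le f g : L1 f -> L1 g -> (forall t, 0 <= f t) ->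
  (forall t, 0 <= g t) ->
  (\forall t \ae mu, f t <= g t) -> \int[mu]_t f t <= \int[mu]_t g t.
Proof.
move=> hf hg f0 g0 fg; rewrite -lee_fin !EFin_Rintegral//.
apply: ae_ge0_le_integral => //.
- by move=> t _; rewrite lee_fin.
- exact/measurable_EFinP/L1_measurable.
- by move=> t _; rewrite lee_fin.
- exact/measurable_EFinP/L1_measurable.
- by apply: filterS fg => t h _; rewrite lee_fin.
Qed.

Lemma Rint_dct (u : nat -> T -> R) f g :
  (forall n, measurable_fun setT (u n)) -> measurable_fun setT f ->
  (\forall t \ae mu, u n t @[n --> \oo] --> f t) ->
  L1 g -> (\forall t \ae mu, forall n, `|u n t| <= g t) ->
  [/\ L1 f, (forall n, L1 (u n)) &
    \int[mu]_t u n t @[n --> \oo] --> \int[mu]_t f t].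
Proof.
move=> mu_ mf uf g1 ug.
have iu n : L1 (u n).
  apply/integrableP; split; first exact/measurable_EFinP.
  have /integrableP[_ +] := L1_norm g1; apply: le_lt_trans.
  apply: ae_ge0_le_integral => //.
  - by apply: measurableT_comp => //; exact/measurable_EFinP.
  - apply: measurableT_comp => //; apply/measurable_EFinP.
    exact: L1_measurable (L1_norm g1).
  - apply: filterS ug => t /(_ n) h _ /=; rewrite lee_fin.
    by rewrite normr_id (le_trans h)// ler_norm.
have [||||if_ _ cv] := @dominated_convergence _ _ _ mu setT measurableT
    (fun n => EFin \o u n) (EFin \o f) (EFin \o g) _ _ _ g1 _.
- by move=> n; exact/measurable_EFinP.
- exact/measurable_EFinP.
- by apply: filterS uf => t h _; apply: cvg_EFin => //; apply: nearW.
- by apply: filterS ug => t h n _; rewrite /= lee_fin.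
split => //; rewrite -(fineK (integrable_fin_num _ if_))// in cv.
exact: fine_cvg cv.
Qed.

(** [S] is the sum of the [2^n w_n], whose integrals are at most [2^-n]. It is integrable, hence
    finite almost everywhere, and dominates each of its terms. *)
Lemma ae_le_geometric (w : nat -> T -> R) :
  (forall n, L1 (w n)) -> (forall n t, 0 <= w n t) ->
  (forall n, \int[mu]_t w n t <= 4^-1 ^+ n) ->
  exists S : T -> R, [/\ L1 S, forall t, 0 <= S t &
    \forall t \ae mu, forall n, w n t <= S t * 2^-1 ^+ n].
Proof.
move=> Lw w0 iw.
pose v n t := 2 ^+ n * w n t.
have Lv n : L1 (v n) by exact: L1Z.
have v0 n t : (0 <= (v n t)%:E)%E by rewrite lee_fin mulr_ge0// exprn_ge0.
have mv n : measurable_fun setT (fun t => (v n t)%:E).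
  by apply/measurable_EFinP; exact: L1_measurable (Lv n).
pose S t := (\sum_(n <oo) (v n t)%:E)%E.
have mS : measurable_fun setT S.
  by apply: ge0_emeasurable_sum => // n t _ _; exact: v0.
have mfS : measurable_fun setT (fine \o S).
  exact: (measurableT_comp (fine_measurable measurableT)).
have S0 t : (0 <= S t)%E by apply: nneseries_ge0 => n _ _; exact: v0.
have iS : (\int[mu]_t S t < +oo)%E.
  rewrite integral_nneseries//.
  apply: (@le_lt_trans _ _ (\sum_(n <oo) (2 / (2 ^ n.+1)%:R)%:E)%E); last first.
    by apply: le_lt_trans (epsilon_trick0 _ _) _ => //; rewrite ltey.
  apply: lee_nneseries => [n _ _|n _]; first exact: integral_ge0.
  rewrite -EFin_Rintegral// lee_fin RintegralZl//; last exact: Lw.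
  apply: (@le_trans _ _ (2 ^+ n * 4^-1 ^+ n)).
    by apply: ler_wpM2l => //; rewrite exprn_ge0.
  rewrite -exprMn expnS natrM invfM mulrA divff ?mul1r// natrX -exprVn.
  by rewrite lerXn2r ?nnegrE//; lra.
have iS' : mu.-integrable setT S.
  apply/integrableP; split; first exact: mS.
  under eq_integral => t _ do rewrite (gee0_abs (S0 t)).
  exact: iS.
have Sfin := integrable_ae measurableT iS'.
exists (fine \o S); split.
- apply: L1_ge0P => //; first by move=> t; exact: fine_ge0.
  apply: le_lt_trans iS; apply: ae_ge0_le_integral => //.
  + by move=> t _; rewrite lee_fin fine_ge0.
  + exact/measurable_EFinP.
  + by apply: filterS Sfin => t /(_ I) St _; rewrite /= fineK.
- by move=> t; exact: fine_ge0.
- apply: filterS Sfin => t /(_ I) St n.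
  rewrite exprVn ler_pdivlMr ?exprn_gt0// mulrC -lee_fin fineK//.
  apply: le_trans (nneseries_lim_ge n.+1 _); last by move=> ? _ _; exact: v0.
  by rewrite big_nat_recr//= leeDr//; apply: sume_ge0 => i _; exact: v0.
Qed.

Lemma ae_cvg0_fast (w : nat -> T -> R) :
  (forall n, L1 (w n)) -> (forall n t, 0 <= w n t) ->
  (forall n, \int[mu]_t w n t <= 4^-1 ^+ n) ->
  \forall t \ae mu, w n t @[n --> \oo] --> 0.
Proof.
move=> Lw w0 iw; have [S [_ _ wS]] := ae_le_geometric Lw w0 iw.
apply: filterS wS => t wS.
apply: (@squeeze_cvgr _ _ _ _ (fun=> 0) (fun n => S t * 2^-1 ^+ n)).
- by apply: nearW => n; rewrite w0 wS.
- exact: cvg_cst.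
- rewrite -[X in _ --> X](mulr0 (S t)); apply: cvgMl_tmp; apply: cvg_expr.
  by rewrite ger0_norm ?invr_ge0// invf_lt1 ?ltr1n.
Qed.

(** The rate 16 leaves room for a weight [2^n], since [2^n 16^-n <= 4^-n]. Then [ae_le_geometric]
    yields another factor [2^-n], so the squared increments are at most [S t 4^-n]. *)
Lemma L2_fast_cauchy (k : nat -> T -> R) :
  (forall n, measurable_fun setT (k n)) -> L1 (fun t => k 0%N t ^+ 2) ->
  (forall n, L1 (fun t => (k n t - k n.+1 t) ^+ 2)) ->
  (forall n, \int[mu]_t ((k n t - k n.+1 t) ^+ 2) <= 16^-1 ^+ n) ->
  exists ko h : T -> R, [/\ measurable_fun setT ko, L1 h, forall t, 0 <= h t,
    \forall t \ae mu, k n t @[n --> \oo] --> ko t &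
    \forall t \ae mu, forall n, k n t ^+ 2 <= h t].
Proof.
move=> mk k0 Lk kk.
have [||n|S [LS S0 kS]] := @ae_le_geometric (fun n t => 2 ^+ n * (k n t - k n.+1 t) ^+ 2).
- by move=> n; exact: L1Z.
- by move=> n t; rewrite mulr_ge0 ?sqr_ge0// exprn_ge0.
- rewrite RintegralZl//; last exact: Lk.
  apply: (@le_trans _ _ (2 ^+ n * 16^-1 ^+ n)).
    by apply: ler_wpM2l => //; rewrite exprn_ge0.
  by rewrite -exprMn lerXn2r ?nnegrE//; lra.
have incr : \forall t \ae mu, forall n,
    `|k n t - k n.+1 t| <= Num.sqrt (S t) * 2^-1 ^+ n.
  apply: filterS kS => t kSt n; have := kSt n.
  rewrite -ler_pdivlMl ?exprn_gt0// => h.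
  rewrite -ler_sqr ?nnegrE ?mulr_ge0 ?exprn_ge0 ?invr_ge0 ?sqrtr_ge0//.
  rewrite exprMn sqr_sqrtr// real_normK ?num_real//; apply: (le_trans h).
  by rewrite -exprVn mulrCA -expr2.
(* The upper limit is measurable and defined everywhere. The majorant [h] comes from
   [|k 0 - k n| <= 2 sqrt S] and [(x + y)^2 <= 2 x^2 + 2 y^2]. *)
exists (fun t => fine (limn_esup (fun n => (k n t)%:E))).
exists (fun t => 2 * k 0%N t ^+ 2 + 8 * S t); split.
- apply: (measurableT_comp (fine_measurable measurableT)).
  by apply: measurable_fun_limn_esup => n; exact/measurable_EFinP.
- by apply: L1D; exact: L1Z.
- by move=> t; apply: addr_ge0; apply: mulr_ge0 => //; exact: sqr_ge0.
- apply: filterS incr => t it.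
  have cv := geometric_increments_cvg (sqrtr_ge0 _) it.
  have cvE : (fun n => (k n t)%:E) @ \oo --> (limn (k ^~ t))%:E.
    by apply: cvg_EFin => //; exact: nearW.
  rewrite is_cvg_limn_esupE; last by apply/cvg_ex; eexists; exact: cvE.
  by rewrite (cvg_lim _ cvE).
- apply: filterS incr => t it n.
  have := geometric_increments_le (sqrtr_ge0 _) it n.
  have := sqr_sqrtr (S0 t).
  move: (Num.sqrt _) (sqrtr_ge0 (S t)) => s s0 <-.
  rewrite ler_norml => /andP[h1 h2].
  have : (2 * k 0%N t ^+ 2 + 8 * s ^+ 2) - k n t ^+ 2 =
    (k n t - 2 * k 0%N t) ^+ 2 + 2 * ((2 * s) ^+ 2 - (k 0%N t - k n t) ^+ 2) by ring.
  move=> e; rewrite -subr_ge0 e addr_ge0 ?sqr_ge0// mulr_ge0// subr_sqr.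
  by rewrite mulr_ge0//; lra.
Qed.

End sequences_and_integrals.

(** * Quantitative concavity of the potential *)

Section pot_more.
Context {R : realType}.
Implicit Types q s t : R.

(** Test [s] and [t] at the minimiser of their midpoint [m]: the affine values add up to
    [2 pot q m], and the two gaps of [pot_le] combine to the square by the parallelogram law. *)
Lemma pot_concave q s t : 0 < q ->
  pot q s + pot q t
    + gapc q / 2 * (thr q s `^ (q / 2) - thr q t `^ (q / 2)) ^+ 2
  <= 2 * pot q (2^-1 * (s + t)).
Proof.
move=> q0; set m := 2^-1 * _.
have := pot_le s q0 (thr_ge1 q m); have := pot_le t q0 (thr_ge1 q m).
have : pot q m = m * thr q m `^ (q - 1) + thr q m `^ q by [].
have me : s + t = 2 * m by rewrite /m; lra.
move: (gapc_gt0 q) (thr q m `^ (q / 2)) (thr q s `^ (q / 2)) (thr q t `^ (q / 2)).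
move: (thr q m `^ (q - 1)) (thr q m `^ q) => x y c0 w u v -> h1 h2.
have sq : gapc q / 2 * (u - v) ^+ 2 <=
    gapc q * (w - v) ^+ 2 + gapc q * (w - u) ^+ 2.
  rewrite -mulrA -mulrDr ler_pM2l// -subr_ge0.
  rewrite (_ : _ - _ = 2^-1 * (w - v + (w - u)) ^+ 2); last by field.
  by rewrite mulr_ge0 ?sqr_ge0// invr_ge0.
have : s * x + t * x = 2 * (m * x) by rewrite -mulrDl me mulrA.
by move: (gapc q * _) (gapc q * _) (gapc q / 2 * _) sq h1 h2 => ? ? ? ? ? ?; lra.
Qed.

(** Supergradient inequality with the gradient taken at the end point: [pot q s] is tested at the
    minimiser of [s + t], so the increase is bounded from below. *)
Lemma pot_ascent q s t : 0 < q ->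
  pot q s + t * thr q (s + t) `^ (q - 1) <= pot q (s + t).
Proof.
move=> q0; have := pot_le s q0 (thr_ge1 q (s + t)).
have := gapc_gt0 q; move=> c0.
have : 0 <= gapc q * (thr q (s + t) `^ (q / 2) - thr q s `^ (q / 2)) ^+ 2.
  by rewrite mulr_ge0 ?sqr_ge0// ltW.
rewrite -[pot q (s + t)]/((s + t) * _ + _) mulrDl.
move: (gapc q * _) (thr q _ `^ (q - 1)) (thr q _ `^ q) => G X Y; lra.
Qed.

Lemma measurable_thr q : measurable_fun setT (@thr R q).
Proof.
apply: measurable_maxr; first exact: measurable_cst.
by apply: measurable_funM => //; exact: measurable_cst.
Qed.

Lemma measurable_pot q : measurable_fun setT (@pot R q).
Proof.
have mt := measurable_thr q.
apply: measurable_funD.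
  by apply: measurable_funM => //; exact: (measurableT_comp (measurable_powR _)).
exact: (measurableT_comp (measurable_powR _)).
Qed.

End pot_more.

(** * A weight obtained by maximising a concave functional *)

Section weight.
Context {R : realType} d (T : measurableType d) (nu : probability T R).
Variable q : R.
Hypothesis q0 : 0 < q.
Implicit Types f g : T -> R.

(** On the probability space [nu] these are the nonnegative functions of L^max(1,q). Both integrals
    are kept because [pot q s] grows linearly in [s] at one end and like the power q at the
    other. *)
Definition L1q f :=
  [/\ forall t, 0 <= f t, L1 nu f & L1 nu (fun t => f t `^ q)].

Lemma L1_cst (c : R) : L1 nu (fun=> c).
Proof. exact: finite_measure_integrable_cst. Qed.

Lemma measurable_fun_powR f (r : R) : measurable_fun setT f ->
  measurable_fun setT (fun t => f t `^ r).
Proof. exact: (measurableT_comp (measurable_powR _)). Qed.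

Lemma L1q_cst (c : R) : 0 <= c -> L1q (fun=> c).
Proof. by move=> c0; split => //; exact: L1_cst. Qed.

Lemma L1qD f g : L1q f -> L1q g -> L1q (fun t => f t + g t).
Proof.
move=> [f0 f1 fq] [g0 g1 gq]; split.
- by move=> t; rewrite addr_ge0.
- exact: L1D.
- apply: (@L1_le _ _ _ _ _ (fun t => 2 `^ q * (f t `^ q + g t `^ q))).
  + by apply/measurable_fun_powR/measurable_funD; [exact: L1_measurable f1|exact: L1_measurable g1].
  + by move=> t; rewrite ger0_norm ?powR_ge0//; exact: powRD_le.
  + by apply: L1Z; exact: L1D.
Qed.

Lemma L1qZ (c : R) f : 0 <= c -> L1q f -> L1q (fun t => c * f t).
Proof.
move=> c0 [f0 f1 fq]; split.
- by move=> t; rewrite mulr_ge0.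
- exact: L1Z.
- apply: (@L1_le _ _ _ _ _ (fun t => c `^ q * f t `^ q)).
  + by apply/measurable_fun_powR/measurable_funM => //; exact: L1_measurable f1.
  + by move=> t; rewrite ger0_norm ?powR_ge0// powRM.
  + exact: L1Z.
Qed.

Lemma L1q_le f g : measurable_fun setT f -> (forall t, 0 <= f t <= g t) ->
  L1q g -> L1q f.
Proof.
move=> mf fg [g0 g1 gq]; have f0 t : 0 <= f t by case/andP: (fg t).
have fg' t : f t <= g t by case/andP: (fg t).
split => //.
- by apply: L1_le g1 => // t; rewrite ger0_norm.
- apply: L1_le gq; first exact: measurable_fun_powR.
  by move=> t; rewrite ger0_norm ?powR_ge0// ge0_ler_powR ?nnegrE// ltW.
Qed.

Lemma L1q_measurable f : L1q f -> measurable_fun setT f.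
Proof. by case=> _ /L1_measurable. Qed.

Lemma L1q_thr (s : T -> R) g : measurable_fun setT s ->
  (forall t, `|s t| <= g t) -> L1q g -> L1q (fun t => thr q (s t)).
Proof.
move=> ms sg g1.
apply: (@L1q_le _ (fun t => 1 + `|q^-1 - 1| * g t)).
- exact: (measurableT_comp (measurable_thr q)).
- move=> t; rewrite (le_trans ler01 (thr_ge1 _ _))/=.
  by apply: le_trans (thr_le _ _) _; rewrite lerD2l ler_wpM2l.
- by apply: L1qD; [exact: L1q_cst|exact: L1qZ].
Qed.

Lemma L1_pot (s : T -> R) g : measurable_fun setT s ->
  (forall t, `|s t| <= g t) -> L1q g -> L1 nu (fun t => pot q (s t)).
Proof.
move=> ms sg g1; have t1 := L1q_thr ms sg g1; have [_ gi _] := g1.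
have [h0 _ hq] := L1qD g1 t1.
apply: (@L1_le _ _ _ _ _
    (fun t => g t + 2 * (g t + thr q (s t)) `^ q)).
- exact: (measurableT_comp (measurable_pot q)).
- move=> t; apply: le_trans (abs_pot_le _ q0) _.
  apply: lerD => //; apply: ler_wpM2l => //.
  have s0 := normr_ge0 (s t); have t0 := thr_gt0 q (s t); have sg' := sg t.
  by apply: (ge0_ler_powR (ltW q0)); rewrite ?nnegrE; lra.
- by apply: L1D => //; exact: L1Z.
Qed.

Section family.
Variables (K : R) (I : Type) (a b : I -> T -> R).
Hypotheses (K0 : 0 <= K) (La : forall i, L1q (a i)) (Lb : forall i, L1q (b i)).

(** The coefficients enter squared, as in the squared modulus of [c *: x]. Lists allow repetitions,
    so these sums form a convex cone; see [wsum_cat] and [wsum_scale]. *)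
Definition wsum (f : I -> T -> R) (s : seq (R * I)) t :=
  \sum_(c <- s) c.1 ^+ 2 * f c.2 t.

Hypothesis aKb : forall s,
  \int[nu]_t (wsum a s t) `^ q <= K * \int[nu]_t (wsum b s t) `^ q.

Lemma L1q_wsum (f : I -> T -> R) s : (forall i, L1q (f i)) -> L1q (wsum f s).
Proof.
move=> Lf; elim: s => [|c s ih].
  rewrite (_ : wsum f [::] = fun=> 0); first exact: L1q_cst.
  by apply/funext => t; rewrite /wsum big_nil.
rewrite (_ : wsum f (c :: s) = fun t => c.1 ^+ 2 * f c.2 t + wsum f s t).
  by apply: L1qD => //; apply: L1qZ (Lf _); rewrite sqr_ge0.
by apply/funext => t; rewrite /wsum big_cons.
Qed.

Definition wscale (r : R) (s : seq (R * I)) :=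
  [seq (Num.sqrt r * c.1, c.2) | c <- s].

Lemma wsum_scale (f : I -> T -> R) r s t : 0 <= r -> wsum f (wscale r s) t = r * wsum f s t.
Proof.
move=> r0; rewrite /wsum big_map mulr_sumr; apply: eq_bigr => c _ /=.
by rewrite exprMn sqr_sqrtr// -mulrA.
Qed.

Lemma wsum_cat (f : I -> T -> R) s s' t : wsum f (s ++ s') t = wsum f s t + wsum f s' t.
Proof. by rewrite /wsum big_cat. Qed.

Section optimise.
Variables (l D : R).
Hypothesis l0 : 0 <= l.
Hypothesis lD : forall x y, 0 <= x -> 0 <= y ->
  pot q (x - l * y) <= D * (1 + x `^ q - K * y `^ q).
Hypothesis D0 : 0 <= D.

Definition wdiff s t := wsum a s t - l * wsum b s t.

Lemma wdiffD r s s' t : 0 <= r ->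
  wdiff (s ++ wscale r s') t = wdiff s t + r * wdiff s' t.
Proof. by move=> r0; rewrite /wdiff !wsum_cat !wsum_scale//; ring. Qed.

Lemma wdiff_mid s s' t :
  wdiff (wscale 2^-1 (s ++ s')) t = 2^-1 * (wdiff s t + wdiff s' t).
Proof.
by rewrite /wdiff !wsum_scale ?invr_ge0// !wsum_cat; ring.
Qed.

Lemma wdiff_dom s : exists2 g, L1q g & forall t, `|wdiff s t| <= g t.
Proof.
exists (fun t => wsum a s t + l * wsum b s t).
  by apply: L1qD; [exact: L1q_wsum|apply: L1qZ => //; exact: L1q_wsum].
move=> t; have [xa _ _] := L1q_wsum s La; have [xb _ _] := L1q_wsum s Lb.
rewrite (le_trans (ler_normB _ _))// normrM (ger0_norm l0).
by rewrite !ger0_norm.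
Qed.

Lemma measurable_wdiff s : measurable_fun setT (wdiff s).
Proof.
apply: measurable_funB; first exact/L1q_measurable/L1q_wsum.
apply: measurable_funM; first exact: measurable_cst.
exact/L1q_measurable/L1q_wsum.
Qed.

Definition energy s := \int[nu]_t pot q (wdiff s t).

Lemma L1_pot_wdiff s : L1 nu (fun t => pot q (wdiff s t)).
Proof.
by have [g g1 sg] := wdiff_dom s; exact: L1_pot (measurable_wdiff s) sg g1.
Qed.

Lemma L1q_thr_wdiff s : L1q (fun t => thr q (wdiff s t)).
Proof.
by have [g g1 sg] := wdiff_dom s; exact: L1q_thr (measurable_wdiff s) sg g1.
Qed.

Lemma energy_le s : energy s <= D.
Proof.
have [A0 A1 Aq] := L1q_wsum s La; have [B0 B1 Bq] := L1q_wsum s Lb.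
apply: (@le_trans _ _ (\int[nu]_t
    (D * (1 + wsum a s t `^ q - K * wsum b s t `^ q)))).
  apply: le_Rintegral => //; [exact: L1_pot_wdiff| |by move=> t _; exact: lD].
  by apply: L1Z; apply: L1B; [apply: L1D => //; exact: L1_cst|exact: L1Z].
rewrite RintegralZl//; last first.
  by apply: L1B; [apply: L1D => //; exact: L1_cst|exact: L1Z].
rewrite RintegralB//; [|by apply: L1D => //; exact: L1_cst|exact: L1Z].
rewrite RintegralD//; last exact: L1_cst.
have nu1 : fine (nu setT) = 1 by rewrite (probability_setT nu).
rewrite RintegralZl// Rintegral_cst// nu1 mul1r -[leRHS]mulr1 ler_wpM2l//.
by move: (aKb s); move: (Rintegral _ _ _) (Rintegral _ _ _) => x y; lra.
Qed.

Lemma energy_mid s s' :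
  energy s + energy s' + gapc q / 2 * \int[nu]_t
    ((thr q (wdiff s t) `^ (q / 2) - thr q (wdiff s' t) `^ (q / 2)) ^+ 2)
  <= 2 * energy (wscale 2^-1 (s ++ s')) /\
  L1 nu (fun t => (thr q (wdiff s t) `^ (q / 2)
                   - thr q (wdiff s' t) `^ (q / 2)) ^+ 2).
Proof.
have [t0 _ tq] := L1q_thr_wdiff s; have [t0' _ tq'] := L1q_thr_wdiff s'.
have Lsq : L1 nu (fun t => (thr q (wdiff s t) `^ (q / 2)
                   - thr q (wdiff s' t) `^ (q / 2)) ^+ 2).
  apply: L1_le (L1D tq tq').
    apply: measurable_funX; apply: measurable_funB; apply: measurable_fun_powR;
    exact/L1q_measurable/L1q_thr_wdiff.
  move=> t; rewrite ger0_norm ?sqr_ge0//.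
  rewrite -(sqr_powR_half q (t0 t)) -(sqr_powR_half q (t0' t)).
  by have := powR_ge0 (thr q (wdiff s t)) (q / 2);
     have := powR_ge0 (thr q (wdiff s' t)) (q / 2); nra.
split => //; rewrite /energy -RintegralZl// -RintegralD//; try exact: L1_pot_wdiff.
rewrite -RintegralD//; [|by apply: L1D; exact: L1_pot_wdiff|exact: L1Z].
rewrite -RintegralZl//; last exact: L1_pot_wdiff.
apply: le_Rintegral => //.
- by apply: L1D; [apply: L1D; exact: L1_pot_wdiff|exact: L1Z].
- by apply: L1Z; exact: L1_pot_wdiff.
- by move=> t _; rewrite wdiff_mid; exact: pot_concave.
Qed.

Lemma energy_ascent s s' r : 0 <= r ->
  let w t := thr q (wdiff s t + r * wdiff s' t) `^ (q - 1) in
  L1 nu (fun t => w t * wdiff s' t) ->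
  energy s + r * \int[nu]_t (w t * wdiff s' t)
  <= energy (s ++ wscale r s').
Proof.
move=> r0 w Lw; rewrite /energy -RintegralZl// -RintegralD//; last 2 first.
- exact: L1_pot_wdiff.
- exact: L1Z.
apply: le_Rintegral => //.
- by apply: L1D; [exact: L1_pot_wdiff|exact: L1Z].
- exact: L1_pot_wdiff.
- move=> t _; rewrite wdiffD//; apply: le_trans (pot_ascent _ _ q0).
  by rewrite lerD2l /w (mulrC (_ `^ _)) mulrA.
Qed.

End optimise.

Lemma wdiff1 l i t : wdiff l [:: (1, i)] t = a i t - l * b i t.
Proof. by rewrite /wdiff /wsum !big_seq1 expr1n !mul1r. Qed.

(* The weight is a limit of the gradients of the concave energy along a maximising
   sequence; [pot_concave] makes the sequence Cauchy and optimality in the direction of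
   one generator gives the inequality. *)
Lemma exists_weight : exists (l : R) (r : T -> R), [/\ 0 <= l, measurable_fun setT r,
  forall t, 1 <= r t, L1 nu (fun t => r t `^ q) & forall i,
  [/\ L1 nu (fun t => a i t * r t `^ (q - 1)),
      L1 nu (fun t => b i t * r t `^ (q - 1)) &
      \int[nu]_t (a i t * r t `^ (q - 1)) <=
      l * \int[nu]_t (b i t * r t `^ (q - 1))]].
Proof.
have [l [D [l0 D0 lD]]] := pot_le_trade q0 K0.
pose E := range (energy l); pose S := sup E.
have E_le s : energy l s <= S.
  apply: ub_le_sup; last by exists s.
  by exists D => _ [s' _ <-]; exact: energy_le.
have hE : has_sup E.
  split; first by exists (energy l [::]); exists [::].
  by exists D => _ [s' _ <-]; exact: energy_le.
pose c := gapc q; have c0 : 0 < c by exact: gapc_gt0.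
(* With defect [eps n] in the energy, [energy_mid] bounds the squared L^2 distance of [k n] and
   [k n.+1] by [2 eps n / (c/2) = 16^-n]. *)
pose eps n : R := c / 4 * 16^-1 ^+ n.
have eps0 n : 0 < eps n by rewrite mulr_gt0 ?divr_gt0 ?exprn_gt0 ?invr_gt0.
have /choice[s_ s_E] : forall n, exists s, S - eps n < energy l s.
  by move=> n; have [_ [s _ <-] h] := sup_adherent (eps0 n) hE; exists s.
pose k n t := thr q (wdiff l (s_ n) t) `^ (q / 2).
have k1 n t : 1 <= k n t by apply: powR_ge1; [exact: thr_ge1|rewrite divr_ge0// ltW].
have mk n : measurable_fun setT (k n).
  exact/measurable_fun_powR/L1q_measurable/L1q_thr_wdiff.
have kk n t : k n t ^+ 2 = thr q (wdiff l (s_ n) t) `^ q.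
  by rewrite sqr_powR_half// ltW// thr_gt0.
have [|n|n|ko [h [mko h1 h0 kko kh]]] := @L2_fast_cauchy R d T nu k mk.
- have [_ _] := L1q_thr_wdiff l0 (s_ 0%N).
  by under [X in _ -> L1 _ X]eq_fun do rewrite kk.
- exact: (energy_mid l0 (s_ n) (s_ n.+1)).2.
- have [en Ln] := energy_mid l0 (s_ n) (s_ n.+1).
  have := E_le (wscale 2^-1 (s_ n ++ s_ n.+1)).
  have := s_E n; have := s_E n.+1.
  have : eps n.+1 <= eps n.
    rewrite /eps ler_wpM2l ?divr_ge0 ?(ltW c0)// exprS ler_piMl ?exprn_ge0//.
    by rewrite invf_le1// ler1n.
  move=> e1 e2 e3 e4; have c2 : 0 < c / 2 by rewrite divr_gt0.
  rewrite -(ler_pM2l c2); have e5 : c / 2 * 16^-1 ^+ n = 2 * eps n.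
    by rewrite /eps; field.
  pose J := \int[nu]_t ((k n t - k n.+1 t) ^+ 2).
  have {}en : energy l (s_ n) + energy l (s_ n.+1) + c / 2 * J <=
      2 * energy l (wscale 2^-1 (s_ n ++ s_ n.+1)) by exact: en.
  rewrite -/J e5; move: e1 e2 e3 e4 en; move: (c / 2 * J) (eps n) (eps n.+1).
  move: (energy _ _) (energy _ _) (energy _ _) => x y z ? ? ?; lra.
(* The limit is controlled only almost everywhere; the maximum forces [1 <= r] at every point. *)
pose kM t := Num.max 1 (ko t).
pose r t := kM t `^ (2 / q).
have kM1 t : 1 <= kM t by rewrite le_max lexx.
have r1 t : 1 <= r t by rewrite powR_ge1// divr_ge0// ltW.
have mkM : measurable_fun setT kM.
  by apply: measurable_maxr => //; exact: measurable_cst.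
have mr : measurable_fun setT r by exact: measurable_fun_powR.
have rq t : r t `^ q = kM t ^+ 2.
  rewrite /r -powRrM divfK ?gt_eqF// -powR_mulrn// (le_trans ler01)//.
have kkM : \forall t \ae nu, k n t @[n --> \oo] --> kM t.
  apply: filterS kko => t kt; suff -> : kM t = ko t by [].
  apply/max_idPr; apply: (@ler_cvg_to _ _ _ R (fun=> 1) (k ^~ t) 1 (ko t) _ kt).
    exact: cvg_cst.
  by apply: nearW => n; exact: k1.
have thr_r : \forall t \ae nu, thr q (wdiff l (s_ n) t) @[n --> \oo] --> r t.
  apply: filterS kkM => t kt.
  under eq_fun => n.
    rewrite (_ : thr _ _ = k n t `^ (2 / q)); last first.
      rewrite /k -powRrM (_ : q / 2 * (2 / q) = 1) ?powRr1 ?(ltW (thr_gt0 _ _))//.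
      by field; rewrite gt_eqF.
    over.
  by apply: cvg_powR => //; rewrite (lt_le_trans ltr01).
exists l, r; split => //.
- have [] // := @Rint_dct R d T nu (fun n t => k n t ^+ 2) (fun t => r t `^ q) h.
  + by move=> n; exact: measurable_funX.
  + exact: measurable_fun_powR.
  + apply: filterS kkM => t kt; rewrite rq expr2.
    by under eq_fun do rewrite expr2; exact: cvgM.
  + by apply: filterS kh => t kt n; rewrite ger0_norm ?sqr_ge0.
(* The steps satisfy [eps n = c/4 * tau n ^ 2]. A step [tau n] along the generator [i] cannot gain
   more than the defect [eps n], so the derivative is at most [c/4 * tau n], which tends to 0. *)
move=> i; pose dl t := a i t - l * b i t; pose tau n : R := 4^-1 ^+ n.
have tau0 n : 0 < tau n by rewrite exprn_gt0// invr_gt0.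
have tau1 n : tau n <= 1 by rewrite exprn_ile1// ?invr_ge0// invf_le1// ler1n.
pose w n t := thr q (wdiff l (s_ n) t + tau n * dl t) `^ (q - 1).
have [a0 a1 aq] := La i; have [b0 b1 bq] := Lb i.
have ma := L1_measurable a1; have mb := L1_measurable b1.
have mdl : measurable_fun setT dl.
  by apply: measurable_funB => //; apply: measurable_funM => //; exact: measurable_cst.
have mw n : measurable_fun setT (w n).
  apply: measurable_fun_powR; apply: (measurableT_comp (measurable_thr q)).
  apply: measurable_funD; first exact: measurable_wdiff.
  by apply: measurable_funM => //; exact: measurable_cst.
have w_r : \forall t \ae nu, w n t @[n --> \oo] --> r t `^ (q - 1).
  apply: filterS thr_r => t tr; apply: cvg_powR; first exact: lt_le_trans (r1 t).
  pose C := `|q^-1 - 1| * `|dl t|.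
  have tau_0 : C * tau n @[n --> \oo] --> 0.
    rewrite -[X in _ --> X](mulr0 C); apply: cvgMl_tmp; apply: cvg_expr.
    by rewrite ger0_norm ?invr_ge0// invf_lt1 ?ltr1n.
  apply: (@squeeze_cvgr _ _ _ _ (fun n => thr q (wdiff l (s_ n) t) - C * tau n)
    (fun n => thr q (wdiff l (s_ n) t) + C * tau n)).
  - apply: nearW => n; have := thr_lip q (wdiff l (s_ n) t + tau n * dl t) (wdiff l (s_ n) t).
    have := thr_lip q (wdiff l (s_ n) t) (wdiff l (s_ n) t + tau n * dl t).
    move: (wdiff l (s_ n) t) => z.
    have -> : z - (z + tau n * dl t) = - (tau n * dl t) by ring.
    have -> : z + tau n * dl t - z = tau n * dl t by ring.
    have -> : C * tau n = `|q^-1 - 1| * `|tau n * dl t|.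
      by rewrite normrM (ger0_norm (ltW (tau0 n))) /C; ring.
    rewrite normrN; move: (`|_| * `|_|) (thr q z) (thr q _) => u v v'; lra.
  - by rewrite -[X in _ --> X]subr0; exact: cvgB.
  - by rewrite -[X in _ --> X]addr0; exact: cvgD.
(* Majorant from [mul_powRB1_le] and [powRD_le]: [Y] collects the generator and the Lipschitz change
   of [thr] under the perturbation, while [h^(1/q)] bounds the unperturbed [thr]. The sum
   [a i + b i] lets one majorant serve both integrals. *)
pose Y t := a i t + b i t + `|q^-1 - 1| * (a i t + l * b i t).
pose G t := (a i t + b i t) + 2 `^ q * (Y t `^ q + h t).
have LY : L1q Y.
  apply: L1qD; first exact: L1qD.
  by apply: L1qZ => //; apply: L1qD => //; exact: L1qZ.
have LG : L1 nu G.
  apply: L1D; first exact: L1D.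
  by apply: L1Z; apply: L1D => //; case: LY.
have dom y : (forall t, 0 <= y t <= a i t + b i t) ->
    \forall t \ae nu, forall n, `|y t * w n t| <= G t.
  move=> yab; apply: filterS kh => t kt n; have /andP[y0 y1] := yab t.
  have := mul_powRB1_le q0 y0 (thr_ge1 q (wdiff l (s_ n) t + tau n * dl t)).
  rewrite ger0_norm ?mulr_ge0 ?powR_ge0// => /le_trans; apply; apply: lerD => //.
  have [Y0 _ _] := LY.
  have hq : (h t `^ q^-1) `^ q = h t.
    by rewrite -powRrM mulVf ?gt_eqF// powRr1.
  rewrite -[in leRHS]hq; apply: le_trans (powRD_le q0 _ _); rewrite ?powR_ge0//.
  have t0 := thr_gt0 q (wdiff l (s_ n) t + tau n * dl t).
  apply: (ge0_ler_powR (ltW q0)); rewrite ?nnegrE; first by lra.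
    by rewrite addr_ge0 ?powR_ge0.
  have thr_h : thr q (wdiff l (s_ n) t) <= h t `^ q^-1.
    have := kt n; rewrite kk => /(ge0_ler_powR _) -/(_ q^-1).
    rewrite invr_ge0 (ltW q0) !nnegrE powR_ge0 h0 => /(_ isT isT isT).
    by rewrite -powRrM divff ?gt_eqF// powRr1// (ltW (thr_gt0 _ _)).
  have := thr_lip q (wdiff l (s_ n) t + tau n * dl t) (wdiff l (s_ n) t).
  have -> : wdiff l (s_ n) t + tau n * dl t - wdiff l (s_ n) t = tau n * dl t.
    by ring.
  rewrite normrM (ger0_norm (ltW (tau0 n))).
  have dlab : tau n * `|dl t| <= a i t + l * b i t.
    rewrite -[leRHS]mul1r ler_pM ?(ltW (tau0 n))//.
    rewrite (le_trans (ler_normB _ _))// normrM (ger0_norm l0).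
    by rewrite !ger0_norm.
  have := ler_wpM2l (normr_ge0 (q^-1 - 1)) dlab.
  rewrite /Y; move: thr_h y1; move: (`|_| * (_ * _)) (`|_| * (_ + _)) => u v.
  by move: (thr q _) (thr q _) (h t `^ _) (a i t + b i t) => ? ? ? ? ? ? ? ?; lra.
have [|||||ia_ ian cva] := @Rint_dct R d T nu (fun n t => a i t * w n t)
  (fun t => a i t * r t `^ (q - 1)) G.
- by move=> n; exact: measurable_funM.
- by apply: measurable_funM => //; exact: measurable_fun_powR.
- by apply: filterS w_r => t wt; exact: cvgMl_tmp.
- exact: LG.
- by apply: dom => t; rewrite a0 lerDl b0.
have [|||||ib_ ibn cvb] := @Rint_dct R d T nu (fun n t => b i t * w n t)
  (fun t => b i t * r t `^ (q - 1)) G.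
- by move=> n; exact: measurable_funM.
- by apply: measurable_funM => //; exact: measurable_fun_powR.
- by apply: filterS w_r => t wt; exact: cvgMl_tmp.
- exact: LG.
- by apply: dom => t; rewrite b0 lerDr a0.
split => //.
have wdlE n : \int[nu]_t (w n t * dl t) =
    \int[nu]_t (a i t * w n t) - l * \int[nu]_t (b i t * w n t).
  have -> : \int[nu]_t (w n t * dl t) =
      \int[nu]_t (a i t * w n t - l * (b i t * w n t)).
    by apply: eq_Rintegral => t _; rewrite /dl; ring.
  rewrite RintegralB//; [|exact: ian|by apply: L1Z; exact: ibn].
  by rewrite RintegralZl//; exact: ibn.
have wdlL n : L1 nu (fun t => w n t * dl t).
  rewrite (_ : (fun t => _) = fun t => a i t * w n t - l * (b i t * w n t)).
    by apply: L1B => //; exact: L1Z.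
  by apply/funext => t; rewrite /dl; ring.
have up n : \int[nu]_t (a i t * w n t) - l * \int[nu]_t (b i t * w n t)
    <= c / 4 * tau n.
  have dlE : wdiff l [:: (1, i)] = dl by apply/funext => t; exact: wdiff1.
  have := @energy_ascent l l0 (s_ n) [:: (1, i)] (tau n) (ltW (tau0 n)).
  rewrite dlE => /(_ (wdlL n)) e3; rewrite wdlE in e3.
  have {}e3 := le_trans e3 (E_le _); have e1 := s_E n.
  have e2 : eps n = tau n * (c / 4 * tau n).
    rewrite /eps /tau mulrCA -exprMn -invfM.
    by congr (_ * _^-1 ^+ _); rewrite -natrM.
  rewrite -(ler_pM2l (tau0 n)) -e2; move: e3 e1.
  move: (tau n * (_ - _)) (energy _ _) (eps n) => x y z; lra.
rewrite -subr_le0; apply: (@ler_cvg_to nat \oo _ R (fun n =>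
  \int[nu]_t (a i t * w n t) - l * \int[nu]_t (b i t * w n t))
  (fun n => c / 4 * tau n)).
- by apply: cvgB => //; exact: cvgMl_tmp.
- rewrite -[X in _ --> X](mulr0 (c / 4)); apply: cvgMl_tmp; apply: cvg_expr.
  by rewrite ger0_norm ?invr_ge0// invf_lt1 ?ltr1n.
- by apply: nearW.
Qed.

End family.
End weight.

(** * Random signs *)

Section average.
Context {R : realType} {S : finType}.
Implicit Types F G : S -> R.

Definition avg F := (#|S|%:R)^-1 * \sum_s F s.

Lemma avgD F G : avg (fun s => F s + G s) = avg F + avg G.
Proof. by rewrite /avg big_split mulrDr. Qed.

Lemma avgZ (c : R) F : avg (fun s => c * F s) = c * avg F.
Proof. by rewrite /avg -mulr_sumr mulrCA. Qed.

Lemma le_avg F G : (forall s, F s <= G s) -> avg F <= avg G.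
Proof. by move=> FG; rewrite ler_wpM2l ?invr_ge0// ler_sum. Qed.

Lemma avg_ge0 F : (forall s, 0 <= F s) -> 0 <= avg F.
Proof. by move=> F0; rewrite mulr_ge0 ?invr_ge0// sumr_ge0. Qed.

Hypothesis S0 : (0 < #|S|)%N.

Lemma avg_cst (c : R) : avg (fun=> c) = c.
Proof.
by rewrite /avg sumr_const -(mulr_natl c) mulKf// pnatr_eq0 -lt0n.
Qed.

Lemma avg_eq0 F : (forall s, 0 <= F s) -> avg F = 0 -> forall s, F s = 0.
Proof.
move=> F0 /eqP; rewrite mulf_eq0 invr_eq0 pnatr_eq0 (gtn_eqF S0)/=.
by move=> /eqP/psumr_eq0P FE s; apply: FE.
Qed.

Lemma jensen_ge1 (q : R) F : 1 <= q -> (forall s, 0 <= F s) ->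
  avg F `^ q <= avg (fun s => F s `^ q).
Proof.
move=> q1 F0; have := avg_ge0 F0; rewrite le_eqVlt => /predU1P[<-|m0].
  by rewrite powR0 ?avg_ge0// => [s|]; [exact: powR_ge0|rewrite gt_eqF//; lra].
have : avg (fun s => avg F `^ q + q * avg F `^ (q - 1) * (F s - avg F)) <=
    avg (fun s => F s `^ q).
  by apply: le_avg => s; apply: powR_ge_tangent.
by rewrite avgD avgZ avgD !avg_cst subrr mulr0 addr0.
Qed.

Lemma jensen_le1 (q : R) F : 0 < q <= 1 -> (forall s, 0 <= F s) ->
  avg (fun s => F s `^ q) <= avg F `^ q.
Proof.
move=> /andP[q0 q1] F0; have := avg_ge0 F0; rewrite le_eqVlt => /predU1P[m0|m0].
  under eq_fun do rewrite (avg_eq0 F0 (esym m0)) powR0 ?gt_eqF//.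
  by rewrite avg_cst powR_ge0.
have : avg (fun s => F s `^ q) <=
    avg (fun s => avg F `^ q + q * avg F `^ (q - 1) * (F s - avg F)).
  by apply: le_avg => s; apply: powR_le_tangent => //; rewrite ltW.
by rewrite avgD avgZ avgD !avg_cst subrr mulr0 addr0.
Qed.

End average.

Section signs.
Context {R : realType} (n : nat).
Local Notation sgs := {ffun 'I_n -> bool}.
Implicit Types (x y : 'I_n -> R) (s : sgs).

Lemma card_signs : #|sgs| = (2 ^ n)%N.
Proof. by rewrite card_ffun card_bool card_ord. Qed.

Lemma card_signs_gt0 : (0 < #|sgs|)%N.
Proof. by rewrite card_signs expn_gt0. Qed.

Definition sgsum x s : R := \sum_k (-1) ^+ s k * x k.

(** Flipping the sign at [j] is an involution that reverses every summand. *)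
Lemma sum_signs_neq (j k : 'I_n) : j != k ->
  \sum_(s : sgs) (-1) ^+ s j * (-1) ^+ s k = 0 :> R.
Proof.
move=> jk; pose fl s : sgs := [ffun i => (i == j) (+) s i].
have flK : involutive fl by move=> s; apply/ffunP => i; rewrite !ffunE addKb.
suff h : \sum_(s : sgs) (-1) ^+ s j * (-1) ^+ s k =
  - (\sum_(s : sgs) (-1) ^+ s j * (-1) ^+ s k) :> R by lra.
rewrite {1}(reindex_inj (inv_inj flK)) -sumrN; apply: eq_bigr => s _.
rewrite !ffunE eqxx eq_sym (negbTE jk) addTb addFb.
by rewrite signrN mulNr.
Qed.

Lemma avg_sgsum_sqr x : avg (fun s => sgsum x s ^+ 2) = \sum_k x k ^+ 2.
Proof.
have -> : (fun s => sgsum x s ^+ 2) =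
    fun s => \sum_j \sum_k (x j * x k) * ((-1) ^+ s j * (-1) ^+ s k).
  apply/funext => s; rewrite expr2 /sgsum mulr_suml; apply: eq_bigr => j _.
  by rewrite mulr_sumr; apply: eq_bigr => k _; ring.
rewrite /avg exchange_big/= mulr_sumr; apply: eq_bigr => j _.
rewrite exchange_big/= (bigD1 j)//= [X in _ + X]big1 ?addr0 => [|k kj]; last first.
  by rewrite -mulr_sumr sum_signs_neq ?mulr0// eq_sym.
rewrite -mulr_sumr (eq_bigr (fun=> 1)) => [|s _]; last by rewrite -expr2 sqrr_sign.
by rewrite sumr_const mulrCA mulVf ?mulr1// pnatr_eq0 -lt0n card_signs_gt0.
Qed.

(** The sharp exponent is [t^2/2]. With [2 t^2] two elementary cases suffice: [|t| <= 2 t^2] if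
    [t^2 >= 1/2], and [expR u <= 1/(1-u)] otherwise. *)
Lemma cosh_le (t : R) : expR t + expR (- t) <= 2 * expR (2 * t ^+ 2).
Proof.
have [h|h] := leP (2^-1) (t ^+ 2).
  have t2 : `|t| <= 2 * t ^+ 2.
    by have := real_normK (num_real t); have := normr_ge0 t; nra.
  have : expR t <= expR (2 * t ^+ 2).
    by rewrite ler_expR (le_trans (ler_norm _)).
  have : expR (- t) <= expR (2 * t ^+ 2).
    by rewrite ler_expR (le_trans (ler_norm _))// normrN.
  lra.
have t1 : -1 < t < 1 by nra.
have inv_le (u : R) : -1 < u < 1 -> expR u <= (1 - u)^-1.
  move=> /andP[u1 u2]; have u0 : 0 < 1 - u by lra.
  rewrite -[u in expR u]opprK expRN lef_pV2 ?posrE ?expR_gt0//.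
  by have := expR_ge1Dx (- u); lra.
have := inv_le t t1; have t1' : -1 < - t < 1 by lra.
have := inv_le (- t) t1'; rewrite opprK => h1 h2.
have h3 := expR_ge1Dx (2 * t ^+ 2).
have t2 : 0 <= t ^+ 2 by exact: sqr_ge0.
have h4 : 2 * (1 - t ^+ 2)^-1 <= 2 * expR (2 * t ^+ 2).
  rewrite ler_pM2l// -[leLHS]mul1r ler_pdivrMr; last lra.
  by nra.
apply: le_trans h4; apply: (le_trans (lerD h2 h1)); apply: eqW.
by field; rewrite !lt0r_neq0//; nra.
Qed.

Lemma avg_exp_sgsum x :
  avg (fun s => expR (sgsum x s)) <= expR (2 * \sum_k x k ^+ 2).
Proof.
rewrite /avg (eq_bigr (fun s => \prod_k expR ((-1) ^+ (s k : bool) * x k))); last first.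
  by move=> s _; rewrite /sgsum expR_sum.
rewrite -(bigA_distr_bigA (fun k (b : bool) => expR ((-1) ^+ b * x k))).
rewrite ler_pdivrMl ?ltr0n ?card_signs_gt0//.
rewrite card_signs mulr_sumr expR_sum natrX.
rewrite -[X in 2 ^+ X](card_ord n) -prodr_const -big_split/=.
apply: ler_prod => k _; rewrite big_bool/= expr0 expr1 mul1r mulN1r.
by rewrite addr_ge0 ?expR_ge0//= addrC cosh_le.
Qed.

End signs.

(** * Khintchine's inequality for complex coefficients *)

Section khintchine.
Context {R : realType}.

Lemma powR_le_exp (m t : R) : 0 < m -> 0 <= t -> t `^ m <= m `^ m * expR t.
Proof.
move=> m0 t0; rewrite -{1}(divfK (lt0r_neq0 m0) t) powRM ?divr_ge0 ?(ltW m0)//.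
rewrite mulrC; apply: ler_wpM2l; first exact: powR_ge0.
rewrite -{2}(divfK (lt0r_neq0 m0) t) expRM.
apply: (ge0_ler_powR (ltW m0)); rewrite ?nnegrE ?divr_ge0 ?expR_ge0 ?(ltW m0)//.
by have := expR_ge1Dx (t / m); lra.
Qed.

Lemma sgsumN n (x : 'I_n -> R) s : sgsum (fun k => - x k) s = - sgsum x s.
Proof. by rewrite /sgsum -sumrN; apply: eq_bigr => k _; rewrite mulrN. Qed.

Lemma sgsumZ n (c : R) (x : 'I_n -> R) s :
  sgsum (fun k => c * x k) s = c * sgsum x s.
Proof. by rewrite /sgsum mulr_sumr; apply: eq_bigr => k _; rewrite mulrCA. Qed.

(** The sub-Gaussian exponential moments dominate every power: [|z|^(2q) <= (2q)^(2q) exp |z|], and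
    [exp |z|] is at most [exp z + exp (-z)]. *)
Lemma sgsum_moment (q : R) : 0 < q -> exists2 M : R, 0 < M &
  forall n (x : 'I_n -> R), \sum_k x k ^+ 2 <= 1 ->
    avg (fun s => (sgsum x s ^+ 2) `^ q) <= M.
Proof.
move=> q0; have q20 : 0 < 2 * q by rewrite mulr_gt0.
have P0 := powR_gt0 (2 * q) q20.
exists ((2 * q) `^ (2 * q) * (expR 2 + expR 2)).
  by rewrite mulr_gt0// addr_gt0// expR_gt0.
move=> n x x1.
apply: (@le_trans _ _ (avg (fun s => (2 * q) `^ (2 * q) *
    (expR (sgsum x s) + expR (sgsum (fun k => - x k) s))))).
  apply: le_avg => s; rewrite -(real_normK (num_real _)) -powR_mulrn// -powRrM.
  apply: le_trans (powR_le_exp q20 (normr_ge0 _)) _.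
  apply: ler_wpM2l; first exact: powR_ge0.
  rewrite sgsumN; case: (ger0P (sgsum x s)) => _.
    by rewrite lerDl expR_ge0.
  by rewrite lerDr expR_ge0.
rewrite avgZ avgD; apply: ler_wpM2l; first exact: powR_ge0.
by apply: lerD; apply: le_trans (avg_exp_sgsum _) _; rewrite ler_expR;
  under eq_bigr do rewrite ?sqrrN; lra.
Qed.

Definition cmod2 n (x y : 'I_n -> R) s := sgsum x s ^+ 2 + sgsum y s ^+ 2.

Lemma cmod2_ge0 n (x y : 'I_n -> R) s : 0 <= cmod2 x y s.
Proof. by rewrite addr_ge0// sqr_ge0. Qed.

Lemma avg_cmod2 n (x y : 'I_n -> R) :
  avg (cmod2 x y) = \sum_k (x k ^+ 2 + y k ^+ 2).
Proof. by rewrite avgD !avg_sgsum_sqr big_split. Qed.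

Lemma cmod2_moment (q : R) : 0 < q -> exists2 M : R, 0 < M &
  forall n (x y : 'I_n -> R), \sum_k (x k ^+ 2 + y k ^+ 2) = 1 ->
    avg (fun s => cmod2 x y s `^ q) <= M.
Proof.
move=> q0; have [M M0 HM] := sgsum_moment q0.
exists (2 `^ q * (M + M)); first by rewrite mulr_gt0 ?powR_gt0// addr_gt0.
move=> n x y; rewrite big_split/= => xy1.
have x0 : 0 <= \sum_k x k ^+ 2 by apply: sumr_ge0 => k _; exact: sqr_ge0.
have y0 : 0 <= \sum_k y k ^+ 2 by apply: sumr_ge0 => k _; exact: sqr_ge0.
apply: (@le_trans _ _ (avg (fun s => 2 `^ q *
    ((sgsum x s ^+ 2) `^ q + (sgsum y s ^+ 2) `^ q)))).
  by apply: le_avg => s; apply: powRD_le; rewrite ?sqr_ge0.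
rewrite avgZ avgD; apply: ler_wpM2l; first exact: powR_ge0.
by apply: lerD; apply: HM; lra.
Qed.

(** These are the two directions that Jensen's inequality does not give. For q >= 1 the moment bound
    is enough; for q <= 1 the second moment prevents the mean 1 from being carried by rare large
    values. *)
Lemma khintchine1 (q : R) : 0 < q -> exists2 C : R, 0 < C &
  forall n (x y : 'I_n -> R), \sum_k (x k ^+ 2 + y k ^+ 2) = 1 ->
  (1 <= q -> avg (fun s => cmod2 x y s `^ q) <= C) /\
  (q <= 1 -> 1 <= C * avg (fun s => cmod2 x y s `^ q)).
Proof.
move=> q0; have [M M0 HM] := cmod2_moment q0.
have [A' A'0 HA] := cmod2_moment (ltr0Sn R 1).
pose A := 2 * A'; have A0 : 0 < A by rewrite mulr_gt0.
exists (Num.max M (2 * A `^ (1 - q))); first by rewrite lt_max M0.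
move=> n x y xy1; split=> q1; first by rewrite (le_trans (HM _ _ _ xy1))// le_max lexx.
have av0 : 0 <= avg (fun s => cmod2 x y s `^ q).
  by apply: avg_ge0 => s; exact: powR_ge0.
apply: (@le_trans _ _ (2 * A `^ (1 - q) * avg (fun s => cmod2 x y s `^ q))); last first.
  by rewrite ler_wpM2r// le_max lexx orbT.
(* Small values satisfy [z <= A ^ (1 - q) * z ^ q], large ones [z <= z ^ 2 / A]; the
   second moment makes the latter contribute at most 1/2. *)
have : avg (cmod2 x y) <= avg (fun s => A `^ (1 - q) * cmod2 x y s `^ q +
    A^-1 * cmod2 x y s `^ 2).
  apply: le_avg => s; have := cmod2_ge0 x y s; move: (cmod2 x y s) => z.
  rewrite le_eqVlt => /predU1P[<-|z0].
    by rewrite addr_ge0 ?mulr_ge0 ?powR_ge0// invr_ge0 ltW.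
  have [zA|zA] := leP z A.
    rewrite -[leLHS]addr0 lerD//; last by rewrite mulr_ge0 ?powR_ge0// invr_ge0 ltW.
    rewrite -[leLHS](powRr1 (ltW z0)) -{1}(subrK q 1) gt0_powRD//.
    apply: ler_wpM2r; first exact: powR_ge0.
    by apply: ge0_ler_powR; rewrite ?nnegrE ?subr_ge0// ltW.
  rewrite -[leLHS]add0r lerD ?mulr_ge0 ?powR_ge0//.
  rewrite ler_pdivlMl// (powR_mulrn 2 (ltW z0)) expr2.
  by rewrite ler_pM2r// ltW.
rewrite avg_cmod2 xy1 avgD !avgZ.
have := HA _ _ _ xy1; rewrite -(ler_pM2l (x := A^-1)) ?invr_gt0//.
have -> : A^-1 * A' = 2^-1 by rewrite /A; field; rewrite gt_eqF.
by move: (A^-1 * _) (A `^ _) av0 => a b av0; move: (avg _) av0 => c; lra.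
Qed.

Lemma khintchine (q : R) : 0 < q -> exists2 C : R, 0 < C &
  forall n (x y : 'I_n -> R),
  (1 <= q -> avg (fun s => cmod2 x y s `^ q)
             <= C * (\sum_k (x k ^+ 2 + y k ^+ 2)) `^ q) /\
  (q <= 1 -> (\sum_k (x k ^+ 2 + y k ^+ 2)) `^ q
             <= C * avg (fun s => cmod2 x y s `^ q)).
Proof.
move=> q0; have [C C0 HC] := khintchine1 q0; exists C => // n x y.
set S := \sum_k _; have : 0 <= S.
  by apply: sumr_ge0 => k _; rewrite addr_ge0 ?sqr_ge0.
rewrite le_eqVlt => /predU1P[S0|S0].
  have Q0 s : cmod2 x y s = 0.
    apply: (avg_eq0 (card_signs_gt0 n)); first exact: cmod2_ge0.
    by rewrite avg_cmod2.
  under eq_fun do rewrite Q0 powR0 ?gt_eqF//.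
  by rewrite (avg_cst (card_signs_gt0 n)) -S0 powR0 ?gt_eqF// mulr0 lexx.
pose r := Num.sqrt S; have r0 : 0 < r by rewrite sqrtr_gt0.
have rr : r ^+ 2 = S by rewrite sqr_sqrtr// ltW.
pose x' k := r^-1 * x k; pose y' k := r^-1 * y k.
have S1 : \sum_k (x' k ^+ 2 + y' k ^+ 2) = 1.
  under eq_bigr do rewrite /x' /y' !exprMn -mulrDr exprVn rr.
  by rewrite -mulr_sumr -/S mulVf// gt_eqF.
have QE s : cmod2 x y s `^ q = S `^ q * cmod2 x' y' s `^ q.
  rewrite -powRM ?cmod2_ge0 ?(ltW S0)//; congr (_ `^ _).
  rewrite /cmod2 !sgsumZ !exprMn exprVn rr.
  by field; rewrite gt_eqF.
under eq_fun do rewrite QE.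
rewrite avgZ; have [h1 h2] := HC _ _ _ S1; split => [/h1|/h2] h.
  by rewrite mulrC ler_wpM2r// powR_ge0.
by rewrite mulrCA -{1}[S `^ q]mulr1 ler_wpM2l// powR_ge0.
Qed.

End khintchine.

(** * From pointwise averages to averages of norms *)

Section weighted_jensen.
Context {R : realType} {S : finType}.
Hypothesis S0 : (0 < #|S|)%N.
Implicit Types (N h : S -> R).

Lemma avg_gt0 N : (forall s, 0 < N s) -> 0 < avg N.
Proof.
move=> N0; have := avg_ge0 (fun s => ltW (N0 s)).
rewrite le_eqVlt => /predU1P[/esym/(avg_eq0 S0)|//].
move=> /(_ (fun s => ltW (N0 s))) N00.
by have /card_gt0P[s _] := S0; have := N0 s; rewrite N00 ltxx.
Qed.

(* Only the average of the (quasi-)norms [N s] is known, not that of their [q]-th powers: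
   Jensen's inequality with the weights [N s] is used instead of Kahane's inequality. *)
Lemma wjensen_ge1 (q : R) N h : 1 <= q -> (forall s, 0 < N s) ->
  (forall s, 0 <= h s) ->
  avg N `^ (1 - q) * avg h `^ q <= avg (fun s => N s `^ (1 - q) * h s `^ q).
Proof.
move=> q1 N0 h0; have A0 := avg_gt0 N0.
have q0 : 0 < q by lra.
have := avg_ge0 h0; rewrite le_eqVlt => /predU1P[<-|H0].
  rewrite powR0 ?gt_eqF// mulr0; apply: avg_ge0 => s.
  by rewrite mulr_ge0 ?powR_ge0.
pose m := avg h / avg N; have m0 : 0 < m by exact: divr_gt0.
have : avg (fun s => m `^ q * N s + q * m `^ (q - 1) * (h s + (- m) * N s)) <=
    avg (fun s => N s `^ (1 - q) * h s `^ q).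
  apply: le_avg => s.
  have := ler_wpM2l (ltW (N0 s)) (powR_ge_tangent q1 m0 (divr_ge0 (h0 s) (ltW (N0 s)))).
  rewrite (powRM _ (h0 s)) ?invr_ge0 ?(ltW (N0 s))// => hh.
  have -> : N s `^ (1 - q) * h s `^ q = N s * (h s `^ q * (N s)^-1 `^ q).
    rewrite gt0_powRB// powRr1 ?(ltW (N0 s))//.
    rewrite -(powR_inv1 (ltW (N0 s))) -powRrM mulN1r powRN; ring.
  apply: le_trans hh; apply: eqW; field; rewrite gt_eqF//.
rewrite avgD avgZ avgZ avgD avgZ (_ : avg h + - m * avg N = 0); last first.
  by rewrite /m; field; rewrite gt_eqF.
rewrite mulr0 addr0; apply: le_trans; apply: eqW.
rewrite /m (powRM _ (ltW H0)) ?invr_ge0 ?(ltW A0)//.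
rewrite -(powR_inv1 (ltW A0)) -powRrM mulN1r powRN.
by rewrite gt0_powRB// powRr1 ?(ltW A0)//; ring.
Qed.

Lemma wjensen_le1 (q : R) N h : 0 < q <= 1 -> (forall s, 0 < N s) ->
  (forall s, 0 <= h s) ->
  avg (fun s => N s `^ (1 - q) * h s `^ q) <= avg N `^ (1 - q) * avg h `^ q.
Proof.
move=> /andP[q0 q1] N0 h0; have A0 := avg_gt0 N0.
have := avg_ge0 h0; rewrite le_eqVlt => /predU1P[H0|H0].
  under eq_fun do rewrite (avg_eq0 S0 h0 (esym H0)) powR0 ?gt_eqF// mulr0.
  by rewrite (avg_cst S0) mulr_ge0 ?powR_ge0.
pose m := avg h / avg N; have m0 : 0 < m by exact: divr_gt0.
have : avg (fun s => N s `^ (1 - q) * h s `^ q) <=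
    avg (fun s => m `^ q * N s + q * m `^ (q - 1) * (h s + (- m) * N s)).
  apply: le_avg => s.
  have q01 : 0 <= q <= 1 by rewrite ltW.
  have := ler_wpM2l (ltW (N0 s)) (powR_le_tangent q01 m0 (divr_ge0 (h0 s) (ltW (N0 s)))).
  rewrite (powRM _ (h0 s)) ?invr_ge0 ?(ltW (N0 s))// => hh.
  have -> : N s `^ (1 - q) * h s `^ q = N s * (h s `^ q * (N s)^-1 `^ q).
    rewrite gt0_powRB// powRr1 ?(ltW (N0 s))//.
    rewrite -(powR_inv1 (ltW (N0 s))) -powRrM mulN1r powRN; ring.
  apply: (le_trans hh); apply: eqW; field; rewrite gt_eqF//.
rewrite avgD avgZ avgZ avgD avgZ (_ : avg h + - m * avg N = 0); last first.
  by rewrite /m; field; rewrite gt_eqF.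
rewrite mulr0 addr0 => /le_trans; apply; apply: eqW.
rewrite /m (powRM _ (ltW H0)) ?invr_ge0 ?(ltW A0)//.
rewrite -(powR_inv1 (ltW A0)) -powRrM mulN1r powRN.
by rewrite gt0_powRB// powRr1 ?(ltW A0)//; ring.
Qed.

Context d (T : measurableType d) (mu : {measure set T -> \bar R}).
Variables (q C : R) (h : S -> T -> R).
Hypotheses (q0 : 0 < q) (C0 : 0 < C) (h0 : forall s t, 0 <= h s t).
Hypothesis mh : forall s, measurable_fun setT (h s).
Hypothesis hq : forall s, L1 mu (fun t => h s t `^ q).
Let H t := avg (h^~ t).
Let N s := (\int[mu]_t (h s t `^ q)) `^ q^-1.
Hypothesis khin : forall t, (1 <= q -> avg (fun s => h s t `^ q) <= C * H t `^ q) /\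
  (q <= 1 -> H t `^ q <= C * avg (fun s => h s t `^ q)).

Let L1_avg (F : S -> T -> R) : (forall s, L1 mu (F s)) ->
  L1 mu (fun t => avg (F^~ t)).
Proof. by move=> hF; apply: L1Z; exact: L1_sum. Qed.

Let Rint_avg (F : S -> T -> R) : (forall s, L1 mu (F s)) ->
  \int[mu]_t avg (F^~ t) = avg (fun s => \int[mu]_t F s t).
Proof.
move=> hF; rewrite /avg RintegralZl//; last exact: L1_sum.
congr (_ * _); apply: EFin_inj; rewrite EFin_Rintegral; last exact: L1_sum.
rewrite -sumEFin; under eq_bigr do rewrite EFin_Rintegral//.
under eq_integral do rewrite -sumEFin.
by rewrite (@integral_sum _ _ _ mu _ measurableT S (fun s t => (F s t)%:E)).
Qed.

Let mH : measurable_fun setT H.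
Proof.
by apply: measurable_funM; [exact: measurable_cst|exact: measurable_sum].
Qed.

Let H0 t : 0 <= H t. Proof. by apply: avg_ge0. Qed.

Lemma L1_avg_powR : L1 mu (fun t => H t `^ q).
Proof.
apply: (@L1_le _ _ _ _ _ (fun t => (1 + C) * avg (fun s => h s t `^ q))).
- exact: (measurableT_comp (measurable_powR _)).
- move=> t; rewrite ger0_norm ?powR_ge0//.
  have a0 : 0 <= avg (fun s => h s t `^ q) by apply: avg_ge0 => s; exact: powR_ge0.
  have [q1|q1] := leP 1 q.
    apply: le_trans (jensen_ge1 S0 q1 (fun s => h0 s t)) _.
    by rewrite ler_peMl// lerDl ltW.
  have [_ /(_ (ltW q1)) k] := khin t; apply: (le_trans k).
  by rewrite ler_wpM2r// lerDr.
- by apply: L1Z; exact: L1_avg.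
Qed.

Let Nq s : N s `^ q = \int[mu]_t (h s t `^ q).
Proof.
rewrite /N -powRrM mulVf ?gt_eqF// powRr1// Rintegral_ge0// => t _.
exact: powR_ge0.
Qed.

Let N0 s : 0 <= N s. Proof. exact: powR_ge0. Qed.

(** In the application [h] is a squared modulus and [q = p/2], so [N s] is a squared L^p norm. For q
    >= 1, Jensen is followed by Khintchine under the integral. For q < 1, weighted Jensen gives
    [avg N <= (2 avg N)^(1-q) \int H^q], which is solved for [avg N]. *)
Lemma avg_norm_le : avg N `^ q <= (C + 2) * \int[mu]_t (H t `^ q).
Proof.
have I0 : 0 <= \int[mu]_t (H t `^ q) by apply: Rintegral_ge0 => t _; exact: powR_ge0.
have [q1|q1] := leP 1 q.
  apply: le_trans (jensen_ge1 S0 q1 N0) _; under eq_fun do rewrite Nq.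
  rewrite -Rint_avg//; apply: (@le_trans _ _ (C * \int[mu]_t (H t `^ q))).
    rewrite -RintegralZl//; last exact: L1_avg_powR.
    apply: le_Rintegral => //; first exact: L1_avg.
      by apply: L1Z; exact: L1_avg_powR.
    by move=> t _; have [k _] := khin t; exact: k.
  by rewrite ler_wpM2r// lerDl.
have := avg_ge0 N0; rewrite le_eqVlt => /predU1P[<-|A0].
  by rewrite powR0 ?gt_eqF// mulr_ge0// addr_ge0// ltW.
(* Adding the mean makes the weights positive and only doubles their average. *)
pose N' s := N s + avg N.
have N'0 s : 0 < N' s by rewrite ltr_wpDl.
have N'E : avg N' = 2 * avg N by rewrite avgD (avg_cst S0) mulrDl mul1r.
have : avg N <= avg N' `^ (1 - q) * \int[mu]_t (H t `^ q).
  rewrite -RintegralZl//; last exact: L1_avg_powR.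
  have : \int[mu]_t (avg (fun s => N' s `^ (1 - q) * h s t `^ q)) <=
     \int[mu]_t (avg N' `^ (1 - q) * H t `^ q).
    apply: le_Rintegral => //.
    - by apply: (@L1_avg (fun s t => N' s `^ (1 - q) * h s t `^ q)) => s; exact: L1Z.
    - by apply: L1Z; exact: L1_avg_powR.
    - by move=> t _; apply: wjensen_le1 => //; rewrite q0 ltW.
  apply: le_trans; rewrite (@Rint_avg (fun s t => N' s `^ (1 - q) * h s t `^ q)); last first.
    by move=> s; exact: L1Z.
  apply: le_avg => s; rewrite RintegralZl//; last exact: hq.
  rewrite -[Rintegral _ _ _]Nq.
  have := N0 s; rewrite le_eqVlt => /predU1P[<-|Ns0].
    by rewrite mulr_ge0 ?powR_ge0.
  rewrite -[leLHS](powRr1 (N0 s)) -{1}(subrK q 1) gt0_powRD//.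
  apply: ler_wpM2r; first exact: powR_ge0.
  apply: ge0_ler_powR; rewrite ?nnegrE ?subr_ge0 ?(ltW q1) ?(ltW (N'0 s))//.
  by rewrite lerDl ltW.
rewrite N'E powRM ?(ltW A0)// => h1.
have h2 := ler_wpM2l (powR_ge0 (avg N) (q - 1)) h1.
rewrite mulrC -powRB1// in h2; apply: (le_trans h2).
have e : avg N `^ (q - 1) * avg N `^ (1 - q) = 1.
  rewrite -gt0_powRD// (_ : q - 1 + (1 - q) = 0) ?powRr0//; ring.
rewrite -mulrA (mulrCA _ (2 `^ _)) (mulrA (avg N `^ _)) e mul1r.
apply: ler_wpM2r => //.
apply: (@le_trans _ _ 2); last by rewrite lerDr ltW.
by apply: ler1_powR; [rewrite ler1n|rewrite gerBl ltW].
Qed.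

(** For q < 1 Khintchine and Jensen suffice. For q >= 1 the weights [N' s = N s + dl] give
    [(avg N')^(1-q) \int H^q <= avg N']; the shift keeps them positive when some norms vanish. *)
Lemma le_avg_norm (dl : R) : 0 < dl ->
  \int[mu]_t (H t `^ q) <= (C + 2) * (avg N + dl) `^ q.
Proof.
move=> dl0; have [q1|q1] := leP 1 q; last first.
  apply: (@le_trans _ _ (C * avg N `^ q)); last first.
    apply: ler_pM; rewrite ?powR_ge0 ?lerDl ?(ltW C0)//.
    apply: (ge0_ler_powR (ltW q0)); rewrite ?nnegrE ?lerDl ?(ltW dl0)//.
      exact: avg_ge0.
    by rewrite addr_ge0 ?avg_ge0// ltW.
  apply: (@le_trans _ _ (\int[mu]_t (C * avg (fun s => h s t `^ q)))).
    apply: le_Rintegral => //; first exact: L1_avg_powR.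
      by apply: L1Z; exact: L1_avg.
    by move=> t _; have [_ k] := khin t; exact/k/ltW.
  rewrite RintegralZl//; last exact: L1_avg.
  rewrite Rint_avg//; apply: ler_wpM2l; first exact: ltW.
  under eq_fun do rewrite -Nq.
  by apply: jensen_le1 => //; rewrite q0 ltW.
pose N' s := N s + dl.
have N'0 s : 0 < N' s by rewrite ltr_wpDl.
have N'E : avg N' = avg N + dl by rewrite avgD (avg_cst S0).
have A0 : 0 < avg N' by exact: avg_gt0.
rewrite -N'E; apply: (@le_trans _ _ (avg N' `^ q)); last first.
  by rewrite ler_peMl ?powR_ge0//; move: (ltW C0); lra.
have : avg N' `^ (1 - q) * \int[mu]_t (H t `^ q) <= avg N'.
  rewrite -RintegralZl//; last exact: L1_avg_powR.
  apply: (@le_trans _ _ (\int[mu]_t (avg (fun s => N' s `^ (1 - q) * h s t `^ q)))).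
    apply: le_Rintegral => //.
    - by apply: L1Z; exact: L1_avg_powR.
    - by apply: (@L1_avg (fun s t => N' s `^ (1 - q) * h s t `^ q)) => s; exact: L1Z.
    - by move=> t _; exact: wjensen_ge1.
  rewrite (@Rint_avg (fun s t => N' s `^ (1 - q) * h s t `^ q)); last by move=> s; exact: L1Z.
  apply: le_avg => s; rewrite RintegralZl//; last exact: hq.
  rewrite -[Rintegral _ _ _]Nq.
  rewrite -[leRHS](powRr1 (ltW (N'0 s))) -{2}(subrK q 1) [in leRHS]gt0_powRD//.
  apply: ler_wpM2l; first exact: powR_ge0.
  by apply: ge0_ler_powR; rewrite ?nnegrE ?(ltW (N'0 s)) ?(ltW q0)// lerDl ltW.
move=> /(ler_wpM2l (powR_ge0 (avg N') (q - 1))).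
rewrite mulrA -gt0_powRD// (_ : q - 1 + (1 - q) = 0); last by ring.
by rewrite powRr0 mul1r mulrC -powRB1.
Qed.

End weighted_jensen.

(** * Rademacher averages as finite averages over signs *)

Section rademacher_average.
Context {R : realType} d (Omega : measurableType d) (P : probability Omega R).
Variable eps : nat -> {RV P >-> R}.
Hypothesis heps : rademacher eps.

Lemma rademacher_sign k (b : bool) :
  P (eps k @^-1` [set (-1) ^+ b]) = (2^-1)%:E.
Proof.
have [epm ep1 _] := heps; case: b => /=; last by rewrite expr0.
rewrite expr1; have -> : eps k @^-1` [set -1] = ~` (eps k @^-1` [set 1]).
  apply/seteqP; split=> w /=; first by move=> -> /eqP; rewrite -subr_eq0 => /eqP; lra.
  by have [] := epm k w.
rewrite probability_setC; last by rewrite -[X in measurable X]setTI; exact: measurable_funPT.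
by rewrite ep1 -EFinB; congr EFin; field.
Qed.

Definition sign_event n (s : {ffun 'I_n -> bool}) : set Omega :=
  [set w | forall k : 'I_n, eps k w = (-1) ^+ s k].

(** Independence is phrased with a set at every index, so the indices from [n] on receive the whole
    line. *)
Let B n (s : {ffun 'I_n -> bool}) (k : nat) : set R :=
  if insub k is Some i then [set (-1) ^+ s i] else setT.

Let ex_fset_iota n : exists J : {fset nat},
  (forall k, (k \in J) = (k < n)%N) /\ size J = n.
Proof.
exists (seq_fset tt (iota 0 n)); split=> [k|].
  by rewrite seq_fsetE mem_iota add0n.
by have := size_seq_fset tt (iota 0 n); rewrite undup_id ?iota_uniq// size_iota.
Qed.

Let sign_eventE n (s : {ffun 'I_n -> bool}) (J : {fset nat}) :
  (forall k, (k \in J) = (k < n)%N) ->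
  sign_event s = \bigcap_(k in [set` J]) (eps k @^-1` B s k).
Proof.
move=> JE; apply/seteqP; split=> w /= h.
  by move=> k /=; rewrite JE => kn; rewrite /B insubT/= (h (Ordinal kn)).
by move=> k; have := h k; rewrite /= JE ltn_ord /B valK; exact.
Qed.

Let mB n (s : {ffun 'I_n -> bool}) k : measurable (B s k).
Proof. by rewrite /B; case: insub => [i|]; [exact: measurable_set1|exact: measurableT]. Qed.

Lemma measurable_sign_event n (s : {ffun 'I_n -> bool}) :
  measurable (sign_event s).
Proof.
have [J [/(sign_eventE s) -> _]] := ex_fset_iota n.
apply: bigcap_measurableType => k _.
by rewrite -[X in measurable X]setTI; exact: measurable_funPT.
Qed.

Lemma probability_sign_event n (s : {ffun 'I_n -> bool}) :
  P (sign_event s) = ((2 ^+ n)^-1)%:E.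
Proof.
have [_ _ ind] := heps; have [J [JE Jn]] := ex_fset_iota n.
rewrite (sign_eventE s JE) ind; last exact: mB.
rewrite (eq_big_seq (fun=> (2^-1)%:E)); last first.
  by move=> k; rewrite JE => kn; rewrite /B insubT/= rademacher_sign.
rewrite prodEFin big_const_seq count_predT Jn.
by congr EFin; elim: n {s J JE Jn} => [|m ih]/=;
  rewrite ?expr0 ?invr1// exprS invfM ih.
Qed.

(** The [2^n] sign events partition the probability space into sets of equal mass, and the integrand
    is constant on each. *)
Lemma integral_rademacher n (F : ('I_n -> R) -> R) : (forall x, 0 <= F x) ->
  (\int[P]_w (F (fun k => eps k w))%:E =
   (avg (fun s : {ffun 'I_n -> bool} => F (fun k => (-1) ^+ s k)))%:E)%E.
Proof.
move=> F0; have [epm _ _] := heps.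
pose f s := F (fun k : 'I_n => (-1) ^+ (s : {ffun 'I_n -> bool}) k).
have FE w : (F (fun k => eps k w))%:E =
    (\sum_(s : {ffun 'I_n -> bool}) (f s * \1_(sign_event s) w)%:E)%E.
  pose s0 : {ffun 'I_n -> bool} := [ffun k => eps (val k) w == -1].
  have s0E (k : 'I_n) : eps k w = (-1) ^+ s0 k.
    rewrite ffunE; have [->|->] := epm k w; last by rewrite eqxx expr1.
    by rewrite (_ : _ == _ = false) ?expr0//; apply/eqP; lra.
  rewrite (bigD1 s0)//= big1 ?adde0 => [|s ss0].
    rewrite indicE mem_set// mulr1; congr EFin; congr F.
    by apply/funext => k; exact: s0E.
  rewrite indicE memNset ?mulr0// => h; move/eqP: ss0; apply.
  by apply/ffunP => k; apply: (@signr_inj R); rewrite -h s0E.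
under eq_integral do rewrite FE.
have f0 s : 0 <= f s by exact: F0.
rewrite ge0_integral_sum//; last 2 first.
- move=> s; apply/measurable_EFinP; apply: measurable_funM => //.
  by apply: measurable_indic; exact: measurable_sign_event.
- by move=> s w _; rewrite lee_fin mulr_ge0.
under eq_bigr => s _.
  under eq_integral do rewrite EFinM.
  rewrite ge0_integralZl_EFin//; last first.
    apply/measurable_EFinP.
    by apply: measurable_indic; exact: measurable_sign_event.
  rewrite integral_indic//; last exact: measurable_sign_event.
  rewrite setIT [X in (_ * X)%E](probability_sign_event s) -EFinM mulrC; over.
by rewrite sumEFin /avg -mulr_sumr card_signs natrX.
Qed.

Context (X : normedModType R[i]).

Definition rnorm (x : X) : R := complex.Re `|x|.

Lemma rnorm_ge0 x : 0 <= rnorm x.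
Proof. by have := normr_ge0 x; rewrite /rnorm lecE => /andP[]. Qed.

Lemma rad_normE n (x : 'I_n -> X) : rad_norm eps x =
  (avg (fun s : {ffun 'I_n -> bool} =>
    rnorm (\sum_k ((-1) ^+ s k)%:C *: x k) ^+ 2) `^ 2^-1)%:E.
Proof.
have := @integral_rademacher n (fun y => rnorm (\sum_k (y k)%:C *: x k) ^+ 2)
  (fun=> sqr_ge0 _).
rewrite /rad_norm Lnorm.unlock -poweR_EFin => <-; apply: (congr1 (fun z => z `^ 2^-1)%E).
apply: eq_integral => w _ /=; congr EFin.
by rewrite ger0_norm ?powR_mulrn//; exact: rnorm_ge0.
Qed.

Lemma R_bounded_avg (tau : set (X -> X)) : R_bounded eps tau ->
  exists2 C : R, 0 <= C & forall n (S : 'I_n -> X -> X) (x : 'I_n -> X),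
    (forall k, tau (S k)) ->
    avg (fun s : {ffun 'I_n -> bool} =>
      rnorm (\sum_k ((-1) ^+ s k)%:C *: S k (x k)) ^+ 2) <=
    C * avg (fun s : {ffun 'I_n -> bool} =>
      rnorm (\sum_k ((-1) ^+ s k)%:C *: x k) ^+ 2).
Proof.
move=> [_ [C C0 HC]]; exists (C ^+ 2); first exact: sqr_ge0.
move=> n S x tS; have := HC n S x tS; rewrite !rad_normE -EFinM lee_fin.
set A := avg _; set D := avg _.
have A0 : 0 <= A by apply: avg_ge0 => s; exact: sqr_ge0.
have D0 : 0 <= D by apply: avg_ge0 => s; exact: sqr_ge0.
rewrite !powR12_sqrt// => h.
rewrite -(sqr_sqrtr A0) -(sqr_sqrtr D0) -exprMn.
by rewrite ler_sqr ?nnegrE ?mulr_ge0 ?sqrtr_ge0.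
Qed.

End rademacher_average.

(** * Square functions *)

Section square_functions.
Context {R : realType} d (T : measurableType d) (mu : {measure set T -> \bar R}).

Definition sqmod (f : T -> R[i]) t : R := normc (f t) ^+ 2.

Lemma sqmod_ge0 f t : 0 <= sqmod f t. Proof. exact: sqr_ge0. Qed.

Lemma sqmodE f t :
  sqmod f t = complex.Re (f t) ^+ 2 + complex.Im (f t) ^+ 2.
Proof.
by rewrite /sqmod; case: (f t) => a b /=; rewrite sqr_sqrtr// addr_ge0 ?sqr_ge0.
Qed.

Lemma measurable_sqmod f : cmeasurable f -> measurable_fun setT (sqmod f).
Proof. by move=> mf; apply: measurable_funX; exact: measurable_normc. Qed.

Lemma normc_real (c : R) : normc c%:C = `|c|.
Proof. by rewrite /= expr0n/= addr0 sqrtr_sqr. Qed.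

Lemma sqmodZ (c : R[i]) f t : sqmod (fun t => c * f t) t = normc c ^+ 2 * sqmod f t.
Proof. by rewrite /sqmod normcM exprMn. Qed.

Context (p : R) (p1 : 1 <= p).
Let q := p / 2.
Let p0 : 0 < p. Proof. exact: lt_le_trans p1. Qed.
Let q0 : 0 < q. Proof. by rewrite divr_gt0. Qed.

Lemma sqmod_powR f t : sqmod f t `^ q = normc (f t) `^ p.
Proof.
rewrite /sqmod -powR_mulrn ?normc_ge0// -powRrM; congr (_ `^ _).
by rewrite /q; field.
Qed.

Lemma cLnormE f : cLnorm mu p f = ((\int[mu]_t (sqmod f t `^ q)%:E) `^ p^-1)%E.
Proof.
rewrite /cLnorm Lnorm.unlock; apply: (congr1 (fun z => z `^ p^-1)%E).
apply: eq_integral => t _ /=.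
by rewrite sqmod_powR ger0_norm ?normc_ge0.
Qed.

Lemma L1_sqmod f : memLp mu p f -> L1 mu (fun t => sqmod f t `^ q).
Proof.
move=> [mf]; rewrite cLnormE => foo; apply: L1_ge0P.
- exact/measurable_fun_powR/measurable_sqmod.
- by move=> t; exact: powR_ge0.
- rewrite ltNge leye_eq; apply/eqP => e; move: foo; rewrite e.
  by rewrite poweRyr ?ltxx// invr_eq0 gt_eqF.
Qed.

Lemma memLpP f : cmeasurable f -> L1 mu (fun t => sqmod f t `^ q) -> memLp mu p f.
Proof.
move=> mf Lf; split => //; rewrite cLnormE -EFin_Rintegral//.
by rewrite poweR_EFin ltry.
Qed.

Local Notation X := (cLp mu p1).

Lemma rnorm_sqr (x : X) : rnorm x ^+ 2 = (\int[mu]_t (sqmod x t `^ q)) `^ q^-1.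
Proof.
have Lx := L1_sqmod (memLp_cLp x).
rewrite /rnorm cLp_normE/= cLnormE -EFin_Rintegral// poweR_EFin/=.
rewrite -powR_mulrn ?powR_ge0// -powRrM; congr (_ `^ _).
by rewrite /q; field; rewrite gt_eqF.
Qed.

Lemma cLp_sumE (I : Type) (s : seq I) (c : I -> R[i]) (x : I -> X) :
  (\sum_(i <- s) c i *: x i : X) = (fun t => \sum_(i <- s) c i * x i t) %[ae mu].
Proof.
elim: s => [|i s ih].
  rewrite big_nil; move: (@cLp0E _ _ _ mu p p1); apply: filterS => t + _ => ->//.
  by rewrite big_nil.
rewrite big_cons.
move: (cLpDE (c i *: x i) (\sum_(i <- s) c i *: x i)) (cLpZE (c i) (x i)) ih.
apply: filterS3 => t h1 h2 h3 _.
by rewrite h1// h2// h3// big_cons.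
Qed.

Lemma eq_ae_sqmod (f g : T -> R[i]) (w : R -> R) :
  cmeasurable f -> cmeasurable g -> measurable_fun setT w ->
  (forall x, 0 <= w x) -> f = g %[ae mu] ->
  \int[mu]_t w (sqmod f t) = \int[mu]_t w (sqmod g t).
Proof.
move=> mf mg mw w0 fg; apply: (congr1 fine); apply: ge0_ae_eq_integral => //.
- by apply/measurable_EFinP; apply: measurableT_comp => //; exact: measurable_sqmod.
- by apply/measurable_EFinP; apply: measurableT_comp => //; exact: measurable_sqmod.
- by move=> t _; rewrite lee_fin.
- by move=> t _; rewrite lee_fin.
- by apply: filterS fg => t h _; rewrite /sqmod h.
Qed.

Lemma cmeasurable_sum (I : Type) (s : seq I) (c : I -> R[i]) (x : I -> X) :
  cmeasurable (fun t => \sum_(i <- s) c i * x i t).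
Proof.
elim: s => [|i s ih].
  by under eq_fun do rewrite big_nil; exact: cmeasurable_cst.
under eq_fun do rewrite big_cons; apply: cmeasurableD => //.
by apply: cmeasurableM; [exact: cmeasurable_cst|have [] := memLp_cLp (x i)].
Qed.

Lemma memLp_sum (I : Type) (s : seq I) (c : I -> R[i]) (x : I -> X) :
  memLp mu p (fun t => \sum_(i <- s) c i * x i t).
Proof.
elim: s => [|i s ih].
  by under eq_fun do rewrite big_nil; exact: memLp0.
under eq_fun do rewrite big_cons; apply: memLpD => //.
by apply: memLpZ => //; exact: memLp_cLp.
Qed.

Let h n (x : 'I_n -> X) (s : {ffun 'I_n -> bool}) t : R :=
  cmod2 (fun k => complex.Re (x k t)) (fun k => complex.Im (x k t)) s.

Let hE n (x : 'I_n -> X) s t :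
  h x s t = sqmod (fun t => \sum_k ((-1) ^+ s k)%:C * x k t) t.
Proof.
rewrite sqmodE /h /cmod2 /sgsum; congr (_ ^+ 2 + _ ^+ 2).
  rewrite raddf_sum; apply: eq_bigr => k _.
  by case: (x k t) => a b; case: (s k); rewrite /= ?expr0 ?expr1; ring.
rewrite raddf_sum; apply: eq_bigr => k _.
by case: (x k t) => a b; case: (s k); rewrite /= ?expr0 ?expr1; ring.
Qed.

Let mh n (x : 'I_n -> X) s : measurable_fun setT (h x s).
Proof.
rewrite (_ : h x s = sqmod (fun t => \sum_k ((-1) ^+ s k)%:C * x k t)).
  by apply: measurable_sqmod; exact: cmeasurable_sum.
by apply/funext => t; exact: hE.
Qed.

Let Lh n (x : 'I_n -> X) s : L1 mu (fun t => h x s t `^ q).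
Proof. by under eq_fun do rewrite hE; apply: L1_sqmod; exact: memLp_sum. Qed.

Let hN n (x : 'I_n -> X) s :
  (\int[mu]_t (h x s t `^ q)) `^ q^-1 =
  rnorm (\sum_k ((-1) ^+ s k)%:C *: x k) ^+ 2.
Proof.
rewrite rnorm_sqr; apply: (congr1 (fun z => z `^ q^-1)); under eq_Rintegral do rewrite hE.
apply: (@eq_ae_sqmod _ _ (fun z => z `^ q)) => //.
- exact: cmeasurable_sum.
- by have [] := memLp_cLp (\sum_k ((-1) ^+ s k)%:C *: x k).
- by move=> z; exact: powR_ge0.
- exact/ae_eq_sym/cLp_sumE.
Qed.

Let hH n (x : 'I_n -> X) t : avg ((h x)^~ t) = \sum_k sqmod (x k) t.
Proof. by rewrite [LHS]avg_cmod2; apply: eq_bigr => k _; rewrite sqmodE. Qed.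

(** Khintchine for vectors of L^p: [h x s] is the squared modulus of a signed sum, and its average
    over the signs is the square function. Thus [avg_norm_le] and [le_avg_norm] apply. *)
Lemma square_function_norm : exists2 C : R, 0 < C & forall n (x : 'I_n -> X),
  let N := avg (fun s : {ffun 'I_n -> bool} =>
    rnorm (\sum_k ((-1) ^+ s k)%:C *: x k) ^+ 2) in
  let J := \int[mu]_t ((\sum_k sqmod (x k) t) `^ q) in
  N `^ q <= C * J /\ forall dl, 0 < dl -> J <= C * (N + dl) `^ q.
Proof.
have [C C0 HC] := @khintchine R q q0.
exists (C + 2); first by rewrite addr_gt0.
move=> n x; have S0 := card_signs_gt0 n.
have kh t := HC n (fun k => complex.Re (x k t)) (fun k => complex.Im (x k t)).
have h0 s t : 0 <= h x s t by exact: cmod2_ge0.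
have kh' t : (1 <= q -> avg (fun s => h x s t `^ q) <= C * avg ((h x)^~ t) `^ q) /\
    (q <= 1 -> avg ((h x)^~ t) `^ q <= C * avg (fun s => h x s t `^ q)).
  rewrite hH; have := kh t.
  by under eq_bigr do rewrite -sqmodE.
have n1 := avg_norm_le S0 q0 C0 h0 (mh x) (Lh x) kh'.
have n2 := le_avg_norm S0 q0 C0 h0 (mh x) (Lh x) kh'.
have NE : avg (fun s => (\int[mu]_t (h x s t `^ q)) `^ q^-1) =
    avg (fun s : {ffun 'I_n -> bool} =>
      rnorm (\sum_k ((-1) ^+ s k)%:C *: x k) ^+ 2).
  by congr avg; apply/funext => s; exact: hN.
have JE : \int[mu]_t (avg ((h x)^~ t) `^ q) =
    \int[mu]_t ((\sum_k sqmod (x k) t) `^ q).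
  by apply: eq_Rintegral => t _; rewrite hH.
by rewrite NE JE in n1 n2; split.
Qed.

Lemma square_function_bound d0 (Omega0 : measurableType d0)
    (P : probability Omega0 R) (eps : nat -> {RV P >-> R})
    (heps : rademacher eps) (tau : set (X -> X)) :
  R_bounded eps tau -> exists2 K : R, 0 <= K &
  forall n (S : 'I_n -> X -> X) (x : 'I_n -> X), (forall k, tau (S k)) ->
    \int[mu]_t ((\sum_k sqmod (S k (x k)) t) `^ q) <=
    K * \int[mu]_t ((\sum_k sqmod (x k) t) `^ q).
Proof.
move=> /(R_bounded_avg heps)[C C0 HC].
have [D D0 HD] := square_function_norm.
exists (D * (C + 1) `^ q * D).
  by rewrite !mulr_ge0 ?powR_ge0// ltW.
move=> n S x tS; have := HC n S x tS.
have := HD n x; have := HD n (fun k => S k (x k)); rewrite /=.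
set A := avg _; set J1 := Rintegral _ _ _; set B := avg _; set J2 := Rintegral _ _ _.
move=> [_ JA] [BJ _] AB.
have A0 : 0 <= A by apply: avg_ge0 => s; exact: sqr_ge0.
have : 0 <= B by apply: avg_ge0 => s; exact: sqr_ge0.
rewrite le_eqVlt => /predU1P[B0|B0].
  (* If the signed sums of the [x k] vanish, so do those of their images, and then [J1 <= D * dl^q]
     for every positive [dl]. *)
  have {}A0 : A = 0 by apply/eqP; rewrite eq_le A0 (le_trans AB)// -B0 mulr0.
  apply: (@le_trans _ _ 0); last first.
    by rewrite mulr_ge0 ?Rintegral_ge0 ?mulr_ge0 ?powR_ge0 ?(ltW D0)// => t _; exact: powR_ge0.
  apply/ler_addgt0Pl => e e0; have De : 0 < e / D by rewrite divr_gt0.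
  rewrite addr0; have := JA ((e / D) `^ q^-1) (powR_gt0 _ De).
  rewrite A0 add0r -powRrM mulVf ?gt_eqF// powRr1 ?(ltW De)//.
  by rewrite mulrCA divff ?gt_eqF// mulr1.
(* Here [dl = B] is admissible, and [A + B <= (C + 1) * B]. *)
apply: (le_trans (JA B B0)); rewrite -!mulrA ler_pM2l//.
apply: (@le_trans _ _ ((C + 1) `^ q * B `^ q)).
  have C1 : 0 <= C + 1 by rewrite addr_ge0.
  rewrite -powRM ?(ltW B0)//; apply: (ge0_ler_powR (ltW q0)).
  - by rewrite nnegrE; exact: addr_ge0 A0 (ltW B0).
  - by rewrite nnegrE; exact: mulr_ge0 C1 (ltW B0).
  - by rewrite mulrDl mul1r lerD2r.
by rewrite ler_wpM2l ?powR_ge0.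
Qed.

(** The coefficients are moved into the vectors by linearity of the operators in [tau], which turns
    weighted sums into plain square functions. *)
Lemma square_function_wsum d0 (Omega0 : measurableType d0)
    (P : probability Omega0 R) (eps : nat -> {RV P >-> R})
    (heps : rademacher eps) (tau : set (X -> X)) :
  R_bounded eps tau -> exists2 K : R, 0 <= K &
  forall (I : Type) (S : I -> X -> X) (x : I -> X) (s : seq (R * I)),
    (forall i, tau (S i)) ->
    \int[mu]_t (wsum (fun i => sqmod (S i (x i))) s t `^ q) <=
    K * \int[mu]_t (wsum (fun i => sqmod (x i)) s t `^ q).
Proof.
move=> tauR; have [K K0 HK] := square_function_bound heps tauR.
have [tlin _] := tauR.
exists K => // I S x s tS.
pose c (k : 'I_(size s)) := tnth (in_tuple s) k.
have := HK _ (fun k => S (c k).2) (fun k => (c k).1%:C *: x (c k).2) (fun k => tS _).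
have E (y : I -> X) : \int[mu]_t (wsum (fun i => sqmod (y i)) s t `^ q) =
    \int[mu]_t ((\sum_k sqmod ((c k).1%:C *: y (c k).2 : X) t) `^ q).
  apply: (congr1 fine); apply: ge0_ae_eq_integral => //.
  - apply/measurable_EFinP/measurable_fun_powR.
    apply: measurable_sum => i; apply: measurable_funM; first exact: measurable_cst.
    by apply: measurable_sqmod; have [] := memLp_cLp (y i.2).
  - apply/measurable_EFinP/measurable_fun_powR.
    apply: measurable_sum => k; apply: measurable_sqmod.
    by have [] := memLp_cLp ((c k).1%:C *: y (c k).2).
  - by move=> t _; rewrite lee_fin powR_ge0.
  - by move=> t _; rewrite lee_fin powR_ge0.
  - have : \forall t \ae mu, forall k, ((c k).1%:C *: y (c k).2 : X) t =
        (c k).1%:C * y (c k).2 t.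
      apply: filter_forall => k.
      by apply: filterS (cLpZE (c k).1%:C (y (c k).2)) => t; exact.
    apply: filterS => t ht _; congr (_ `^ _)%:E.
    rewrite /wsum big_tnth; apply: eq_bigr => k _; rewrite -/(c k).
    by rewrite /sqmod ht normcM exprMn normc_real real_normK ?num_real.
rewrite -E; apply: le_trans; rewrite E; apply: eqW.
apply: eq_Rintegral => t _; congr (_ `^ _); apply: eq_bigr => k _.
have [linS _] := tlin _ (tS (c k).2).
have S00 : S (c k).2 0 = 0.
  have := linS 1 0 0; rewrite !scale1r addr0 => /eqP.
  by rewrite -subr_eq subrr => /eqP <-.
by have := linS (c k).1%:C (x (c k).2) 0; rewrite S00 !addr0 => ->.
Qed.

End square_functions.

(** * Densities *)

Section dominating_density.
Context {R : realType} d (T : measurableType d).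
Variable mu : {sigma_finite_measure set T -> \bar R}.

Lemma exists_dominating_density (f : nat -> T -> R) :
  (forall k, L1 mu (f k)) -> (forall k t, 0 <= f k t) -> mu setT != 0%E ->
  exists g : density mu, forall k, exists2 c : R, 0 < c &
    \forall t \ae mu, c * f k t <= g t.
Proof.
move=> Lf f0 muT0; have [F FT mF] := sigma_finiteT mu.
(* The indicators of the exhaustion make the sum positive everywhere. *)
pose h k t := \1_(F k) t + f k t.
have Lh k : L1 mu (h k).
  apply: L1D => //; apply: L1_ge0P => //.
  - by apply: measurable_indic; have [] := mF k.
  - by rewrite integral_indic// ?setIT; have [] := mF k.
have h0 k t : 0 <= h k t by rewrite addr_ge0.
have I0 k : 0 <= \int[mu]_t h k t by exact: Rintegral_ge0.
(* Normalised so that the integrals of the [c k * h k] sum to at most 1. *)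
pose c k : R := (1 + \int[mu]_t h k t)^-1 / (2 ^ k.+1)%:R.
have c0 k : 0 < c k.
  by rewrite divr_gt0// ?ltr0n ?expn_gt0// invr_gt0 ltr_pwDl.
pose G t := (\sum_(k <oo) (c k * h k t)%:E)%E.
have ch0 k t : (0 <= (c k * h k t)%:E)%E by rewrite lee_fin mulr_ge0// ltW.
have mch k : measurable_fun setT (fun t => (c k * h k t)%:E).
  by apply/measurable_EFinP/measurable_funM => //; exact: L1_measurable (Lh k).
have mG : measurable_fun setT G.
  by apply: ge0_emeasurable_sum => // k t _ _; exact: ch0.
have G0 t : (0 <= G t)%E by apply: nneseries_ge0 => k _ _; exact: ch0.
have leG k t : ((c k * h k t)%:E <= G t)%E.
  apply: le_trans (nneseries_lim_ge k.+1 _); last by move=> ? _ _; exact: ch0.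
  by rewrite big_nat_recr//= leeDr//; apply: sume_ge0 => i _; exact: ch0.
have Gpos t : (0 < G t)%E.
  have : setT t by []; rewrite FT => -[k _ Fk].
  apply: lt_le_trans (leG k t); rewrite lte_fin mulr_gt0//.
  by rewrite /h indicE mem_set// ltr_pwDl.
have iG : (\int[mu]_t G t <= 1)%E.
  rewrite integral_nneseries//; apply: le_trans (@epsilon_trick0 R 1 xpredT ler01).
  apply: lee_nneseries => [k _ _|k _]; first exact: integral_ge0.
  rewrite -EFin_Rintegral; last exact: L1Z.
  rewrite RintegralZl//; last exact: Lh.
  rewrite lee_fin /c mulrAC ler_wpM2r ?invr_ge0//.
  by rewrite ler_pdivrMl ?ltr_pwDl// mulr1 lerDr.
have iG' : mu.-integrable setT G.
  apply/integrableP; split => //.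
  by under eq_integral => t _ do rewrite (gee0_abs (G0 t));
     rewrite (le_lt_trans iG)// ltry.
have Gfin := integrable_ae measurableT iG'.
(* The series may be infinite on a null set; the value 1 there keeps the function finite and
   positive everywhere. *)
pose g1 t : R := if G t \is a fin_num then fine (G t) else 1.
have g10 t : 0 < g1 t.
  rewrite /g1; case: ifPn => // Goo; rewrite fine_gt0// Gpos/= ltey.
  by move: Goo; rewrite fin_numE => /andP[].
have mg1 : measurable_fun setT g1.
  apply: measurable_fun_ifT => //.
  - by apply: (measurable_fun_bool true); exact/emeasurable_fin_num.
  - by apply: (measurableT_comp (fine_measurable measurableT)).
have g1G : \forall t \ae mu, (g1 t)%:E = G t.
  apply: filterS Gfin => t /(_ I) Gt; by rewrite /g1 Gt fineK.
have Lg1 : L1 mu g1.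
  apply: L1_ge0P => //; first by move=> t; exact: ltW.
  apply: le_lt_trans (ltry 1); apply: le_trans iG.
  apply: ae_ge0_le_integral => //.
  - by move=> t _; rewrite lee_fin ltW.
  - exact/measurable_EFinP.
  - by apply: filterS g1G => t -> _.
pose Z := \int[mu]_t g1 t.
have Z0 : 0 < Z.
  rewrite lt_neqAle Rintegral_ge0 ?andbT => [|t _]; last exact: ltW.
  apply/negP => /eqP/esym ZE; move/eqP: muT0; apply.
  have : (\int[mu]_t `|(g1 t)%:E| = 0)%E.
    under eq_integral => t _ do rewrite gee0_abs ?lee_fin ?(ltW (g10 t))//.
    by rewrite -EFin_Rintegral// -/Z ZE.
  move=> /(ae_eq_integral_abs mu measurableT (proj2 (measurable_EFinP _ _) mg1)) ae0.
  apply: measure_negligible => //; apply: negligibleS ae0 => t _ /= /(_ I)[].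
  by move=> /eqP; rewrite gt_eqF.
pose g0 t := Z^-1 * g1 t.
have g00 t : 0 < g0 t by rewrite mulr_gt0 ?invr_gt0.
have mg0 : measurable_fun setT g0 by exact: measurable_funM.
have ng0 : ('N[mu]_1[EFin \o g0] = 1)%E.
  rewrite Lnorm1; under eq_integral => t _ do rewrite /= ger0_norm ?(ltW (g00 t))//.
  rewrite -EFin_Rintegral; last exact: L1Z.
  by rewrite RintegralZl// -/Z mulVf// gt_eqF.
exists (Density mg0 g00 ng0) => k; exists (c k / Z); first by rewrite divr_gt0.
apply: filterS g1G => t e /=; rewrite /g0 mulrAC mulrC ler_pM2l ?invr_gt0//.
rewrite -lee_fin e; apply: le_trans (leG k t); rewrite lee_fin.
by rewrite ler_pM2l// lerDr.
Qed.

End dominating_density.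

(** * Square integrability against a weight *)

Section weighted_L2.
Context {R : realType} d (T : measurableType d) (mu : {measure set T -> \bar R}).
Variable w : T -> R.
Hypothesis mw : measurable_fun setT w.
Hypothesis w0 : forall t, 0 <= w t.
Implicit Types f g : T -> R[i].

Definition L2w f := L1 mu (fun t => sqmod f t * w t).

Lemma sqmodD_le f g t :
  sqmod (fun t => f t + g t) t <= 2 * (sqmod f t + sqmod g t).
Proof.
rewrite /sqmod; set a := normc (f t); set b := normc (g t).
apply: (@le_trans _ _ ((a + b) ^+ 2)).
  by rewrite ler_sqr ?nnegrE ?addr_ge0 ?normc_ge0//; exact: normcD.
by have := sqr_ge0 (a - b); lra.
Qed.

Lemma measurable_sqmodw f : cmeasurable f ->
  measurable_fun setT (fun t => sqmod f t * w t).
Proof. by move=> mf; apply: measurable_funM => //; exact: measurable_sqmod. Qed.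

Lemma sqmodw_ge0 f t : 0 <= sqmod f t * w t.
Proof. by rewrite mulr_ge0// sqmod_ge0. Qed.

Lemma L2wD f g : cmeasurable f -> cmeasurable g -> L2w f -> L2w g ->
  L2w (fun t => f t + g t).
Proof.
move=> mf mg Lf Lg; apply: L1_le (L1Z 2 (L1D Lf Lg)).
  by apply: measurable_sqmodw; exact: cmeasurableD.
move=> t; rewrite ger0_norm ?sqmodw_ge0// -mulrDl mulrA.
by rewrite ler_wpM2r// sqmodD_le.
Qed.

Lemma L2wZ (c : R[i]) f : L2w f -> L2w (fun t => c * f t).
Proof.
move=> Lf; rewrite /L2w; under eq_fun do rewrite sqmodZ -mulrA.
exact: L1Z.
Qed.

Lemma L2w_ae f g : cmeasurable f -> cmeasurable g -> f = g %[ae mu] ->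
  L2w f -> L2w g.
Proof.
move=> mf mg fg Lf; apply: L1_ge0P; first exact: measurable_sqmodw.
  by move=> t; exact: sqmodw_ge0.
have <- : (\int[mu]_t (sqmod f t * w t)%:E = \int[mu]_t (sqmod g t * w t)%:E)%E.
  apply: ge0_ae_eq_integral => //.
  - exact/measurable_EFinP/measurable_sqmodw.
  - exact/measurable_EFinP/measurable_sqmodw.
  - by move=> t _; rewrite lee_fin sqmodw_ge0.
  - by move=> t _; rewrite lee_fin sqmodw_ge0.
  - by apply: filterS fg => t h _; rewrite /sqmod h.
exact: integrable_lty.
Qed.

Context (p : R) (p1 : 1 <= p).
Local Notation X := (cLp mu p1).

Lemma cmeasurable_cLp (x : X) : cmeasurable x.
Proof. by have [] := memLp_cLp x. Qed.

Lemma L2w_lin (c : R[i]) (x y : X) : L2w x -> L2w y -> L2w (c *: x + y : X).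
Proof.
move=> Lx Ly; apply: (@L2w_ae (fun t => c * x t + y t)).
- apply: cmeasurableD; last exact: cmeasurable_cLp.
  by apply: cmeasurableM; [exact: cmeasurable_cst|exact: cmeasurable_cLp].
- exact: cmeasurable_cLp.
- apply: ae_eq_sym; move: (cLpDE (c *: x) y) (cLpZE c x).
  by apply: filterS2 => t h1 h2 _; rewrite h1// h2.
- apply: L2wD; [|exact: cmeasurable_cLp|exact: L2wZ|exact: Ly].
  by apply: cmeasurableM; [exact: cmeasurable_cst|exact: cmeasurable_cLp].
Qed.

Lemma L2w0 : L2w (0 : X).
Proof.
apply: (@L2w_ae (fun=> 0)); [exact: cmeasurable_cst|exact: cmeasurable_cLp| |].
  exact/ae_eq_sym/cLp0E.
rewrite /L2w /sqmod normc0; under eq_fun do rewrite expr0n mul0r.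
exact: integrable0.
Qed.

Lemma L2w_sum (I : Type) (s : seq I) (c : I -> R[i]) (x : I -> X) :
  (forall i, L2w (x i)) -> L2w (\sum_(i <- s) c i *: x i : X).
Proof.
move=> Lx; elim: s => [|i s ih]; first by rewrite big_nil; exact: L2w0.
by rewrite big_cons; exact: L2w_lin.
Qed.

End weighted_L2.

Section dmeasure_integrals.
Context {R : realType} d (T : measurableType d) (mu : {measure set T -> \bar R}).
Variable g : density mu.

Lemma L1_dmeasure (f : T -> R) : measurable_fun setT f -> (forall t, 0 <= f t) ->
  L1 (dmeasure g) f <-> L1 mu (fun t => f t * g t).
Proof.
move=> mf f0; have mg := density_measurable g; have g0 := density_gt0 g.
have E : (\int[dmeasure g]_t (f t)%:E = \int[mu]_t (f t * g t)%:E)%E.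
  rewrite ge0_integral_dmeasure//; first exact/measurable_EFinP.
split=> h.
- apply: L1_ge0P; first exact: measurable_funM.
    by move=> t; rewrite mulr_ge0// ltW.
  by rewrite -E; exact: integrable_lty.
- by apply: L1_ge0P => //; rewrite E; exact: integrable_lty.
Qed.

Lemma Rint_dmeasure (f : T -> R) : measurable_fun setT f -> (forall t, 0 <= f t) ->
  \int[dmeasure g]_t f t = \int[mu]_t (f t * g t).
Proof.
move=> mf f0; apply: (congr1 fine).
rewrite ge0_integral_dmeasure//; first exact/measurable_EFinP.
Qed.

End dmeasure_integrals.

(** * Change of density *)

Section density_weight.
Context {R : realType} d (T : measurableType d) (mu : {measure set T -> \bar R}).
Context (p : R) (p1 : 1 <= p).
Let q := p / 2.
Let p0 : 0 < p. Proof. exact: lt_le_trans p1. Qed.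
Let q0 : 0 < q. Proof. by rewrite divr_gt0. Qed.
Local Notation X := (cLp mu p1).

Lemma L1_ae_le (f g : T -> R) : measurable_fun setT f -> (forall t, 0 <= f t) ->
  (\forall t \ae mu, f t <= g t) -> L1 mu g -> L1 mu f.
Proof.
move=> mf f0 fg Lg; apply: L1_ge0P => //.
apply: le_lt_trans (integrable_lty measurableT (L1_norm Lg)).
apply: ae_ge0_le_integral => //.
- by move=> t _; rewrite lee_fin.
- exact/measurable_EFinP.
- by move=> t _; rewrite lee_fin.
- exact/measurable_EFinP/L1_measurable/(L1_norm Lg).
- by apply: filterS fg => t h _; rewrite lee_fin (le_trans h)// ler_norm.
Qed.

(* [|x|^2 g^(1-2/p)] is the density of [|phi_{p,g} x|^2 g]. *)
Definition dweight (g : T -> R) t : R := g t `^ (1 - q^-1).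

Lemma dweight_ge0 g t : 0 <= dweight g t. Proof. exact: powR_ge0. Qed.

Lemma measurable_dweight (g : density mu) : measurable_fun setT (dweight g).
Proof. exact/measurable_fun_powR/density_measurable. Qed.

Lemma L1_density (g : density mu) : L1 mu g.
Proof.
apply: L1_ge0P; first exact: density_measurable.
  by move=> t; exact/ltW/density_gt0.
have := density_norm1 g; rewrite Lnorm1 => e.
apply: (@le_lt_trans _ _ 1%E); last exact: ltry.
rewrite -e [leRHS](eq_integral (fun t => (g t)%:E))// => t _.
by rewrite gee0_abs// lee_fin ltW// density_gt0.
Qed.

(** At stake is the integrability of [|x|^2 g^(1-1/q)]. For q >= 1 both factors are bounded by
    powers of [m = |x|^p + g] whose exponents add up to 1. For q < 1 the exponent of [g] is
    negative, and the lower bound for [g] leaves a multiple of [|x|^p]. *)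
Lemma L2w_dominated (g : density mu) (c : R) (x : X) : 0 < c ->
  (\forall t \ae mu, c * sqmod x t `^ q <= g t) -> L2w mu (dweight g) x.
Proof.
move=> c0 cg; have Lx := L1_sqmod p1 (memLp_cLp x).
apply: (@L1_ae_le _ (fun t => (c `^ (1 - q^-1) + 1) * sqmod x t `^ q + g t)).
- apply: measurable_sqmodw; [exact: measurable_dweight|exact: cmeasurable_cLp].
- by move=> t; apply: sqmodw_ge0 => t'; exact: dweight_ge0.
- apply: filterS cg => t cgt; have := sqmod_ge0 x t; rewrite /dweight.
  have g0 := density_gt0 g t; move: (sqmod x t) (g t) cgt g0 => s y sy y0.
  have c10 : 0 <= c `^ (1 - q^-1) + 1 by rewrite addr_ge0 ?powR_ge0.
  rewrite le_eqVlt => /predU1P[<-|s0].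
    by rewrite mul0r addr_ge0 ?mulr_ge0 ?powR_ge0// ltW.
  have [q1|q1] := leP 1 q.
    have q1' : 0 <= 1 - q^-1 by rewrite subr_ge0 invf_le1.
    pose m := s `^ q + y; have m0 : 0 < m by rewrite ltr_wpDl ?powR_ge0.
    apply: (@le_trans _ _ (m `^ q^-1 * m `^ (1 - q^-1))).
      apply: ler_pM; rewrite ?powR_ge0 ?(ltW s0)//.
        rewrite -{1}(powRr1 (ltW s0)) -(divff (lt0r_neq0 q0)) powRrM.
        apply: ge0_ler_powR; rewrite ?nnegrE ?powR_ge0 ?invr_ge0 ?(ltW q0) ?(ltW m0)//.
        by rewrite lerDl ltW.
      apply: ge0_ler_powR; rewrite ?nnegrE ?(ltW y0) ?(ltW m0)//.
      by rewrite lerDr powR_ge0.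
    rewrite -gt0_powRD// subrKC powRr1 ?(ltW m0)// /m lerD2r.
    by rewrite ler_peMl ?powR_ge0// lerDr powR_ge0.
  have cs0 : 0 < c * s `^ q by rewrite mulr_gt0 ?powR_gt0.
  apply: (@le_trans _ _ (c `^ (1 - q^-1) * s `^ q)); last first.
    by rewrite mulrDl mul1r -addrA lerDl addr_ge0 ?powR_ge0// ltW.
  apply: (@le_trans _ _ (s * (c * s `^ q) `^ (1 - q^-1))).
    rewrite ler_pM2l// -opprB !powRN lef_pV2 ?posrE ?powR_gt0//.
    apply: ge0_ler_powR; rewrite ?nnegrE ?(ltW cs0) ?(ltW y0)// subr_ge0.
    by rewrite invf_ge1// ltW.
  rewrite powRM ?powR_ge0 ?(ltW c0)// -powRrM mulrCA ler_pM2l ?powR_gt0//.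
  rewrite -{1}(powRr1 (ltW s0)) -gt0_powRD//; apply: eqW; congr (_ `^ _).
  by field; rewrite gt_eqF.
- by apply: L1D; [exact: L1Z|exact: L1_density].
Qed.

Section change_of_density.
Variables (g0 : density mu) (r : T -> R).
Hypotheses (mr : measurable_fun setT r) (r1 : forall t, 1 <= r t).
Hypothesis Lr : L1 (dmeasure g0) (fun t => r t `^ q).

Let rq0 t : 0 <= r t `^ q. Proof. exact: powR_ge0. Qed.
Let r0 t : 0 < r t. Proof. exact: lt_le_trans (r1 t). Qed.

Definition newmass := \int[dmeasure g0]_t (r t `^ q).

Lemma newmass_ge1 : 1 <= newmass.
Proof.
have : \int[dmeasure g0]_t (1 : R) <= newmass.
  apply: le_Rintegral => //; first exact: L1_cst.
  by move=> t _; rewrite powR_ge1// ltW.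
have nu1 : fine (dmeasure g0 setT) = 1 by rewrite (probability_setT (dmeasure g0)).
by rewrite Rintegral_cst// nu1 mul1r.
Qed.

Let Z0 : 0 < newmass. Proof. exact: lt_le_trans newmass_ge1. Qed.

(** The power is [r^q] because [(r^q)^(1-1/q) = r^(q-1)]: up to a constant, the weight of the new
    density is the gradient [r^(q-1)] times the weight of [g0]. *)
Definition newdens t : R := newmass^-1 * (r t `^ q * g0 t).

Lemma newdens_gt0 t : 0 < newdens t.
Proof. by rewrite !mulr_gt0 ?invr_gt0 ?powR_gt0//; exact: density_gt0. Qed.

Lemma measurable_newdens : measurable_fun setT newdens.
Proof.
apply: measurable_funM; first exact: measurable_cst.
apply: measurable_funM; [exact: measurable_fun_powR|exact: density_measurable].
Qed.

Lemma newdens_norm1 : ('N[mu]_1[EFin \o newdens] = 1)%E.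
Proof.
have mrq : measurable_fun setT (fun t => r t `^ q) by exact: measurable_fun_powR.
have Lm := (L1_dmeasure g0 mrq rq0).1 Lr.
rewrite Lnorm1 (eq_integral (fun t => (newdens t)%:E)); last first.
  by move=> t _; rewrite gee0_abs// lee_fin ltW// newdens_gt0.
rewrite -EFin_Rintegral; last exact: L1Z.
by rewrite RintegralZl// -Rint_dmeasure// -/newmass mulVf// gt_eqF.
Qed.

Definition newdensity := Density measurable_newdens newdens_gt0 newdens_norm1.

Lemma dweight_newdensity t : dweight newdensity t =
  newmass `^ (q^-1 - 1) * (r t `^ (q - 1) * dweight g0 t).
Proof.
rewrite /dweight /= /newdens.
have g00 := density_gt0 g0 t.
rewrite powRM ?invr_ge0 ?mulr_ge0 ?powR_ge0 ?(ltW Z0) ?(ltW g00)//.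
rewrite (powRM _ (rq0 t) (ltW g00)) -powRrM.
congr (_ * (_ `^ _ * _)); last by field; rewrite gt_eqF.
rewrite -(powR_inv1 (ltW Z0)) -powRrM; congr (_ `^ _); ring.
Qed.

Lemma dmeasure_sqmod (f : T -> R[i]) t :
  sqmod f t * dweight g0 t = (sqmod f t * g0 t `^ (- q^-1)) * g0 t.
Proof.
have g00 := density_gt0 g0 t.
rewrite -mulrA /dweight (powRB1 _ g00) [in LHS](mulrC (g0 t)).
by congr (_ * (_ `^ _ * _)); ring.
Qed.

Lemma newdensity_sqmod (f : T -> R[i]) t :
  sqmod f t * dweight newdensity t = newmass `^ (q^-1 - 1) *
  ((sqmod f t * g0 t `^ (- q^-1)) * r t `^ (q - 1) * g0 t).
Proof.
rewrite dweight_newdensity (_ : dweight g0 t = g0 t `^ (- q^-1) * g0 t); first ring.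
have := dmeasure_sqmod (fun=> 1) t; rewrite /sqmod normc1 expr1n !mul1r.
by move=> ->.
Qed.

End change_of_density.

(** A normalisation by a power of [g0] moves the square function estimate to the probability space
    [g0 dmu]. There [exists_weight] is applied to the family of all admissible pairs [(S, x)] at
    once, so that one density serves every operator and every vector. *)
Lemma exists_weighted_bound d0 (Omega0 : measurableType d0)
    (P : probability Omega0 R) (eps : nat -> {RV P >-> R})
    (heps : rademacher eps) (tau : set (X -> X)) (g0 : density mu) :
  R_bounded eps tau ->
  (forall (S : X -> X) (x : X), tau S -> L2w mu (dweight g0) (S x)) ->
  exists (g : density mu) (l : R), 0 <= l /\
    forall (S : X -> X) (x : X), tau S -> L2w mu (dweight g0) x ->
    [/\ L2w mu (dweight g) x, L2w mu (dweight g) (S x) &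
      \int[mu]_t (sqmod (S x) t * dweight g t) <=
      l * \int[mu]_t (sqmod x t * dweight g t)].
Proof.
move=> tauR tauL.
have [K K0 HK] := square_function_wsum heps tauR.
pose I := {i : (X -> X) * X | tau i.1 /\ L2w mu (dweight g0) i.2}.
pose S (i : I) := (sval i).1; pose x (i : I) := (sval i).2.
pose nu : probability T R := dmeasure g0.
have mg0 := density_measurable g0; have g00 := density_gt0 g0.
(* [|y|^2 * u] has in [L^q(g0 dmu)] the norm of [|y|^2] in [L^q(mu)]. *)
pose u t := g0 t `^ (- q^-1).
have u0 t : 0 <= u t by exact: powR_ge0.
have mu_ : measurable_fun setT u by exact: measurable_fun_powR.
have mX (y : X) : measurable_fun setT (sqmod y).
  exact/measurable_sqmod/cmeasurable_cLp.
have uq t : u t `^ q * g0 t = 1.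
  rewrite /u -powRrM mulNr mulVf ?gt_eqF// powR_inv1 ?mulVf ?gt_eqF//.
  exact: ltW.
pose b (y : X) t := sqmod y t * u t.
have Lb (y : X) : L2w mu (dweight g0) y -> L1q nu q (b y).
  move=> Ly; split.
  - by move=> t; rewrite mulr_ge0// sqmod_ge0.
  - apply/L1_dmeasure; first exact: measurable_funM.
      by move=> t; rewrite mulr_ge0// sqmod_ge0.
    by under eq_fun do rewrite -dmeasure_sqmod.
  - apply/L1_dmeasure; first by apply: measurable_fun_powR; exact: measurable_funM.
      by move=> t; exact: powR_ge0.
    under eq_fun do rewrite /b powRM ?sqmod_ge0// -mulrA uq mulr1.
    exact: L1_sqmod (memLp_cLp y).
have [] := @exists_weight R _ T nu q q0 K I (fun i => b (S i (x i)))
  (fun i => b (x i)) K0.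
- by move=> i; apply: Lb; apply: tauL; case: (svalP i).
- by move=> i; apply: Lb; case: (svalP i).
- move=> s.
  have wE (y : I -> X) : \int[nu]_t (wsum (fun i => b (y i)) s t `^ q) =
      \int[mu]_t (wsum (fun i => sqmod (y i)) s t `^ q).
    have mw : measurable_fun setT (wsum (fun i => b (y i)) s).
      apply: measurable_sum => c; apply: measurable_funM; first exact: measurable_cst.
      exact: measurable_funM.
    rewrite Rint_dmeasure; [|exact: measurable_fun_powR|by move=> t; exact: powR_ge0].
    apply: eq_Rintegral => t _.
    have -> : wsum (fun i => b (y i)) s t = wsum (fun i => sqmod (y i)) s t * u t.
      by rewrite /wsum mulr_suml; apply: eq_bigr => c _; rewrite /b mulrA.
    rewrite powRM// ?sumr_ge0// => [|c _]; last by rewrite mulr_ge0 ?sqr_ge0.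
    by rewrite -mulrA uq mulr1.
  rewrite !wE; apply: HK => i; by case: (svalP i).
move=> l [r [l0 mr r1 Lr Hi]].
exists (newdensity mr r1 Lr), l; split => // S' x' tS Lx.
pose i : I := exist _ (S', x') (conj tS Lx).
have [La Lb' le_ab] := Hi i.
pose cZ := newmass g0 r `^ (q^-1 - 1).
have cZ0 : 0 <= cZ by exact: powR_ge0.
have mbr (y : X) : measurable_fun setT (fun t => b y t * r t `^ (q - 1)).
  by apply: measurable_funM; [exact: measurable_funM|exact: measurable_fun_powR].
have br0 (y : X) t : 0 <= b y t * r t `^ (q - 1).
  apply: mulr_ge0; last exact: powR_ge0.
  by apply: mulr_ge0 => //; exact: sqmod_ge0.
have LW (y : X) : L1 nu (fun t => b y t * r t `^ (q - 1)) ->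
    L2w mu (dweight (newdensity mr r1 Lr)) y.
  move=> Ly; rewrite /L2w; under eq_fun do rewrite newdensity_sqmod.
  by apply: L1Z; exact: (L1_dmeasure g0 (mbr y) (br0 y)).1 Ly.
have IW (y : X) : L1 nu (fun t => b y t * r t `^ (q - 1)) ->
    \int[mu]_t (sqmod y t * dweight (newdensity mr r1 Lr) t) =
    cZ * \int[nu]_t (b y t * r t `^ (q - 1)).
  move=> Ly; under eq_Rintegral do rewrite newdensity_sqmod.
  rewrite RintegralZl//; last exact: (L1_dmeasure g0 (mbr y) (br0 y)).1 Ly.
  by congr (_ * _); rewrite Rint_dmeasure.
split; [exact: LW|exact: LW|].
rewrite !IW// mulrCA; exact: ler_wpM2l.
Qed.

End density_weight.

(** * Bases *)

Section real_norm.
Context {R : realType} {X : normedModType R[i]}.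
Implicit Types (x y : X) (c : R[i]).

Lemma rnormE x : `|x| = (rnorm x)%:C.
Proof.
have := normr_ge0 x; rewrite /rnorm; case: `|x| => a b.
by rewrite lecE/= => /andP[/eqP -> _].
Qed.

Lemma rnormD x y : rnorm (x + y) <= rnorm x + rnorm y.
Proof. by rewrite -lecR rmorphD/= -!rnormE ler_normD. Qed.

Lemma rnorm_ltD z x y (r : R) : rnorm (x - z) < r / 2 -> rnorm (z - y) < r / 2 ->
  rnorm (x - y) < r.
Proof.
move=> h1 h2; rewrite -(subrKA z); apply: le_lt_trans (rnormD _ _) _.
by rewrite [r]splitr ltrD.
Qed.

Lemma rnormZ c x : rnorm (c *: x) = normc c * rnorm x.
Proof. by apply: (@complexI R); rewrite rmorphM/= -!rnormE normrZ Defs.normcE. Qed.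

Lemma rnormN x : rnorm (- x) = rnorm x.
Proof. by rewrite /rnorm normrN. Qed.

Lemma rnormB x y : rnorm (x - y) = rnorm (y - x).
Proof. by rewrite /rnorm distrC. Qed.

Lemma rnorm0 : rnorm (0 : X) = 0.
Proof. by rewrite /rnorm normr0. Qed.

Lemma rnorm_eq0 x : rnorm x = 0 -> x = 0.
Proof. by move=> x0; apply/normr0_eq0; rewrite rnormE x0. Qed.

Lemma rnorm_gt0 x : x != 0 -> 0 < rnorm x.
Proof.
move=> x0; rewrite lt_neqAle rnorm_ge0 andbT eq_sym.
by apply: contra_neq x0; exact: rnorm_eq0.
Qed.

Lemma cvg_rnormP (u : nat -> X) x : u @ \oo --> x <->
  forall e : R, 0 < e -> \forall n \near \oo, rnorm (x - u n) < e.
Proof.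
split=> [/cvgrPdist_lt h e e0|h].
  have := h e%:C; rewrite ltcR => /(_ e0); apply: filterS => n.
  by rewrite rnormE ltcR.
apply/cvgrPdist_lt => e e0.
have eE : e = (complex.Re e)%:C.
  by case: e e0 => a b; rewrite ltcE/= => /andP[/eqP -> _].
rewrite eE; have {}e0 : 0 < complex.Re e by move: e0; rewrite eE ltcR.
by apply: filterS (h _ e0) => n; rewrite rnormE ltcR.
Qed.

Lemma rnorm_sum (I : Type) (s : seq I) (F : I -> X) :
  rnorm (\sum_(i <- s) F i) <= \sum_(i <- s) rnorm (F i).
Proof.
elim: s => [|i s ih]; first by rewrite !big_nil rnorm0.
by rewrite !big_cons (le_trans (rnormD _ _))// lerD2l.
Qed.

End real_norm.

Section normc_lemmas.
Context {R : realType}.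
Implicit Types z : R[i].

Lemma le_Re_normc z : `|complex.Re z| <= normc z.
Proof.
case: z => a b /=; rewrite -[leLHS]ger0_norm// -sqrtr_sqr ler_wsqrtr//.
by rewrite real_normK ?num_real// lerDl sqr_ge0.
Qed.

Lemma le_Im_normc z : `|complex.Im z| <= normc z.
Proof.
case: z => a b /=; rewrite -[leLHS]ger0_norm// -sqrtr_sqr ler_wsqrtr//.
by rewrite real_normK ?num_real// lerDr sqr_ge0.
Qed.

Lemma normc_le_ReIm z : normc z <= `|complex.Re z| + `|complex.Im z|.
Proof.
case: z => a b /=; rewrite -[leRHS]ger0_norm ?addr_ge0// -sqrtr_sqr ler_wsqrtr//.
rewrite sqrrD !real_normK ?num_real// -addrA lerD2l lerDr.
by rewrite mulrn_wge0// mulr_ge0.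
Qed.

Lemma complex_geometric_cvg (k : nat -> R[i]) (s : R) : 0 <= s ->
  (forall n, normc (k n - k n.+1) <= s * 2^-1 ^+ n) ->
  exists l : R[i], forall e : R, 0 < e ->
    \forall n \near \oo, normc (l - k n) < e.
Proof.
move=> s0 ks.
have cr : cvgn (fun n => complex.Re (k n)).
  apply: (geometric_increments_cvg s0) => n; apply: le_trans (ks n).
  by apply: le_trans (le_Re_normc _); rewrite raddfB.
have ci : cvgn (fun n => complex.Im (k n)).
  apply: (geometric_increments_cvg s0) => n; apply: le_trans (ks n).
  by apply: le_trans (le_Im_normc _); rewrite raddfB.
exists (Complex (limn (fun n => complex.Re (k n))) (limn (fun n => complex.Im (k n)))).
move=> e e0; have e2 : 0 < e / 2 by rewrite divr_gt0.
move/cvgrPdist_lt : cr => /(_ _ e2); move/cvgrPdist_lt : ci => /(_ _ e2).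
apply: filterS2 => n hi hr; apply: le_lt_trans (normc_le_ReIm _) _.
by rewrite !raddfB/= [ltRHS](splitr e) addrC ltrD.
Qed.

End normc_lemmas.

Section basis_facts.
Context {R : realType} (X : normedModType R[i]) (e : nat -> X).
Hypothesis be : schauder_basis e.
Implicit Types (x : X) (a : nat -> R[i]).

Lemma basis_coef_eq a x :
  series (fun k => a k *: e k) @ \oo --> x -> basis_coef e x = a.
Proof.
move=> ax; have [b [bx ub]] := be x.
rewrite -(ub _ ax); apply/esym/ub; rewrite /basis_coef.
by apply: (@xgetPex _ (fun=> 0) [set a | series (fun k => a k *: e k) @ \oo --> x]);
  exists a.
Qed.

Lemma basis_proj_cvg x : basis_proj e N x @[N --> \oo] --> x.
Proof.
have [b [bx _]] := be x; have bE := basis_coef_eq bx.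
rewrite (_ : (fun N => _) = series (fun k => b k *: e k))//.
by apply/funext => N; rewrite /basis_proj bE /series/= big_mkord.
Qed.

Lemma basis_proj_sum a N m : (N <= m)%N ->
  basis_proj e N (\sum_(k < m) a k *: e k) = \sum_(k < N) a k *: e k.
Proof.
move=> Nm; pose b k := if (k < m)%N then a k else 0.
have bc : series (fun k => b k *: e k) @ \oo --> \sum_(k < m) a k *: e k.
  apply: cvg_near_cst; exists m => // n /= mn.
  rewrite /series/= big_mkord (big_ord_widen _ (fun k => a k *: e k) mn).
  rewrite [RHS]big_mkcond; apply: eq_bigr => k _; rewrite /b.
  by case: ifP => // _; rewrite scale0r.
rewrite /basis_proj (basis_coef_eq bc); apply: eq_bigr => k _.
by rewrite /b (leq_trans (ltn_ord k) Nm).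
Qed.

Lemma basis_neq0 k : e k != 0.
Proof.
apply/eqP => ek0.
have h (c : R[i]) :
    series (fun j => (if j == k then c else 0) *: e j) @ \oo --> (0 : X).
  apply: cvg_near_cst; apply: nearW => n; rewrite /series/= big1// => j _.
  by case: eqP => [->|_]; rewrite ?ek0 ?scaler0 ?scale0r.
have := basis_coef_eq (h 1); rewrite (basis_coef_eq (h 0)) => /(congr1 (@^~ k)).
by rewrite eqxx => /esym/eqP; rewrite oner_eq0.
Qed.

End basis_facts.

(** * Bases from uniformly bounded partial sums and a dense span *)

Section basis_criterion.
Context {R : realType} (X : normedModType R[i]).
Variables (f : nat -> X) (C : R).
Let psum (a : nat -> R[i]) n := \sum_(k < n) a k *: f k.

Hypothesis C0 : 0 <= C.
Hypothesis fC : forall (a : nat -> R[i]) n m, (n <= m)%N ->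
  rnorm (\sum_(k < n) a k *: f k) <= C * rnorm (\sum_(k < m) a k *: f k).
Hypothesis f0 : forall k, f k != 0.
Hypothesis fdense : forall x (e : R), 0 < e ->
  exists m (a : nat -> R[i]), rnorm (x - \sum_(k < m) a k *: f k) < e.

Let psumB (a b : nat -> R[i]) n : psum (fun k => a k - b k) n = psum a n - psum b n.
Proof. by rewrite /psum -sumrB; apply: eq_bigr => k _; rewrite scalerBl. Qed.

Let series_psum (a : nat -> R[i]) : series (fun k => a k *: f k) = psum a.
Proof. by apply/funext => n; rewrite /series/= big_mkord. Qed.

Let coef_le (a : nat -> R[i]) k m : (k < m)%N ->
  normc (a k) * rnorm (f k) <= 2 * C * rnorm (psum a m).
Proof.
move=> km; rewrite -rnormZ.
have -> : a k *: f k = psum a k.+1 - psum a k.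
  by rewrite /psum big_ord_recr/= addrAC subrr add0r.
rewrite (le_trans (rnormD _ _))// rnormN -mulrA mulr2n mulrDl mul1r.
by rewrite lerD// fC// ltnW.
Qed.

Let coef_unique (a a' : nat -> R[i]) (x : X) : psum a @ \oo --> x -> psum a' @ \oo --> x -> a = a'.
Proof.
move=> ax ax'; apply/funext => k; apply/eqP; rewrite -subr_eq0; apply/eqP.
apply: eq0_normc; have fk := rnorm_gt0 (f0 k).
apply/eqP; rewrite eq_le normc_ge0 andbT.
rewrite -(ler_pM2r fk) mul0r; apply/ler_addgt0Pl => e e0; rewrite addr0.
pose e' := e / (4 * (C + 1)); have e'0 : 0 < e'.
  by rewrite divr_gt0// mulr_gt0// ltr_wpDl.
have [N _ HN] := (cvg_rnormP _ _).1 ax e' e'0.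
have [N' _ HN'] := (cvg_rnormP _ _).1 ax' e' e'0.
pose m := maxn k.+1 (maxn N N').
have := @coef_le (fun k => a k - a' k) k m.
rewrite leq_maxl psumB => /(_ isT) h; apply: (le_trans h).
have h1 := HN m; have h2 := HN' m.
rewrite /= in h1 h2; have {}h1 : rnorm (x - psum a m) < e'.
  by apply: h1; rewrite /m !leq_max leqnn !orbT.
have {}h2 : rnorm (x - psum a' m) < e'.
  by apply: h2; rewrite /m !leq_max leqnn !orbT.
have : rnorm (psum a m - psum a' m) <= 2 * e'.
  rewrite -(subrKA x) (le_trans (rnormD _ _))// rnormB.
  by move: h1 h2; move: (rnorm _) (rnorm _) => u v; lra.
move=> /(ler_wpM2l (mulr_ge0 (ler0n _ 2) C0)) /le_trans; apply.
rewrite (_ : 2 * C * (2 * e') = C / (C + 1) * e); last first.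
  by rewrite /e'; field; rewrite gt_eqF// ltr_wpDl.
by rewrite ler_piMl ?(ltW e0)// ler_pdivrMr ?mul1r ?lerDl// ltr_wpDl.
Qed.

(** The approximants [y j] tend to [x] by choice, so only the scalar coefficients need limits. By
    [coef_le] each coefficient of [y j] converges as [j] grows, and the uniform bound [C] passes to
    the limit in [lim_le]. *)
Lemma basis_criterion : schauder_basis f.
Proof.
move=> x; have e20 n : 0 < 2^-1 ^+ n :> R by rewrite exprn_gt0// invr_gt0.
have /choice[M /choice[a0 yx]] : forall j, exists m, exists a,
    rnorm (x - psum a m) < 2^-1 ^+ j.
  by move=> j; have [m [a h]] := fdense x (e20 j); exists m, a.
(* Cut off at [M j], the partial sums of [b j] are stationary from there on, so approximants of
   different lengths can be compared at a common index. *)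
pose b j k := if (k < M j)%N then a0 j k else 0.
pose y j := psum (a0 j) (M j).
have yE j m : (M j <= m)%N -> psum (b j) m = y j.
  move=> Mm; rewrite /y /psum (big_ord_widen _ (fun k => a0 j k *: f k) Mm).
  rewrite [RHS]big_mkcond; apply: eq_bigr => k _; rewrite /b.
  by case: ifP => // _; rewrite scale0r.
have bB n i j : rnorm (psum (fun k => b i k - b j k) n) <= C * rnorm (y i - y j).
  pose m := maxn n (maxn (M i) (M j)).
  have mi : (M i <= m)%N by rewrite /m !leq_max leqnn !orbT.
  have mj : (M j <= m)%N by rewrite /m !leq_max leqnn !orbT.
  by rewrite -(yE i m mi) -(yE j m mj) -psumB; apply: fC; rewrite leq_maxl.
have yij i j : (j <= i)%N -> rnorm (y i - y j) <= 2 * 2^-1 ^+ j.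
  move=> ji; rewrite -(subrKA x) (le_trans (rnormD _ _))// rnormB.
  have := yx i; have := yx j; rewrite -/(y i) -/(y j).
  have : 2^-1 ^+ i <= 2^-1 ^+ j :> R.
    by rewrite ler_wiXn2l// ?invr_ge0// invf_le1// ler1n.
  by move: (rnorm _) (rnorm _) => u v; lra.
have /choice[a aE] : forall k, exists l : R[i], forall e : R, 0 < e ->
    \forall n \near \oo, normc (l - b n k) < e.
  move=> k; have fk := rnorm_gt0 (f0 k).
  apply: (@complex_geometric_cvg _ _ (2 * C * (C * 2) / rnorm (f k))).
    by rewrite !mulr_ge0 ?invr_ge0 ?rnorm_ge0.
  move=> n; rewrite mulrAC ler_pdivlMr//.
  apply: le_trans (@coef_le (fun k => b n k - b n.+1 k) k k.+1 (ltnSn k)) _.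
  rewrite -[leRHS]mulrA; apply: ler_wpM2l; first by rewrite mulr_ge0.
  apply: le_trans (bB _ _ _) _; rewrite -[leRHS]mulrA; apply: ler_wpM2l => //.
  by rewrite rnormB; exact: yij.
have lim_le n j : rnorm (psum (fun k => a k - b j k) n) <= C * (2 * 2^-1 ^+ j).
  apply/ler_addgt0Pl => e e0.
  pose D := \sum_(k < n) rnorm (f k).
  have D0 : 0 <= D by apply: sumr_ge0 => k _; exact: rnorm_ge0.
  pose e' := e / (D + 1); have e'0 : 0 < e' by rewrite divr_gt0// ltr_wpDl.
  have : \forall i \near \oo, forall k : 'I_n, normc (a k - b i k) < e'.
    by apply: filter_forall => k; exact: aE.
  move=> [N _ HN]; pose i := maxn j N.
  have Hi k : normc (a (k : 'I_n) - b i k) < e' by apply: HN; rewrite /= leq_maxr.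
  have -> : psum (fun k => a k - b j k) n =
      psum (fun k => a k - b i k) n + psum (fun k => b i k - b j k) n.
    by rewrite !psumB subrKA.
  apply: le_trans (rnormD _ _) _; apply: lerD; last first.
    apply: le_trans (bB _ _ _) _; apply: ler_wpM2l => //.
    by apply: yij; rewrite leq_maxl.
  apply: le_trans (rnorm_sum _ _) _.
  apply: (@le_trans _ _ (\sum_(k < n) e' * rnorm (f k))).
    apply: ler_sum => k _; rewrite rnormZ ler_wpM2r ?rnorm_ge0//.
    exact/ltW/Hi.
  rewrite -mulr_sumr -/D /e' mulrAC ler_pdivrMr ?ltr_wpDl//.
  by rewrite ler_wpM2l ?(ltW e0)// lerDl.
have acv : psum a @ \oo --> x.
  apply/cvg_rnormP => e e0; have C1 : 0 < 2 * C + 1 by rewrite ltr_wpDl// mulr_ge0.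
  have : (fun n => 2^-1 ^+ n : R) @ \oo --> 0.
    by apply: cvg_expr; rewrite ger0_norm ?invr_ge0// invf_lt1 ?ltr1n.
  move=> /cvgrPdist_lt/(_ (e / (2 * C + 1)) (divr_gt0 e0 C1))[j _ /(_ j (leqnn j))].
  rewrite /= sub0r normrN ger0_norm ?(ltW (e20 j))// ltr_pdivlMr// => hj.
  exists (M j) => // n /= Mn; rewrite -(subrKA (y j)).
  apply: le_lt_trans hj; apply: le_trans (rnormD _ _) _.
  have := lim_le n j; rewrite psumB (yE j n Mn) rnormB => h1.
  have := yx j; rewrite -/(y j) => /ltW h2.
  by move: (lerD h2 h1); move: (rnorm _ + rnorm _) => z; lra.
exists a; split=> [|a']; rewrite series_psum//.
exact: coef_unique acv.
Qed.

End basis_criterion.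

Lemma subr_convex (K : pzRingType) (V : lmodType K) (c : K) (u w : V) :
  u - c *: w = (1 - c) *: u + c *: (u - w).
Proof. by rewrite scalerBr scalerBl scale1r addrA subrK. Qed.

(** * Density of the span *)

Section density_of_span.
Context {R : realType} d (T : measurableType d) (mu : {measure set T -> \bar R}).
Context (p : R) (p1 : 1 <= p).
Let q := p / 2.
Let p0 : 0 < p. Proof. exact: lt_le_trans p1. Qed.
Let q0 : 0 < q. Proof. by rewrite divr_gt0. Qed.
Local Notation X := (cLp mu p1).

Lemma ae_cvg_subseq (u : nat -> X) (x : X) : u @ \oo --> x ->
  exists N : nat -> nat, (forall j, (0 < N j)%N) /\
  \forall t \ae mu, normc ((x - u (N j) : X) t) @[j --> \oo] --> 0.
Proof.
move=> /cvg_rnormP ux.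
have dl0 j : 0 < (4^-1 ^+ j) `^ p^-1 :> R by rewrite powR_gt0// exprn_gt0// invr_gt0.
have /choice[N HN] : forall j, exists n, (0 < n)%N /\
    rnorm (x - u n) < (4^-1 ^+ j) `^ p^-1.
  move=> j; have [n _ hn] := ux _ (dl0 j).
  (* The index 0 is avoided because the weighted estimate is available for [proj N] with [N]
     positive. *)
  by exists (maxn n 1); rewrite leq_maxr; split => //; apply: hn; rewrite /= leq_maxl.
exists N; split=> [j|]; first by have [] := HN j.
have : \forall t \ae mu, sqmod (x - u (N j) : X) t `^ q @[j --> \oo] --> 0.
  apply: ae_cvg0_fast => [j|j t|j]; [|exact: powR_ge0|].
    exact: L1_sqmod (memLp_cLp _).
  have [_ hj] := HN j.
  have -> : \int[mu]_t (sqmod (x - u (N j) : X) t `^ q) = rnorm (x - u (N j)) `^ p.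
    have /(congr1 (fun z : R => z `^ q)) := rnorm_sqr (x - u (N j)).
    rewrite -powRrM mulVf ?gt_eqF// powRr1; last first.
      by apply: Rintegral_ge0 => t _; exact: powR_ge0.
    move=> <-; rewrite -powR_mulrn ?rnorm_ge0// -powRrM; congr (_ `^ _).
    by rewrite /q; field.
  apply: (@le_trans _ _ (((4^-1 ^+ j) `^ p^-1) `^ p)).
    by apply: (ge0_ler_powR (ltW p0)); rewrite ?nnegrE ?rnorm_ge0 ?powR_ge0// ltW.
  by rewrite -powRrM mulVf ?gt_eqF// powRr1// exprn_ge0// invr_ge0.
apply: filterS => t h; apply/cvgrPdist_lt => e e0.
move/cvgrPdist_lt : h => /(_ _ (powR_gt0 p e0)); apply: filterS => j.
rewrite !sub0r !normrN (ger0_norm (powR_ge0 _ _)) (ger0_norm (normc_ge0 _)).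
rewrite sqmod_powR; apply: contraTT; rewrite -!leNgt => h.
by apply: (ge0_ler_powR (ltW p0)); rewrite ?nnegrE ?normc_ge0// ltW.
Qed.

(** [Dom] stands for the vectors on which the weighted estimate is known; it will be the weighted
    L^2 condition for the initial density. *)
Variables (e : nat -> X) (W : T -> R) (Dom : X -> Prop) (l : R).
Hypothesis be : schauder_basis e.
Let proj N (x : X) : X := basis_proj e N x.
Hypotheses (mW : measurable_fun setT W) (W0 : forall t, 0 <= W t).
Hypothesis Dom_e : forall k, Dom (e k).
Hypothesis Dom_lin : forall c x y, Dom x -> Dom y -> Dom (c *: x + y).
Hypothesis l0 : 0 <= l.
Hypothesis projW : forall N x, (0 < N)%N -> Dom x ->
  [/\ L2w mu W x, L2w mu W (proj N x) &
    \int[mu]_t (sqmod (proj N x) t * W t) <=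
    l * \int[mu]_t (sqmod x t * W t)].

Definition in_span (y : X) := exists m (a : nat -> R[i]), y = \sum_(k < m) a k *: e k.

Lemma in_spanD (c : R[i]) y z : in_span y -> in_span z -> in_span (c *: y + z).
Proof.
move=> [m [a ->]] [n [b ->]].
exists (maxn m n), (fun k => c * (if (k < m)%N then a k else 0) +
  if (k < n)%N then b k else 0).
rewrite (big_ord_widen _ (fun k => a k *: e k) (leq_maxl m n)).
rewrite (big_ord_widen _ (fun k => b k *: e k) (leq_maxr m n)).
rewrite big_mkcond [X in _ + X]big_mkcond scaler_sumr -big_split/=.
apply: eq_bigr => k _; rewrite scalerDl -scalerA.
by do 2 case: ifP => _; rewrite ?scale0r ?scaler0.
Qed.

Lemma in_span_proj N x : in_span (proj N x).
Proof. by exists N, (basis_coef e x). Qed.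

Lemma Dom_span y : in_span y -> Dom y.
Proof.
have XX0 : Dom 0 by have := Dom_lin (-1) (Dom_e 0) (Dom_e 0); rewrite scaleN1r addNr.
move=> [m [a ->]]; elim: m => [|m ih]; first by rewrite big_ord0.
by rewrite big_ord_recr/= addrC; exact: Dom_lin.
Qed.

Let n2 (x : X) := \int[mu]_t (sqmod x t * W t).

Let n2_ge0 x : 0 <= n2 x.
Proof. by apply: Rintegral_ge0 => t _; rewrite mulr_ge0// sqmod_ge0. Qed.

Let Dom_L2w x : Dom x -> L2w mu W x.
Proof. by move=> /(projW (ltnSn 0))[]. Qed.

Let tail u N : (0 < N)%N -> Dom u ->
  Dom (u - proj N u) /\ n2 (u - proj N u) <= 2 * (1 + l) * n2 u.
Proof.
move=> N0 Xu; have [Lu LP P_le] := projW N0 Xu.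
set z := proj N u in LP P_le *.
have Xv : Dom (u - z).
  rewrite addrC -scaleN1r; apply: Dom_lin => //.
  exact/Dom_span/in_span_proj.
split => //; have Lv := Dom_L2w Xv.
apply: (@le_trans _ _ (\int[mu]_t (2 * (sqmod u t * W t + sqmod z t * W t)))).
  apply: ae_Rint_le => //.
  - by apply: L1Z; exact: L1D.
  - by move=> t; rewrite mulr_ge0// sqmod_ge0.
  - by move=> t; rewrite mulr_ge0// addr_ge0// mulr_ge0// sqmod_ge0.
  - move: (cLpDE u (- z)) (cLpNE z).
    apply: filterS2 => t h1 h2; rewrite /sqmod h1// h2//.
    have zN : normc (z t) = normc (- z t) by rewrite normcN.
    rewrite zN -mulrDl mulrA; apply: ler_wpM2r => //.
    exact: (sqmodD_le (fun=> u t) (fun=> - z t) t).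
rewrite RintegralZl//; last exact: L1D.
rewrite RintegralD// -mulrA; apply: ler_wpM2l => //.
by rewrite mulrDl mul1r lerD2l.
Qed.

(** In the limit, [step] obtains the factor [(1-th)^2 + c th^2], where [c] is the 3 of [key] times
    the [2 (1+l)] of [tail]. The chosen [th] minimises it, and the minimum is [1 - th]. *)
Let c := 6 * (1 + l).
Let th := (1 + c)^-1.
Let c0 : 0 < c. Proof. by rewrite mulr_gt0// ltr_pwDl. Qed.
Let th0 : 0 < th. Proof. by rewrite invr_gt0 ltr_wpDr// ltW. Qed.
Let th1 : th <= 1. Proof. by rewrite invf_le1 ?lerDl ?ltW// ltr_wpDr// ltW. Qed.

Let step u dl : Dom u ->
  (forall N, (0 < N)%N -> dl <= n2 (u - th%:C *: proj N u)) ->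
  dl <= (1 - th) * n2 u.
Proof.
move=> Xu dlN; have Lu := Dom_L2w Xu.
have [N [N0 vcvg]] := @ae_cvg_subseq (fun N => proj N u) u (@basis_proj_cvg R X e be u).
pose v j : X := u - proj (N j) u.
pose U t := normc (u t); pose V j t := normc (v j t).
(* Truncated at [U / th], the cross term [U * V] is dominated; [V ^ 2] absorbs the rest. *)
pose m j t := Num.min (V j t) (th^-1 * U t) * U t * W t.
have U0 t : 0 <= U t by exact: normc_ge0.
have V0 j t : 0 <= V j t by exact: normc_ge0.
have m0 j t : 0 <= m j t.
  rewrite mulr_ge0// mulr_ge0// le_min V0 mulr_ge0// invr_ge0 ltW//.
have UU t : sqmod u t * W t = U t * U t * W t by rewrite /sqmod expr2.
have mUt : measurable_fun setT U by apply: measurable_normc; exact: cmeasurable_cLp.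
have mVt j : measurable_fun setT (V j) by apply: measurable_normc; exact: cmeasurable_cLp.
have mm j : measurable_fun setT (m j).
  apply: measurable_funM => //; apply: measurable_funM => //.
  apply: measurable_minr => //; apply: measurable_funM => //; exact: measurable_cst.
have m_le j t : m j t <= th^-1 * (sqmod u t * W t).
  rewrite UU !mulrA ler_wpM2r// ler_wpM2r// ge_min lexx orbT//.
have [_ Lm cvm] : [/\ L1 mu (fun=> 0), (forall j, L1 mu (m j)) &
    \int[mu]_t m j t @[j --> \oo] --> \int[mu]_t (0 : R)].
  apply: (@Rint_dct R _ T mu m (fun=> 0) (fun t => th^-1 * (sqmod u t * W t))) => //.
  - apply: filterS vcvg => t vt.
    apply: (@squeeze_cvgr _ _ _ _ (fun=> 0) (fun j => V j t * (U t * W t))).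
    + apply: nearW => j; rewrite m0/= /m -mulrA ler_wpM2r ?mulr_ge0//.
      by rewrite ge_min lexx.
    + exact: cvg_cst.
    + by rewrite -[X in _ --> X](mul0r (U t * W t)); apply: cvgMr_tmp.
  - exact: L1Z.
  - by apply: nearW => t j; rewrite ger0_norm.
rewrite Rintegral_cst// mul0r in cvm.
(* In the expansion of [((1-th) U + th V)^2] the cross term costs [2 th m + 2 th^2 V^2]; with the
   square [th^2 V^2] this makes the factor 3. *)
have key j : dl <= (1 - th) ^+ 2 * n2 u + 3 * th ^+ 2 * n2 (v j)
    + 2 * th * \int[mu]_t m j t.
  have [Xv _] := tail (N0 j) Xu; have Lv := Dom_L2w Xv.
  apply: (le_trans (dlN _ (N0 j))).
  have -> : u - th%:C *: proj (N j) u = (1 - th%:C) *: u + th%:C *: v j.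
    exact: subr_convex.
  have Xw : Dom ((1 - th%:C) *: u + th%:C *: v j).
    apply: Dom_lin => //; rewrite -[th%:C *: _]addr0; apply: Dom_lin => //.
    by have := Dom_lin (-1) (Dom_e 0) (Dom_e 0); rewrite scaleN1r addNr.
  have Lw := Dom_L2w Xw; move: Lw {Xw}; set w : X := _ + _ => Lw.
  apply: (@le_trans _ _ (\int[mu]_t ((1 - th) ^+ 2 * (sqmod u t * W t)
      + 3 * th ^+ 2 * (sqmod (v j) t * W t) + 2 * th * m j t))).
    have mm0 t : 0 <= (1 - th) ^+ 2 * (sqmod u t * W t)
        + 3 * th ^+ 2 * (sqmod (v j) t * W t) + 2 * th * m j t.
      have th2 : 0 <= 2 * th by rewrite mulr_ge0// ltW.
      have sW (y : X) : 0 <= sqmod y t * W t by rewrite mulr_ge0// sqmod_ge0.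
      apply: addr_ge0; [apply: addr_ge0|exact: mulr_ge0].
        by apply: mulr_ge0 => //; exact: sqr_ge0.
      by apply: mulr_ge0 => //; apply: mulr_ge0 => //; exact: sqr_ge0.
    apply: ae_Rint_le => //.
    - by apply: L1D; [apply: L1D; exact: L1Z|exact: L1Z].
    - by move=> t; rewrite mulr_ge0// sqmod_ge0.
    move: (cLpDE ((1 - th%:C) *: u) (th%:C *: v j)) (cLpZE (1 - th%:C) u)
      (cLpZE th%:C (v j)).
    apply: filterS3 => t h1 h2 h3.
    have le_w : normc (w t) <= (1 - th) * U t + th * V j t.
      rewrite h1// h2// h3//; apply: le_trans (normcD _ _) _.
      rewrite !normcM normc_real (ger0_norm (ltW th0)).
      have -> : 1 - th%:C = (1 - th)%:C by rewrite rmorphB.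
      by rewrite normc_real ger0_norm// subr_ge0.
    have sq_w : sqmod (w : X) t <= ((1 - th) * U t + th * V j t) ^+ 2.
      by rewrite ler_sqr ?nnegrE ?normc_ge0// (le_trans (normc_ge0 _) le_w).
    have UV : V j t * U t <= Num.min (V j t) (th^-1 * U t) * U t + th * V j t ^+ 2.
      have [h|h] := leP (V j t) (th^-1 * U t).
        by rewrite lerDl mulr_ge0 ?sqr_ge0// ltW.
      rewrite -[leLHS]add0r lerD//; first by rewrite !mulr_ge0// invr_ge0 ltW.
      rewrite expr2 mulrCA ler_wpM2l// -ler_pdivrMl//.
      exact: ltW.
    have -> : (1 - th) ^+ 2 * (sqmod u t * W t)
        + 3 * th ^+ 2 * (sqmod (v j) t * W t) + 2 * th * m j t =
      ((1 - th) ^+ 2 * sqmod u t + 3 * th ^+ 2 * sqmod (v j) t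
        + 2 * th * (Num.min (V j t) (th^-1 * U t) * U t)) * W t.
      by rewrite /m; ring.
    apply: ler_wpM2r => //; apply: (le_trans sq_w).
    have uE : sqmod u t = U t ^+ 2 by [].
    have vE : sqmod (v j) t = V j t ^+ 2 by [].
    have := mulr_ge0 (V0 j t) (U0 t); move: UV; rewrite uE vE.
    move: (U t) (V j t) (Num.min _ _ * _) => x y M UV xy.
    have th2 : 0 <= 2 * th by rewrite mulr_ge0// ltW.
    have h4 := ler_wpM2l th2 UV.
    have h5 : 0 <= th ^+ 2 * (y * x) by rewrite mulr_ge0// sqr_ge0.
    by move: h4 h5; lra.
  rewrite RintegralD//; [|by apply: L1D; exact: L1Z|exact: L1Z].
  rewrite RintegralD//; [|exact: L1Z|exact: L1Z].
  rewrite RintegralZl; [|by []|exact: Lu].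
  rewrite RintegralZl; [|by []|exact: Lv].
  by rewrite RintegralZl; [|by []|exact: Lm].
have th1c : th * (1 + c) = 1 by rewrite mulVf// gt_eqF// ltr_wpDr// ltW.
apply: (@ler_cvg_to nat \oo _ R (fun=> dl)
  (fun j => (1 - th) * n2 u + 2 * th * \int[mu]_t m j t)).
- exact: cvg_cst.
- rewrite -[X in _ --> X]addr0; apply: cvgD; first exact: cvg_cst.
  by rewrite -[X in _ --> X](mulr0 (2 * th)); apply: cvgMl_tmp.
- apply: nearW => j; apply: le_trans (key j) _; rewrite lerD2r.
  have [_ hv] := tail (N0 j) Xu.
  have h3 : 0 <= 3 * th ^+ 2 by rewrite mulr_ge0 ?sqr_ge0.
  have := ler_wpM2l h3 hv; rewrite -/(v j); move: (n2 u) (n2 (v j)) => x y h.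
  have -> : (1 - th) * x = (1 - th) ^+ 2 * x + 3 * th ^+ 2 * (2 * (1 + l) * x).
    have -> : 3 * th ^+ 2 * (2 * (1 + l) * x) = th * (th * (1 + c) - th) * x.
      by rewrite /c; ring.
    by rewrite th1c; ring.
  by rewrite lerD2l.
Qed.

Lemma span_dense x : Dom x -> forall ep : R, 0 < ep ->
  exists m (a : nat -> R[i]), n2 (x - \sum_(k < m) a k *: e k) < ep.
Proof.
move=> Xx; pose E := [set n2 (x - y) | y in in_span].
have E0 : E !=set0.
  by exists (n2 (x - 0)); exists 0 => //; exists 0%N, (fun=> 0); rewrite big_ord0.
have lE : lbound E 0 by move=> _ [y _ <-].
have hE : has_inf E by split => //; exists 0.
pose dl := inf E.
have dl0 : 0 <= dl by exact: lb_le_inf.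
have dlE y : in_span y -> dl <= n2 (x - y).
  by move=> My; apply: ge_inf; [exists 0|exists y].
have {}dl0 : dl = 0.
  apply/eqP; rewrite eq_le dl0 andbT.
  (* For a near-minimiser [y], [step] gives [dl <= (1 - th) * (dl + ep)]: subtracting
     [th%:C *: proj N (x - y)] stays within [x] plus the span. *)
  have h : dl <= (1 - th) * dl.
    apply/ler_addgt0Pl => ep ep0.
    have [_ [y My <-] yE] := inf_adherent ep0 hE.
    have Xu : Dom (x - y).
      by rewrite addrC -scaleN1r; apply: Dom_lin => //; exact: Dom_span.
    apply: (@le_trans _ _ ((1 - th) * n2 (x - y))).
      apply: step => // N N0; rewrite -addrA -opprD; apply: dlE.
      rewrite addrC; apply: in_spanD => //; exact: in_span_proj.
    have th1' : 0 <= 1 - th by rewrite subr_ge0.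
    apply: (le_trans (ler_wpM2l th1' (ltW yE))).
    rewrite mulrDr addrC lerD2r ler_piMl ?(ltW ep0)//.
    by rewrite gerBl ltW.
  have : th * dl <= 0 by move: h; rewrite mulrBl mul1r; lra.
  by rewrite pmulr_rle0.
move=> ep ep0; have [_ [y [m [a ->]] <-]] := inf_adherent ep0 hE.
by rewrite -/dl dl0 add0r => h; exists m, a.
Qed.

End density_of_span.

(** * Transfer to the weighted L2 space *)

Section transfer.
Context {R : realType} d (T : measurableType d) (mu : {measure set T -> \bar R}).
Context (p : R) (p1 : 1 <= p) (g : density mu).
Let p0 : 0 < p. Proof. exact: lt_le_trans p1. Qed.
Local Notation X := (cLp mu p1).
Local Notation nu := (dmeasure g).
Local Notation X2 := (cLp nu (ler12 R)).
Local Notation W := (dweight p g).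

Lemma ae_dmeasure (A : T -> Prop) : (\forall t \ae mu, A t) ->
  \forall t \ae nu, A t.
Proof.
move=> [N [mN N0 sub]]; exists N; split => //.
rewrite /= /dmeasure; apply: null_set_integral => //.
apply/measurable_EFinP; apply: measurable_funS (density_measurable g) => //.
Qed.

Lemma cmeasurable_phi_fun (z : T -> R[i]) : cmeasurable z ->
  cmeasurable (phi_fun g p z).
Proof.
move=> mz; apply: cmeasurableM => //; split=> /=; last exact: measurable_cst.
exact/measurable_fun_powR/density_measurable.
Qed.

Lemma sqmod_phi_fun (z : T -> R[i]) t :
  sqmod (phi_fun g p z) t * g t = sqmod z t * W t.
Proof.
have g0 := density_gt0 g t.
rewrite /phi_fun /sqmod normcM exprMn normc_real ger0_norm ?powR_ge0//.
rewrite mulrAC mulrC; congr (_ * _).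
rewrite -powR_mulrn ?powR_ge0// -powRrM -{2}(powRr1 (ltW g0)) -gt0_powRD//.
by congr (_ `^ _); field; rewrite gt_eqF.
Qed.

Lemma L1_phi_fun (z : T -> R[i]) : cmeasurable z ->
  L1 nu (sqmod (phi_fun g p z)) <-> L2w mu W z.
Proof.
move=> mz; have mp := measurable_sqmod (cmeasurable_phi_fun mz).
split=> [/(L1_dmeasure g mp (sqmod_ge0 _))|Lz].
  by rewrite /L2w; under eq_fun do rewrite sqmod_phi_fun.
apply: (L1_dmeasure g mp (sqmod_ge0 _)).2.
by under eq_fun do rewrite sqmod_phi_fun.
Qed.

Lemma memL2_phi_fun (z : T -> R[i]) : cmeasurable z -> L2w mu W z ->
  memLp nu 2 (phi_fun g p z).
Proof.
move=> mz Lz; apply: memLpP; first exact: cmeasurable_phi_fun.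
under eq_fun do rewrite divff// powRr1 ?sqmod_ge0//.
exact/L1_phi_fun.
Qed.

Lemma rnorm_L2 (Y : X2) (z : T -> R[i]) : cmeasurable z ->
  Y = phi_fun g p z %[ae nu] ->
  rnorm Y ^+ 2 = \int[mu]_t (sqmod z t * W t).
Proof.
move=> mz Yz; rewrite rnorm_sqr divff// invr1 powRr1; last first.
  by apply: Rintegral_ge0 => t _; exact: powR_ge0.
have mp := cmeasurable_phi_fun mz.
rewrite (@eq_ae_sqmod _ _ _ _ Y (phi_fun g p z) (fun x => x `^ 1))//; last 2 first.
- exact: cmeasurable_cLp.
- by move=> x; exact: powR_ge0.
under eq_Rintegral do rewrite powRr1 ?sqmod_ge0//.
rewrite Rint_dmeasure; [|exact: measurable_sqmod|exact: sqmod_ge0].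
by apply: eq_Rintegral => t _; rewrite sqmod_phi_fun.
Qed.

Lemma phi_ae (x : X) : (phi g x : T -> R[i]) = phi_fun g p x %[ae nu].
Proof. exact: phiE. Qed.

(** The same function viewed in L^2(g dmu). Since [toLp] returns 0 for functions outside the space,
    linearity and the norm formula are stated under [L2w]. *)
Definition toL2 (x : X) : X2 := toLp nu (ler12 R) (phi g x).

Lemma memL2_phi (x : X) : L2w mu W x -> memLp nu 2 (phi g x).
Proof.
move=> Lx; have mx := cmeasurable_cLp x.
have [mp fp] := memL2_phi_fun mx Lx.
have mphi : cmeasurable (phi g x) by have [] := memLp_cLp (phi g x).
by split => //; rewrite (cmeasurable_ae_cLnorm 2 mphi mp (phi_ae x)).
Qed.

Lemma toL2_ae (x : X) : L2w mu W x -> toL2 x = phi_fun g p x %[ae nu].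
Proof.
move=> Lx; have := toLpK (ler12 R) (memL2_phi Lx).
by move/ae_eq_trans; apply; exact: phi_ae.
Qed.

Lemma rnorm_toL2 (x : X) : L2w mu W x ->
  rnorm (toL2 x) ^+ 2 = \int[mu]_t (sqmod x t * W t).
Proof. by move=> Lx; apply: rnorm_L2; [exact: cmeasurable_cLp|exact: toL2_ae]. Qed.

Let mW : measurable_fun setT W. Proof. exact: measurable_dweight. Qed.
Let W0 t : 0 <= W t. Proof. exact: dweight_ge0. Qed.

Lemma toL2_lin (c : R[i]) (x y : X) : L2w mu W x -> L2w mu W y ->
  toL2 (c *: x + y) = c *: toL2 x + toL2 y.
Proof.
move=> Lx Ly; apply: cLpP.
have Lxy := L2w_lin mW W0 c Lx Ly.
have h1 := toL2_ae Lxy; have h2 := toL2_ae Lx; have h3 := toL2_ae Ly.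
have h4 := ae_dmeasure (cLpDE (c *: x) y); have h5 := ae_dmeasure (cLpZE c x).
have h6 := cLpDE (c *: toL2 x) (toL2 y); have h7 := cLpZE c (toL2 x).
apply: filterS2 (filterI h1 (filterI h2 h3)) (filterI (filterI h4 h5) (filterI h6 h7)).
move=> t [/= e1 [e2 e3]] [[e4 e5] [e6 e7]] _.
rewrite e1// e6// e7// e2// e3// /phi_fun e4// e5//.
by rewrite mulrDr mulrCA.
Qed.

Lemma toL2_0 : toL2 0 = 0.
Proof.
have L0 : L2w mu W (0 : X) by exact: L2w0.
by have := toL2_lin (-1) L0 L0; rewrite !scaleN1r !addNr.
Qed.

Lemma toL2_sum n (a : nat -> R[i]) (x : nat -> X) :
  (forall k, L2w mu W (x k)) ->
  toL2 (\sum_(k < n) a k *: x k) = \sum_(k < n) a k *: toL2 (x k).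
Proof.
move=> Lx; elim: n => [|n ih]; first by rewrite !big_ord0 toL2_0.
rewrite !big_ord_recr/= addrC toL2_lin//; first by rewrite ih addrC.
exact: L2w_sum.
Qed.

(** The weight is positive at every point, so a vanishing weighted norm forces [x] to vanish almost
    everywhere. *)
Lemma toL2_neq0 (x : X) : L2w mu W x -> x != 0 -> toL2 x != 0.
Proof.
move=> Lx; apply: contra_neq => x0; apply: cLpP.
have := rnorm_toL2 Lx; rewrite x0 rnorm0 expr0n/= => /esym I0.
have ms : measurable_fun setT (fun t => (sqmod x t * W t)%:E).
  by apply/measurable_EFinP/measurable_sqmodw => //; exact: cmeasurable_cLp.
have : (\int[mu]_t `|(sqmod x t * W t)%:E| = 0)%E.
  have sW t : (0 <= (sqmod x t * W t)%:E)%E by rewrite lee_fin mulr_ge0// sqmod_ge0.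
  under eq_integral => t _ do rewrite (gee0_abs (sW t)).
  by rewrite -EFin_Rintegral// I0.
move=> /(ae_eq_integral_abs mu measurableT ms) h.
move: h (cLp0E mu p1); apply: filterS2 => t /(_ I)[/eqP] h1 h2 _; rewrite h2//.
move: h1; rewrite mulf_eq0 [W t == 0]gt_eqF ?orbF; last first.
  by rewrite powR_gt0// density_gt0.
by rewrite expf_eq0/= => /eqP/eq0_normc.
Qed.

Section dense_truncations.
Variable g0 : density mu.
Local Notation W0' := (dweight p g0).
Hypothesis LW : forall x : X, L2w mu W0' x -> L2w mu W x.

(* Every [F] of [L^2(g dmu)] is [phi_{p,g} z] for a function [z], and [z] is approximated
   by its restrictions to the sets where [phi_{p,g0} z] is bounded. *)
Lemma truncations_dense (F : X2) (ep : R) : 0 < ep ->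
  exists2 x : X, L2w mu W0' x & rnorm (F - toL2 x) < ep.
Proof.
move=> ep0; pose z t : R[i] := (g t `^ p^-1)%:C * F t.
have mF : cmeasurable F by exact: cmeasurable_cLp.
have mz : cmeasurable z.
  apply: cmeasurableM => //; split=> /=; last exact: measurable_cst.
  exact/measurable_fun_powR/density_measurable.
have Fz t : F t = phi_fun g p z t.
  have gt0 := density_gt0 g t; rewrite /phi_fun /z mulrA -rmorphM/= -gt0_powRD//.
  by rewrite addNr powRr0 mul1r.
have Lz : L2w mu W z.
  apply/L1_phi_fun => //; have := L1_sqmod (ler12 R) (memLp_cLp F).
  under eq_fun do rewrite divff// powRr1 ?sqmod_ge0//.
  by rewrite (_ : sqmod F = sqmod (phi_fun g p z))//; apply/funext => t; rewrite /sqmod Fz.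
have [mg0 g00] := (density_measurable g0, density_gt0 g0).
(* This cutoff puts the truncation [y] of [z] in both spaces: [|y|^p <= n^(p/2) g0] and
   [|y|^2 g0^(1-2/p) <= n g0]. *)
pose B n : set T := [set t | sqmod z t <= n%:R * g0 t `^ (2 / p)].
have mB n : measurable (B n).
  rewrite -[B n]setTI; apply: measurable_fun_le => //.
    exact: measurable_sqmod.
  apply: measurable_funM; first exact: measurable_cst.
  exact: measurable_fun_powR.
pose y n t : R[i] := (\1_(B n) t)%:C * z t.
have my n : cmeasurable (y n).
  apply: cmeasurableM => //; split=> /=; last exact: measurable_cst.
  exact: measurable_indic.
have ysq n t : sqmod (y n) t = \1_(B n) t * sqmod z t.
  rewrite /y /sqmod normcM exprMn normc_real indicE.
  by case: (_ \in _); rewrite ?normr0 ?normr1 ?expr1n// expr0n.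
have y_le n t : sqmod (y n) t <= n%:R * g0 t `^ (2 / p).
  rewrite ysq indicE; case: (boolP (t \in B n)) => [/set_mem//|_].
    by rewrite mul1r.
  by rewrite mul0r mulr_ge0 ?powR_ge0.
have Ly n : memLp mu p (y n).
  apply: memLpP => //; apply: (L1_le _ _ (L1Z (n%:R `^ (p / 2)) (L1_density g0))).
    exact/measurable_fun_powR/measurable_sqmod.
  move=> t; rewrite ger0_norm ?powR_ge0//.
  have -> : n%:R `^ (p / 2) * g0 t = (n%:R * g0 t `^ (2 / p)) `^ (p / 2).
    rewrite powRM ?powR_ge0// -powRrM (_ : 2 / p * (p / 2) = 1); last first.
      by field; rewrite gt_eqF.
    by rewrite powRr1 ?(ltW (g00 t)).
  have p20 : 0 <= p / 2 by rewrite divr_ge0// ltW.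
  apply: (ge0_ler_powR p20); rewrite ?nnegrE ?sqmod_ge0//.
  by rewrite mulr_ge0 ?powR_ge0.
pose x n : X := toLp mu p1 (y n).
have xy n : x n = y n %[ae mu] by exact: toLpK.
have Lx0 n : L2w mu W0' (x n).
  apply: (L2w_ae _ _ (my n) _ (ae_eq_sym (xy n))).
  - exact: measurable_dweight.
  - by move=> t; exact: dweight_ge0.
  - exact: cmeasurable_cLp.
  apply: (L1_le _ _ (L1Z n%:R (L1_density g0))).
    by apply: measurable_sqmodw => //; exact: measurable_dweight.
  move=> t; rewrite ger0_norm; last by apply: sqmodw_ge0 => ?; exact: dweight_ge0.
  apply: (@le_trans _ _ (n%:R * g0 t `^ (2 / p) * dweight p g0 t)).
    by rewrite ler_wpM2r ?dweight_ge0.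
  rewrite -mulrA -gt0_powRD// invf_div subrKC powRr1//; exact: ltW.
pose v n t := z t - y n t.
have mv n : cmeasurable (v n).
  have -> : v n = fun t => z t + (-1) * y n t.
    by apply/funext => t; rewrite mulN1r.
  by apply: cmeasurableD => //; apply: cmeasurableM => //; exact: cmeasurable_cst.
have vB n t : B n t -> v n t = 0.
  by move=> Bt; rewrite /v /y indicE mem_set// mul1r subrr.
have v_le n t : sqmod (v n) t <= sqmod z t.
  have [/set_mem Bt|Bt] := boolP (t \in B n).
    by rewrite {1}/sqmod (vB _ _ Bt) normc0 expr0n sqmod_ge0.
  by rewrite /sqmod /v /y indicE (negbTE Bt) mul0r subr0.
have [||||_ _] := @Rint_dct R _ T mu (fun n t => sqmod (v n) t * W t) (fun=> 0)
    (fun t => sqmod z t * W t) _ _ _ Lz.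
- by move=> n; exact: measurable_sqmodw.
- exact: measurable_cst.
- apply: nearW => t; apply: cvg_near_cst.
  have g0t : 0 < g0 t `^ (2 / p) by rewrite powR_gt0.
  exists (Num.truncn (sqmod z t / g0 t `^ (2 / p))).+1 => // n /= hn.
  rewrite /sqmod vB ?normc0 ?expr0n ?mul0r// /B /=.
  rewrite -ler_pdivrMr// (le_trans (ltW (truncnS_gt _)))// ler_nat//.
- by apply: nearW => t n; rewrite ger0_norm ?ler_wpM2r//; exact: sqmodw_ge0.
rewrite Rintegral_cst// mul0r => /cvgrPdist_lt/(_ (ep ^+ 2)).
rewrite exprn_gt0// => /(_ isT)[n _ /(_ n (leqnn n))].
rewrite /= sub0r normrN => hn; exists (x n) => //.
rewrite -ltr_sqr ?nnegrE ?rnorm_ge0 ?(ltW ep0)//.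
apply: le_lt_trans (le_lt_trans (ler_norm _) hn).
apply: eqW; apply: rnorm_L2 => //.
have h1 := toL2_ae (LW (Lx0 n)); have h2 := ae_dmeasure (xy n).
have h3 := cLpDE F (- toL2 (x n)); have h4 := cLpNE (toL2 (x n)).
apply: filterS2 (filterI h1 h2) (filterI h3 h4).
move=> t [e1 e2] [e3 e4] _.
rewrite e3// e4// e1// /phi_fun e2// Fz /phi_fun /v.
by rewrite mulrBr.
Qed.

End dense_truncations.

End transfer.

Theorem proposition5p5 (R : realType)
    (d0 : measure_display) (Omega0 : measurableType d0)
    (P : probability Omega0 R) (eps : nat -> {RV P >-> R})
    (heps : rademacher eps)
    (d : measure_display) (Omega : measurableType d)
    (mu : {sigma_finite_measure set Omega -> \bar R})
    (p : R) (p1 : 1 <= p) (e : nat -> cLp mu p1) :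
  R_basis eps e ->
  exists g : density mu,
    (forall k, memLp (dmeasure g) 2 (phi g (e k))) /\
    schauder_basis (fun k => toLp (dmeasure g) (ler12 R) (phi g (e k))).
Proof.
move=> [be tauR].
(* Over a null space every vector is 0, whereas basis vectors are not. Positive mass is what allows
   a density to be normalised. *)
have muT0 : mu setT != 0%E.
  apply/eqP => mu0; have /eqP := basis_neq0 be 0; apply; apply: cLpP.
  by exists setT; split.
have [||g0 hg0] := exists_dominating_density
    (f := fun k t => sqmod (e k) t `^ (p / 2)) _ _ muT0.
- by move=> k; exact: (L1_sqmod p1 (memLp_cLp (e k))).
- by move=> k t; exact: powR_ge0.
have Le0 k : L2w mu (dweight p g0) (e k).
  by have [c c0 hc] := hg0 k; exact: (L2w_dominated c0 hc).
have mW0 : measurable_fun setT (dweight p g0) by exact: measurable_dweight.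
have W00 t : 0 <= dweight p g0 t by exact: dweight_ge0.
set tau := [set _ | _ in _] in tauR.
have tauP N : (0 < N)%N -> tau (basis_proj e N) by move=> N0; exists N.
(* Each [P_N] maps into the span of the [e k], and these satisfy the weighted L^2 condition for
   [g0]. *)
have [|g [l [l0 H]]] := exists_weighted_bound heps (g0 := g0) tauR.
  move=> S x [N _ <-]; rewrite /basis_proj.
  exact: (L2w_sum mW0 W00 _ _ (fun k : 'I_N => Le0 k)).
have mW : measurable_fun setT (dweight p g) by exact: measurable_dweight.
have W0 t : 0 <= dweight p g t by exact: dweight_ge0.
have LW (x : cLp mu p1) : L2w mu (dweight p g0) x -> L2w mu (dweight p g) x.
  by move=> Lx; have [] := H _ x (tauP 1%N isT) Lx.
have LWe k : L2w mu (dweight p g) (e k) by exact: LW.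
exists g; split=> [k|]; first exact: memL2_phi.
(* [l] bounds squared norms, whence the square root. *)
apply: (@basis_criterion _ _ _ (Num.sqrt l)) => [|a n m nm|k|F ep ep0].
- exact: sqrtr_ge0.
- rewrite -!(toL2_sum _ a LWe).
  (* The R-bounded set starts at [P_1], so the empty partial sum is treated separately. *)
  case: n nm => [|n nm]; first by rewrite big_ord0 toL2_0 rnorm0 mulr_ge0 ?sqrtr_ge0 ?rnorm_ge0.
  have L0 j : L2w mu (dweight p g0) (\sum_(k < j) a k *: e k : cLp mu p1).
    exact: (L2w_sum mW0 W00 _ _ (fun k : 'I_j => Le0 k)).
  rewrite -ler_sqr ?nnegrE ?mulr_ge0 ?sqrtr_ge0 ?rnorm_ge0//.
  rewrite exprMn sqr_sqrtr// !rnorm_toL2; [|exact: LW|exact: LW].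
  have [_ _] := H _ _ (tauP n.+1 isT) (L0 m).
  by rewrite (basis_proj_sum be a nm).
- exact/toL2_neq0/basis_neq0.
(* Density in two stages: the truncations are dense and lie in the domain of the estimate for [g0],
   and [span_dense] approximates each of them. Its bound is on the squared norm, hence
   [(ep / 2) ^+ 2]. *)
- have e2 : 0 < ep / 2 by rewrite divr_gt0.
  have [x Lx Fx] := truncations_dense LW F e2.
  have [|||m [a xa]] := @span_dense _ _ _ mu p p1 e (dweight p g)
    (fun y => L2w mu (dweight p g0) y) l be mW W0 Le0 _ l0 _ x Lx ((ep / 2) ^+ 2).
  + by move=> c y z; exact: L2w_lin.
  + by move=> N y N0 Ly; apply: H Ly; exact: tauP.
  + by rewrite exprn_gt0.
  exists m, a.
  rewrite -(toL2_sum _ a LWe); apply: (rnorm_ltD Fx).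
  rewrite -ltr_sqr ?nnegrE ?rnorm_ge0 ?(ltW e2)//.
  have Ls : L2w mu (dweight p g0) (\sum_(k < m) a k *: e k : cLp mu p1).
    exact: (L2w_sum mW0 W00 _ _ (fun k : 'I_m => Le0 k)).
  have -> : toL2 g x - toL2 g (\sum_(k < m) a k *: e k) =
      toL2 g (x - \sum_(k < m) a k *: e k).
    by rewrite -scaleN1r addrC -toL2_lin ?scaleN1r 1?addrC//; exact: LW.
  rewrite rnorm_toL2//; apply: LW; rewrite addrC -scaleN1r.
  exact: L2w_lin.
Qed.
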